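(* Let $G$ be a group, $N$ a normal subgroup of $G$, and $i:N\hookrightarrow G$ the inclusion map. Consider the map $$\iota_{\mathbb{Q}}:(\mathcal{C}_{\mathbb{Q}}(G,N),\mathrm{scl}_{G,N})\to(\mathcal{C}_{\mathbb{Q}}(G),\mathrm{scl}_G),\qquad c\mapsto c.$$ Then the following hold. (1) A coarse kernel of $\iota_{\mathbb{Q}}$ exists if and only if $\widehat{i^*}(\mathrm{Q}(G)/\mathrm{H}^1(G))$ is norm-closed in $(\mathrm{Q}(N)^G/\mathrm{H}^1(N)^G,D_N)$. (2) Assume that $\widehat{i^*}(\mathrm{Q}(G)/\mathrm{H}^1(G))$ is norm-closed in $(\mathrm{Q}(N)^G/\mathrm{H}^1(N)^G,D_N)$. Then a coarse kernel of $\iota_{\mathbb{Q}}$ is isomorphic, as a coarse group, to a real normed space $V$ such that the continuous dual $V^*$ is isometrically isomorphic to $\mathrm{W}(G,N)$ equipped with the quotient norm of $D_N$. In particular, if $\mathrm{W}(G,N)$ is finite-dimensional, then a coarse kernel of $\iota_{\mathbb{Q}}$ exists and it is isomorphic, as a coarse group, to the continuous dual $\mathrm{W}(G,N)^*$.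
   Context: Quasimorphisms: for a group $H$ and $f:H\to\mathbb{R}$, the defect is $D_H(f)=\sup\{|f(h_1h_2)-f(h_1)-f(h_2)| : h_1,h_2\in H\}$; $f$ is a quasimorphism if $D_H(f)<\infty$, and homogeneous if its restriction to every cyclic subgroup is a homomorphism. $\mathrm{Q}(H)$ is the real vector space of homogeneous quasimorphisms on $H$, $\mathrm{H}^1(H)=\mathrm{Hom}(H,\mathbb{R})$. $\mathrm{Q}(N)^G$ and $\mathrm{H}^1(N)^G$ are the subspaces of $\mathrm{Q}(N)$ and $\mathrm{H}^1(N)$ of elements invariant under conjugation by $G$. The defects $D_N$, $D_G$ induce norms on $\mathrm{Q}(N)^G/\mathrm{H}^1(N)^G$ and $\mathrm{Q}(G)/\mathrm{H}^1(G)$. Restriction $i^*:\mathrm{Q}(G)\to\mathrm{Q}(N)^G$, $\phi\mapsto\phi|_N$, induces $\widehat{i^*}:\mathrm{Q}(G)/\mathrm{H}^1(G)\to\mathrm{Q}(N)^G/\mathrm{H}^1(N)^G$. Define $\mathrm{W}(G,N)=\mathrm{Q}(N)^G/(\mathrm{H}^1(N)^G+i^*\mathrm{Q}(G))$, which is the cokernel of $\widehat{i^*}$; its quotient seminorm from $D_N$ is a norm iff the image of $\widehat{i^*}$ is norm-closed. Chains: for $R\in\{\mathbb{Z},\mathbb{Q}\}$, $\mathrm{C}_k(G;R)$ is the free $R$-module on $G^k$, and $\partial:\mathrm{C}_2(G;R)\to\mathrm{C}_1(G;R)$ is $\partial(g_1,g_2)=g_2-g_1g_2+g_1$. $\mathrm{C}_2'(G,N;R)$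 is the submodule generated by those $(g_1,g_2)$ with $g_1\in N$ or $g_2\in N$. Put $\mathrm{B}_1'(G,N;R)=\partial\mathrm{C}'_2(G,N;R)$, $\mathcal{C}_R(G,N)=\mathrm{C}_1(N;R)\cap\mathrm{B}'_1(G,N;R)$, and $\mathcal{C}_R(G)=\mathcal{C}_R(G,G)$. One has $\mathcal{C}_{\mathbb Q}(G,N)\subseteq\mathcal{C}_{\mathbb Q}(G)$. Mixed scl on chains: for $y\in[G,N]$ (the subgroup generated by all $[g,x]=gxg^{-1}x^{-1}$, $g\in G$, $x\in N$), $\mathrm{cl}_{G,N}(y)$ is the minimal number of such commutators whose product is $y$. An element of $\mathcal{C}_{\mathbb{Z}}(G,N)$ is expressed as $c=x_1+\dots+x_m-\check x_1-\dots-\check x_n$ with $x_i,\check x_j\in N$; for such an expression set $\mathrm{cl}_{G,N}(c)=\inf\mathrm{cl}_{G,N}(\xi_1\cdots\xi_m\eta_1^{-1}\cdots\eta_n^{-1})$, where $\xi_i$ runs over the $G$-conjugates of $x_i$ and $\eta_j$ over the $G$-conjugates of $\check x_j$. Then $\mathrm{scl}_{G,N}(c)=\lim_{k\to\infty}\frac1k\mathrm{cl}_{G,N}(x_1^k+\dots+x_m^k-\check x_1^k-\dots-\check x_n^k)$. For $c\in\mathcal{C}_{\mathbb{Q}}(G,N)$, $\mathrm{scl}_{G,N}(c)=\mathrm{scl}_{G,N}(kc)/k$ for any $k\in\mathbb{N}$ with $kc\in\mathcal{C}_{\mathbb{Z}}(G,N)$. It is known that this is well-defined and gives a seminorm on the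 $\mathbb{Q}$-vector space $\mathcal{C}_{\mathbb{Q}}(G,N)$; $\mathrm{scl}_G=\mathrm{scl}_{G,G}$. These seminorms are used as (pseudo-)metrics $d(c,c')=\mathrm{scl}(c-c')$, which are bi-invariant for addition. Coarse notions: for subsets $A,B$ of a (pseudo-)metric space $(X,d_X)$, $A\precsim B$ means that there is $R\ge0$ such that every $a\in A$ satisfies $d_X(a,b)\le R$ for some $b\in B$; $A\asymp B$ means $A\precsim B$ and $B\precsim A$. A map $f:X\to Y$ is bornologous if for each $R\ge0$ there is $\hat R\ge0$ such that $d_X(x_1,x_2)\le R$ implies $d_Y(f(x_1),f(x_2))\le\hat R$. Two maps are close ($\sim$) if they are at uniformly bounded distance. A map between groups with bi-invariant metrics is a coarse homomorphism if it is bornologous and $\sup_{g_1,g_2}d(f(g_1g_2),f(g_1)f(g_2))<\infty$. A coarse kernel of a coarse homomorphism $f:(G_1,d_1)\to(G_2,d_2)$ is a subset $A\subseteq G_1$ such that $f(A)$ is bounded and $B\precsim A$ for every $B\subseteq G_1$ with $f(B)$ bounded. A coarse kernel is unique up to $\asymp$ if it exists. It carries a coarse group structure: assuming $e\in A$ (replace $A$ by $A\cup\{e\}$), there are $D\ge 0$ and $\star:A\times A\to A$ with $d_1(a\star b,ab)\le D$ for all $a,b\in A$, with $A$ given the restricted metric; up to coarse isomorphism this structure does not depend on choices. A real normed space is regarded as a coarse group via its addition and norm metric. Two coarse groups (with multiplications possibly only of this coarse kind) are isomorphic if there are coarse homomorphisms $f,f'$ between them in both directions with $f'\circ f\sim\mathrm{id}$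 and $f\circ f'\sim\mathrm{id}$. *)

(* Defs.v *)
From HB Require Import structures.
From mathcomp Require Import all_boot all_order all_algebra.
From mathcomp Require Import all_classical all_reals all_analysis.
From mathcomp Require Import freeg.
From mathcomp Require Import ring lra.

Set Implicit Arguments.
Unset Strict Implicit.
Unset Printing Implicit Defensive.

Import Order.TTheory GRing.Theory Num.Theory.
Import numFieldNormedType.Exports.

Local Open Scope quotient_scope.
Local Open Scope classical_set_scope.
Local Open Scope ring_scope.

Record seminorm (R : numDomainType) (V : lmodType R) := Seminorm {
  seminorm_fun :> V -> R;
  seminormD : forall u v, seminorm_fun (u + v) <= seminorm_fun u + seminorm_fun v;
  seminormZ : forall a v, seminorm_fun (a *: v) = `|a| * seminorm_fun v
}.

Section SeminormTheory.
Context (R : numDomainType) (V : lmodType R) (p : seminorm V).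

Fact seminorm0 : p 0 = 0.
Proof. by rewrite -(scale0r 0) seminormZ normr0 mul0r. Qed.

Fact seminormN v : p (- v) = p v.
Proof. by rewrite -scaleN1r seminormZ normrN1 mul1r. Qed.

Fact seminorm_ge0 v : 0 <= p v.
Proof.
rewrite -(@pmulrn_lge0 _ _ 2)// mulr2n -{2}seminormN.
by rewrite -seminorm0 -(subrr v) seminormD.
Qed.

End SeminormTheory.

Section QuotientModule.
Context (R : nzRingType) (V : lmodType R) (I : submodClosed V).

Definition submod_zmod : {pred V} := fun v => v \in I.

HB.instance Definition _ := GRing.isZmodClosed.Build V submod_zmod
  (GRing.subsemimod_closedB (GRing.subsemimodClosedP I)).

Definition qmod : Type := Quotient.quot submod_zmod.

HB.instance Definition _ := GRing.Zmodule.on qmod.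
HB.instance Definition _ : EqQuotient V (Quotient.equiv submod_zmod) qmod :=
  EqQuotient.on qmod.
HB.instance Definition _ :=
  isZmodQuotient.Build V (Quotient.equiv submod_zmod) 0 -%R +%R qmod
    (lock _) (@Quotient.pi_opp V submod_zmod) (@Quotient.pi_add V submod_zmod).

Definition qproj (v : V) : qmod := \pi_qmod v.
Definition qscale (a : R) (x : qmod) : qmod := qproj (a *: repr x).

Fact qprojK (x : qmod) : qproj (repr x) = x. Proof. exact: reprK. Qed.

Fact qprojP (u v : V) : qproj u = qproj v <-> u - v \in I.
Proof. by rewrite [_ \in _](@Quotient.idealrBE V submod_zmod); split => /eqP. Qed.

Fact qproj_additive : zmod_morphism qproj.
Proof. by move=> x y; rewrite /qproj !piE. Qed.

HB.instance Definition _ :=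
  GRing.isZmodMorphism.Build V qmod qproj qproj_additive.

Fact qprojZ a v : qproj (a *: v) = qscale a (qproj v).
Proof. by apply/qprojP; rewrite -scalerBr rpredZ//; apply/qprojP; rewrite qprojK. Qed.

Fact qscaleA a b x : qscale a (qscale b x) = qscale (a * b) x.
Proof. by rewrite -(qprojK x) -!qprojZ scalerA. Qed.

Fact qscale1 : left_id 1 qscale.
Proof. by move=> x; rewrite -(qprojK x) -qprojZ scale1r. Qed.

Fact qscaleDr : right_distributive qscale +%R.
Proof.
move=> a x y; rewrite -(qprojK x) -(qprojK y) -(raddfD qproj) -!qprojZ.
by rewrite scalerDr raddfD.
Qed.

Fact qscaleDl x : {morph qscale^~ x : a b / a + b}.
Proof. by move=> a b /=; rewrite -(qprojK x) -!qprojZ scalerDl raddfD. Qed.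

HB.instance Definition _ :=
  GRing.Zmodule_isLmodule.Build R qmod qscaleA qscale1 qscaleDr qscaleDl.

Fact qproj_scalable : scalable qproj. Proof. exact: qprojZ. Qed.

HB.instance Definition _ :=
  GRing.isScalable.Build R V qmod *:%R qproj qproj_scalable.

End QuotientModule.

(* The quotient of the seminormed space (V, p): the parameter p is only there
   to determine the topology. *)
Definition snquot (R : realType) (V : lmodType R) (p : seminorm V)
  (I : submodClosed V) : Type := qmod I.

Section QuotientSeminorm.
Context (R : realType) (V : lmodType R) (p : seminorm V) (I : submodClosed V).
Local Notation Q := (snquot p I).

HB.instance Definition _ := GRing.Lmodule.on Q.

Definition snproj : {linear V -> Q} := qproj I.

Definition qnorm (x : Q) : R := inf [set p v | v in [set v | snproj v = x]].

Fact qnorm_has_inf (x : Q) :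
  has_inf [set p v | v in [set v | snproj v = x]].
Proof.
split; last by exists 0 => _ [v _ <-]; exact: seminorm_ge0.
by exists (p (repr (x : qmod I))), (repr (x : qmod I)) => //=; exact: qprojK.
Qed.

Fact qnorm_le (v : V) : qnorm (snproj v) <= p v.
Proof. by apply: ge_inf; [case: (qnorm_has_inf (snproj v))|exists v]. Qed.

Fact qnorm_ge (x : Q) (c : R) :
  (forall v, snproj v = x -> c <= p v) -> c <= qnorm x.
Proof.
move=> h; apply: lb_le_inf; first by case: (qnorm_has_inf x).
by move=> _ [v /= /h ? <-].
Qed.

Fact qnormD x y : qnorm (x + y) <= qnorm x + qnorm y.
Proof.
rewrite -lerBlDr; apply: qnorm_ge => u ux; rewrite lerBlDr (addrC (p u)) -lerBlDr.
apply: qnorm_ge => v vy; rewrite lerBlDr -ux -vy -raddfD.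
by rewrite (le_trans (qnorm_le _))// (addrC (p v)) seminormD.
Qed.

Fact qnormZ_le a x : qnorm (a *: x) <= `|a| * qnorm x.
Proof.
have [->|a0] := eqVneq a 0.
  by rewrite scale0r normr0 mul0r -(raddf0 snproj) (le_trans (qnorm_le _))// seminorm0.
rewrite mulrC -ler_pdivrMr ?normr_gt0//; apply: qnorm_ge => v <-.
by rewrite -linearZ ler_pdivrMr ?normr_gt0// (le_trans (qnorm_le _))// seminormZ mulrC.
Qed.

Fact qnormZ a x : qnorm (a *: x) = `|a| * qnorm x.
Proof.
apply/eqP; rewrite eq_le qnormZ_le/=; have [->|a0] := eqVneq a 0.
  by rewrite scale0r normr0 mul0r qnorm_ge// => v _; exact: seminorm_ge0.
rewrite mulrC -ler_pdivlMr ?normr_gt0// mulrC -normfV.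
by rewrite -{1}[x](scalerK a0) qnormZ_le.
Qed.

Definition quotient_seminorm : seminorm Q := Seminorm qnormD qnormZ.

(* The topology of the quotient is that of the pseudometric of its seminorm. *)
Definition qball (x : Q) (e : R) : set (Q) := [set y | qnorm (x - y) < e].

Definition qent : set_system (Q * Q) := entourage_ qball.

Definition qnbhs (x : Q) : set_system (Q) := nbhs_ qent x.

HB.instance Definition _ := hasNbhs.Build (Q) qnbhs.

Fact qnbhsE : nbhs = nbhs_ qent. Proof. by []. Qed.

Fact qball_center x (e : R) : 0 < e -> qball x e x.
Proof. by rewrite /qball/= subrr [qnorm 0](seminorm0 quotient_seminorm). Qed.

Fact qball_sym x y (e : R) : qball x e y -> qball y e x.
Proof. by rewrite /qball/= -opprB [qnorm _](seminormN quotient_seminorm). Qed.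

Fact qball_triangle x y z (e1 e2 : R) :
  qball x e1 y -> qball y e2 z -> qball x (e1 + e2) z.
Proof.
rewrite /qball/= => h1 h2; rewrite -(subrKA y).
by rewrite (le_lt_trans (qnormD _ _))// ltrD.
Qed.

HB.instance Definition _ := @Nbhs_isPseudoMetric.Build R (Q)
  qent qnbhsE qball qball_center qball_sym qball_triangle erefl.

End QuotientSeminorm.

Section ContinuousDual.
Context (R : realType) (V : preTopologicalLmodType R).

Definition dual_pred : {pred V -> R^o} :=
  [pred f | `[< scalar f /\ continuous (f : V -> R^o) >]].

Fact dual_submod : submod_closed dual_pred.
Proof.
split.
  apply/asboolP; split=> [a u v|x]; last exact: cvg_cst.
  by rewrite -[LHS]/(0 : R) -[RHS]/(a * 0 + 0 : R) mulr0 addr0.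
move=> a f g /asboolP[lf cf] /asboolP[lg cg]; apply/asboolP; split => [b u v|x].
  rewrite -[LHS]/(a * f (b *: u + v) + g (b *: u + v) : R) lf lg.
  rewrite -[RHS]/(b * (a * f u + g u) + (a * f v + g v) : R).
  by rewrite !mulrDr !mulrA (mulrC b a) addrACA.
by apply: cvgD; [apply: cvgZr; exact: cf|exact: cg].
Qed.

HB.instance Definition _ := GRing.isSubmodClosed.Build R (V -> R^o) dual_pred
  (GRing.submod_closed_semi dual_submod).

Definition dual : Type := {f : V -> R^o | f \in dual_pred}.

HB.instance Definition _ := SubChoice.on dual.
HB.instance Definition _ := [SubChoice_isSubLmodule of dual by <:].

End ContinuousDual.

Definition dual_norm (R : realType) (V : preTopologicalLmodType R) (p : V -> R)
  (f : dual V) : R := sup [set `|val f v| | v in [set v | p v <= 1]].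

Definition isometrically_isomorphic (R : realType) (U V : lmodType R)
    (p : U -> R) (q : V -> R) : Prop :=
  exists T : {linear U -> V}, bijective T /\ forall u, q (T u) = p u.

Definition finite_dimensional (R : realType) (V : lmodType R) : Prop :=
  exists n, inhabited (Vector.axiom n V).

Section Quasimorphisms.
Context (R : realType) (H : groupType).
Implicit Types (f g : H -> R^o).

Definition defects f : set R :=
  range (fun h : H * H => `|f (h.1 * h.2)%g - f h.1 - f h.2|).

Definition defect f : R := sup (defects f).

Definition quasimorphism f : Prop := has_ubound (defects f).

Definition cyclic_subgroup (h : H) : set H :=
  [set x | exists n : nat, x = (h ^+ n)%g \/ x = (h ^- n)%g].

Definition homogeneous f : Prop := forall h x y,
  cyclic_subgroup h x -> cyclic_subgroup h y -> f (x * y)%g = f x + f y.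

Definition hqm_pred : {pred H -> R^o} :=
  [pred f | `[< quasimorphism f /\ homogeneous f >]].

Fact quasimorphismP f :
  quasimorphism f <-> exists C, forall x y, `|f (x * y)%g - f x - f y| <= C.
Proof.
split=> [[C Cf]|[C Cf]]; exists C.
  by move=> x y; apply: Cf; exists (x, y).
by move=> _ [[x y] _ <-]; exact: Cf.
Qed.

Fact defect_ub f x y : quasimorphism f -> `|f (x * y)%g - f x - f y| <= defect f.
Proof. by move=> qf; apply: ub_le_sup => //; exists (x, y). Qed.

Fact defect_le f C :
  (forall x y, `|f (x * y)%g - f x - f y| <= C) -> defect f <= C.
Proof.
move=> h; apply: ge_sup; first by exists `|f (1 * 1)%g - f 1%g - f 1%g|, (1, 1)%g.
by move=> _ [[x y] _ <-]; exact: h.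
Qed.

Fact defectD_le f g x y : quasimorphism f -> quasimorphism g ->
  `|(f + g) (x * y)%g - (f + g) x - (f + g) y| <= defect f + defect g.
Proof.
move=> qf qg; rewrite -[leLHS]/`|f (x * y)%g + g (x * y)%g
  - (f x + g x) - (f y + g y)|.
rewrite (_ : _ - _ = (f (x * y)%g - f x - f y) + (g (x * y)%g - g x - g y)).
  by rewrite (le_trans (ler_normD _ _))// lerD// defect_ub.
by ring.
Qed.

Fact defectZ_le (a : R) f x y : quasimorphism f ->
  `|(a *: f) (x * y)%g - (a *: f) x - (a *: f) y| <= `|a| * defect f.
Proof.
move=> qf; rewrite -[leLHS]/`|a * f (x * y)%g - a * f x - a * f y|.
by rewrite -!mulrBr normrM ler_wpM2l// defect_ub.
Qed.

Fact hqm_submod : submod_closed hqm_pred.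
Proof.
split.
  apply/asboolP; split; last by move=> h x y _ _; rewrite -[LHS]/(0 : R) addr0.
  apply/quasimorphismP; exists 0 => x y.
  by rewrite -[leLHS]/(`|0 - 0 - 0 : R|) !subr0 normr0.
move=> a f g /asboolP[qf hf] /asboolP[qg hg].
have qaf : quasimorphism (a *: f).
  by apply/quasimorphismP; exists (`|a| * defect f) => x y; exact: defectZ_le.
apply/asboolP; split.
  by apply/quasimorphismP; eexists => x y; exact: defectD_le.
move=> h x y hx hy; rewrite -[LHS]/(a * f (x * y)%g + g (x * y)%g : R).
rewrite -[RHS]/((a * f x + g x) + (a * f y + g y) : R).
by rewrite (hf h)// (hg h)// mulrDr addrACA.
Qed.

HB.instance Definition _ := GRing.isSubmodClosed.Build R (H -> R^o) hqm_pred
  (GRing.submod_closed_semi hqm_submod).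

Definition hqm : Type := {f : H -> R^o | f \in hqm_pred}.

HB.instance Definition _ := SubChoice.on hqm.
HB.instance Definition _ := [SubChoice_isSubLmodule of hqm by <:].

Fact hqm_qm (f : hqm) : quasimorphism (val f).
Proof. by have /asboolP[] := valP f. Qed.

Fact hqm_homogeneous (f : hqm) : homogeneous (val f).
Proof. by have /asboolP[] := valP f. Qed.

Fact defect_ge0 f : 0 <= defect f.
Proof.
have [qf|nqf] := pselect (quasimorphism f).
  exact: le_trans (defect_ub 1%g 1%g qf).
by rewrite /defect sup_out// => -[].
Qed.

Fact defectD (f g : hqm) : defect (val (f + g)) <= defect (val f) + defect (val g).
Proof. by apply: defect_le => x y; apply: defectD_le; exact: hqm_qm. Qed.

Fact defectZ (a : R) (f : hqm) : defect (val (a *: f)) = `|a| * defect (val f).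
Proof.
have le b (g : hqm) : defect (val (b *: g)) <= `|b| * defect (val g).
  by apply: defect_le => x y; apply: defectZ_le; exact: hqm_qm.
apply/eqP; rewrite eq_le le/=; have [->|a0] := eqVneq a 0.
  by rewrite normr0 mul0r defect_ge0.
rewrite mulrC -ler_pdivlMr ?normr_gt0// mulrC -normfV.
by rewrite -{1}[f](scalerK a0) le.
Qed.

Definition hqm_defect : seminorm hqm := Seminorm defectD defectZ.

Definition hom_pred : {pred hqm} :=
  [pred f | `[< forall x y, val f (x * y)%g = val f x + val f y >]].

Fact hom_submod : submod_closed hom_pred.
Proof.
split; first by apply/asboolP => x y; rewrite -[LHS]/(0 : R) addr0.
move=> a f g /asboolP hf /asboolP hg; apply/asboolP => x y.
rewrite -[LHS]/(a * val f (x * y)%g + val g (x * y)%g : R).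
rewrite -[RHS]/((a * val f x + val g x) + (a * val f y + val g y) : R).
by rewrite hf hg mulrDr addrACA.
Qed.

HB.instance Definition _ := GRing.isSubmodClosed.Build R hqm hom_pred
  (GRing.submod_closed_semi hom_submod).

(* Q(H)/H^1(H) *)
Definition hqm_mod_hom : Type := snquot hqm_defect hom_pred.

HB.instance Definition _ := GRing.Lmodule.on hqm_mod_hom.

Fact hqm1 (f : hqm) : val f 1%g = 0.
Proof.
have c1 : cyclic_subgroup 1%g (1%g : H) by exists 0%N; left.
have /eqP := hqm_homogeneous f c1 c1.
by rewrite mulg1 -subr_eq0 opprD addNKr oppr_eq0 => /eqP.
Qed.

Fact hqmV (f : hqm) (x : H) : val f (x^-1)%g = - val f x.
Proof.
apply/eqP; rewrite -addr_eq0 -(hqm_homogeneous f (h := x)) ?mulVg ?hqm1//.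
  by exists 1%N; right; rewrite expg1.
by exists 1%N; left; rewrite expg1.
Qed.

Fact hqmX (f : hqm) n (x : H) : val f (x ^+ n)%g = n%:R * val f x.
Proof.
elim: n => [|n IH]; first by rewrite expg0 hqm1 mul0r.
rewrite expgS (hqm_homogeneous f (h := x)).
- by rewrite IH -natr1 mulrDl mul1r addrC.
- by exists 1%N; left; rewrite expg1.
- by exists n; left.
Qed.

Fact hqm_conj (f : hqm) (x h : H) : val f (x ^ h)%g = val f x.
Proof.
have bnd1 y : `|val f (y ^ h)%g - val f y| <= defect (val f) *+ 2.
  have := defect_ub (h^-1)%g (y * h)%g (hqm_qm f).
  have := defect_ub y h (hqm_qm f); rewrite hqmV -[(h^-1 * (y * h))%g]/(y ^ h)%g.
  by rewrite !ler_norml mulr2n => /andP[? ?] /andP[? ?]; apply/andP; split; lra.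
have bnd n : n%:R * `|val f (x ^ h)%g - val f x| <= defect (val f) *+ 2.
  by have := bnd1 (x ^+ n)%g; rewrite conjXg !hqmX -mulrBr normrM normr_nat.
apply/eqP; rewrite -subr_eq0 -normr_le0 leNgt; apply/negP => d0.
have := bnd (Num.bound (defect (val f) *+ 2 / `|val f (x ^ h)%g - val f x|)).
rewrite leNgt -ltr_pdivrMr// archi_boundP// divr_ge0// ?mulrn_wge0//.
exact: defect_ge0.
Qed.

End Quasimorphisms.

Section Subgroup.
Context (G : groupType) (N : groupClosed G).

Definition subgroup : Type := {x : G | x \in N}.

HB.instance Definition _ := SubChoice.on subgroup.

Fact subgroup_closed : group_closed (fun x : G => x \in N).
Proof.
split; first exact: gpred1.
by move=> x y xN yN; apply: gpredM => //; rewrite gpredV.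
Qed.

HB.instance Definition _ :=
  SubChoice_isSubGroup.Build G (fun x : G => x \in N) subgroup subgroup_closed.

End Subgroup.

Section Extension.
Context (R : realType) (G : groupType) (N : groupClosed G).

(* y = x ^ g is stated in G, so that the subgroup need not be known to be normal. *)
Definition inv_pred : {pred hqm R (subgroup N)} := [pred f | `[< forall (g : G)
  (x y : subgroup N), val y = (val x ^ g)%g -> val f y = val f x >]].

Fact inv_submod : submod_closed inv_pred.
Proof.
split; first by apply/asboolP.
move=> a f h /asboolP fG /asboolP hG; apply/asboolP => g x y yx.
rewrite -[LHS]/(a * val f y + val h y : R) -[RHS]/(a * val f x + val h x : R).
by rewrite (fG g x y)// (hG g x y).
Qed.

HB.instance Definition _ := GRing.isSubmodClosed.Build R (hqm R (subgroup N))
  inv_pred (GRing.submod_closed_semi inv_submod).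

(* Q(N)^G *)
Definition ihqm : Type := {f : hqm R (subgroup N) | f \in inv_pred}.

HB.instance Definition _ := SubChoice.on ihqm.
HB.instance Definition _ := [SubChoice_isSubLmodule of ihqm by <:].

Definition ihqm_defect : seminorm ihqm :=
  @Seminorm R ihqm (fun f => @hqm_defect R (subgroup N) (val f))
    (fun f g => seminormD (@hqm_defect R (subgroup N)) (val f) (val g))
    (fun a f => seminormZ (@hqm_defect R (subgroup N)) a (val f)).

(* H^1(N)^G, as a subspace of Q(N)^G *)
Definition ihom_pred : {pred ihqm} := fun f => val f \in @hom_pred R (subgroup N).

Fact ihom_submod : submod_closed ihom_pred.
Proof.
have [h0 hD] := hom_submod R (subgroup N).
by split=> [|a f g fh gh]; [exact: h0|exact: hD].
Qed.

HB.instance Definition _ := GRing.isSubmodClosed.Build R ihqm ihom_pred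
  (GRing.submod_closed_semi ihom_submod).

(* Q(N)^G/H^1(N)^G *)
Definition ihqm_mod_hom : Type := snquot ihqm_defect ihom_pred.

HB.instance Definition _ := GRing.Lmodule.on ihqm_mod_hom.
HB.instance Definition _ := PseudoMetric.on ihqm_mod_hom.

Fact restrict_hqm (f : hqm R G) :
  (fun x : subgroup N => val f (val x)) \in @hqm_pred R (subgroup N).
Proof.
apply/asboolP; split.
  apply/quasimorphismP; exists (defect (val f)) => x y.
  by rewrite valM; exact/defect_ub/hqm_qm.
have valX (h : subgroup N) n : val (h ^+ n)%g = (val h ^+ n)%g.
  by elim: n => [|n IH]; rewrite ?expg0 ?val1// !expgS valM IH.
have cyc (h x : subgroup N) : cyclic_subgroup h x -> cyclic_subgroup (val h) (val x).
  case=> n [->|->]; exists n; [left; exact: valX|right].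
  by apply: (mulgI (val h ^+ n)%g); rewrite mulgV -valX -valM mulgV val1.
by move=> h x y /cyc hx /cyc hy; rewrite valM; exact: (hqm_homogeneous f hx hy).
Qed.

Definition restrict_fun (f : hqm R G) : hqm R (subgroup N) :=
  exist (fun g => g \in @hqm_pred R (subgroup N)) _ (restrict_hqm f).

Fact restrict_inv (f : hqm R G) : restrict_fun f \in inv_pred.
Proof. by apply/asboolP => g x y /= ->; exact: hqm_conj. Qed.

(* i^* : Q(G) -> Q(N)^G *)
Definition restrict (f : hqm R G) : ihqm :=
  exist (fun g => g \in inv_pred) _ (restrict_inv f).

Fact restrict_linear : linear restrict.
Proof. by move=> a f g; apply/val_inj/val_inj. Qed.

HB.instance Definition _ :=
  GRing.isLinear.Build R (hqm R G) ihqm *:%R restrict restrict_linear.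

(* Defined on a representative; restrict_hatE shows the independence of the choice. *)
Definition restrict_hat (x : hqm_mod_hom R G) : ihqm_mod_hom :=
  snproj ihqm_defect ihom_pred (restrict (repr (x : qmod (@hom_pred R G)))).

Fact restrict_hatE (f : hqm R G) :
  restrict_hat (snproj (@hqm_defect R G) (@hom_pred R G) f) =
  snproj ihqm_defect ihom_pred (restrict f).
Proof.
apply/qprojP; rewrite -linearB; set h := _ - f.
have /asboolP hh : h \in @hom_pred R G by apply/qprojP; exact: qprojK.
by apply/asboolP => x y; rewrite -[LHS]/(val h (val (x * y)%g)) valM hh.
Qed.

(* H^1(N)^G + i^*Q(G) *)
Definition ihom_restrict_pred : {pred ihqm} :=
  [pred f | `[< exists h g, h \in ihom_pred /\ f = h + restrict g >]].

Fact ihom_restrict_submod : submod_closed ihom_restrict_pred.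
Proof.
have [h0 hD] := ihom_submod.
split; first by apply/asboolP; exists 0, 0; rewrite linear0 addr0.
move=> a f1 f2 /asboolP[h1 [g1 [hh1 ->]]] /asboolP[h2 [g2 [hh2 ->]]].
apply/asboolP; exists (a *: h1 + h2), (a *: g1 + g2); split; first exact: hD.
by rewrite linearP scalerDr addrACA.
Qed.

HB.instance Definition _ := GRing.isSubmodClosed.Build R ihqm ihom_restrict_pred
  (GRing.submod_closed_semi ihom_restrict_submod).

(* W(G,N), with the quotient seminorm of D_N *)
Definition Wspace : Type := snquot ihqm_defect ihom_restrict_pred.

HB.instance Definition _ := GRing.Lmodule.on Wspace.
HB.instance Definition _ := PseudoMetric.on Wspace.

Definition Wnorm : seminorm Wspace :=
  quotient_seminorm ihqm_defect ihom_restrict_pred.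

End Extension.

Definition gen_submod (K : nzRingType) (M : lmodType K) (S : set M) : set M :=
  [set m | exists s : seq (K * M), (forall p, p \in s -> S p.2) /\
    m = \sum_(p <- s) p.1 *: p.2].

Fact gen_submodP (K : nzRingType) (M : lmodType K) (S : set M) (a : K) (u v : M) :
  gen_submod S u -> gen_submod S v -> gen_submod S (a *: u + v).
Proof.
move=> [s [sS ->]] [t [tS ->]]; exists ([seq (a * p.1, p.2) | p <- s] ++ t).
split=> [p|]; last first.
  by rewrite big_cat big_map scaler_sumr/=; congr +%R; apply: eq_bigr => p _; rewrite scalerA.
by rewrite mem_cat => /orP[/mapP[q /sS qS ->]//|/tS].
Qed.

Fact gen_submod0 (K : nzRingType) (M : lmodType K) (S : set M) : gen_submod S 0.
Proof. by exists [::]; rewrite big_nil. Qed.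

Fact gen_submodS (K : nzRingType) (M : lmodType K) (S T : set M) :
  S `<=` T -> gen_submod S `<=` gen_submod T.
Proof. by move=> ST m [s [sS ->]]; exists s; split=> // p /sS /ST. Qed.

Section FreeModule.
Context (K : nzRingType) (M : lmodType K) (X : choiceType) (f : X -> M).

HB.instance Definition _ := GRing.isZmodMorphism.Build {freeg X / K} M (fglift f)
  (lift_is_additive f).

Fact fglift_linear : linear (fglift f).
Proof.
move=> a u v; rewrite raddfD; congr +%R.
have -> : a *: u = \sum_(x <- dom u) << a * coeff x u *g x >> by [].
rewrite -[in RHS](freeg_sumE u) !raddf_sum; apply: eq_bigr => x _.
by rewrite -[LHS]/(fglift f _) -[RHS]/(a *: fglift f _) !liftU scalerA.
Qed.

End FreeModule.

Section Chains.
Context (K : nzRingType) (G : groupType).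

Definition boundary (c : {freeg (G * G) / K}) : {freeg G / K} :=
  fglift (fun g : G * G => << g.2 >> - << (g.1 * g.2)%g >> + << g.1 >>) c.

(* C_1(N; K) inside C_1(G; K) *)
Definition chains1 (N : {pred G}) : set {freeg G / K} :=
  gen_submod [set << x >> | x in [set x | x \in N]].

(* C'_2(G, N; K) *)
Definition chains2' (N : {pred G}) : set {freeg (G * G) / K} :=
  gen_submod [set << g >> | g in [set g : G * G | (g.1 \in N) || (g.2 \in N)]].

(* C_K(G, N) *)
Definition mixed_chains (N : {pred G}) : set {freeg G / K} :=
  chains1 N `&` boundary @` chains2' N.

Fact mixed_chainsP (N : {pred G}) (a : K) (u v : {freeg G / K}) :
  mixed_chains N u -> mixed_chains N v -> mixed_chains N (a *: u + v).
Proof.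
move=> [Nu [bu Bu bu_u]] [Nv [bv Bv bv_v]]; split; first exact: gen_submodP.
exists (a *: bu + bv); first exact: gen_submodP.
by rewrite [boundary _]fglift_linear -bu_u -bv_v.
Qed.

Fact mixed_chains0 (N : {pred G}) : mixed_chains N 0.
Proof.
split; first exact: gen_submod0.
by exists 0; [exact: gen_submod0|rewrite /boundary raddf0].
Qed.

Fact mixed_chainsS (N : {pred G}) : mixed_chains N `<=` mixed_chains predT.
Proof.
by move=> c [c1 [b b2 bc]]; split; [|exists b => //];
  apply: gen_submodS c1 || apply: gen_submodS b2; apply: image_subset.
Qed.

End Chains.

Section MixedCommutatorLength.
Context (R : realType) (G : groupType) (N : {pred G}).

(* cl_{G,N}(y), equal to +oo when y is not in [G,N] *)
Definition cl (y : G) : \bar R :=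
  ereal_inf [set (size s)%:R%:E | s in [set s : seq (G * G) |
    (forall p, p \in s -> p.2 \in N) /\
    y = (\prod_(p <- s) (p.1 * p.2 * p.1^-1 * p.2^-1))%g]].

(* cl_{G,N}(x_1 + ... + x_m - y_1 - ... - y_n); the conjugates of the x_i and of
   the y_j are given by the conjugating elements g i and h j. *)
Definition cl_chain (xs ys : seq G) : \bar R :=
  ereal_inf (range (fun gh : (nat -> G) * (nat -> G) =>
    cl ((\prod_(i < size xs) (nth 1 xs i ^ gh.1 i)) *
        (\prod_(j < size ys) (nth 1 ys j ^ gh.2 j)^-1))%g)).

Definition cl_growth (xs ys : seq G) (k : nat) : R :=
  fine (cl_chain [seq (x ^+ k)%g | x <- xs] [seq (y ^+ k)%g | y <- ys]) / k%:R.

(* The limit is that of any expression of c as a difference of sums of elements of N;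
   for c in C_Z(G,N) it exists and does not depend on the expression. *)
Definition scl_int (c : {freeg G / int}) : R :=
  xget 0 [set s | exists xs ys : seq G,
    [/\ {subset xs <= N}, {subset ys <= N},
      c = \sum_(x <- xs) << x >> - \sum_(y <- ys) << y >> &
      cl_growth xs ys @ \oo --> s]].

Definition chain_rat (c : {freeg G / int}) : {freeg G / rat} :=
  \sum_(x <- dom c) << (coeff x c)%:~R *g x >>.

(* For c in C_Q(G,N) the value does not depend on the chosen integral multiple of c. *)
Definition scl_rat (c : {freeg G / rat}) : R :=
  xget 0 [set s | exists (k : nat) (z : {freeg G / int}),
    [/\ (0 < k)%N, mixed_chains N z, k%:R *: c = chain_rat z &
      s = scl_int z / k%:R]].

End MixedCommutatorLength.

Section RationalChains.
Context (G : groupType) (N : {pred G}).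

Definition rat_chains_pred : {pred {freeg G / rat}} :=
  [pred c | `[< mixed_chains N c >]].

Fact rat_chains_submod : submod_closed rat_chains_pred.
Proof.
split; first by apply/asboolP; exact: mixed_chains0.
by move=> a u v /asboolP ? /asboolP ?; apply/asboolP; exact: mixed_chainsP.
Qed.

HB.instance Definition _ := GRing.isSubmodClosed.Build rat {freeg G / rat}
  rat_chains_pred (GRing.submod_closed_semi rat_chains_submod).

(* C_Q(G, N) *)
Definition rat_chains : Type := {c : {freeg G / rat} | c \in rat_chains_pred}.

HB.instance Definition _ := SubChoice.on rat_chains.
HB.instance Definition _ := [SubChoice_isSubLmodule of rat_chains by <:].

Definition scl_dist (R : realType) (c d : rat_chains) : R :=
  scl_rat R N (val (c - d)).

End RationalChains.

Section Iota.
Context (G : groupType) (N : {pred G}).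

Fact rat_chains_sub (c : rat_chains N) : val c \in rat_chains_pred (predT : {pred G}).
Proof. by apply/asboolP; apply: mixed_chainsS; exact/asboolP/(valP c). Qed.

(* C_Q(G) is rat_chains predT. *)
Definition iotaQ (c : rat_chains N) : rat_chains (predT : {pred G}) :=
  exist (fun d => d \in rat_chains_pred predT) (val c) (rat_chains_sub c).

End Iota.

Section Coarse.
Context (R : realType).

Section Maps.
Context (X Y : Type) (dX : X -> X -> R) (dY : Y -> Y -> R).

Definition coarsely_contained (A B : set X) : Prop :=
  exists r : R, 0 <= r /\ forall a, A a -> exists2 b, B b & dX a b <= r.

Definition bounded_subset (A : set X) : Prop :=
  exists r : R, forall a b, A a -> A b -> dX a b <= r.

Definition bornologous (f : X -> Y) : Prop :=
  forall r : R, 0 <= r -> exists r' : R, 0 <= r' /\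
    forall x1 x2, dX x1 x2 <= r -> dY (f x1) (f x2) <= r'.

Definition close_maps (f g : X -> Y) : Prop :=
  exists r : R, forall x, dY (f x) (g x) <= r.

(* mX and mY are the (possibly only coarse) multiplications. *)
Definition coarse_hom (mX : X -> X -> X) (mY : Y -> Y -> Y) (f : X -> Y) : Prop :=
  bornologous f /\
  exists r : R, forall x1 x2, dY (f (mX x1 x2)) (mY (f x1) (f x2)) <= r.

End Maps.

Definition coarse_kernel (X Y : Type) (dX : X -> X -> R) (dY : Y -> Y -> R)
    (f : X -> Y) (A : set X) : Prop :=
  bounded_subset dY (f @` A) /\
  forall B : set X, bounded_subset dY (f @` B) -> coarsely_contained dX B A.

Definition coarse_isomorphic (X Y : Type) (dX : X -> X -> R) (mX : X -> X -> X)
    (dY : Y -> Y -> R) (mY : Y -> Y -> Y) : Prop :=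
  exists (f : X -> Y) (f' : Y -> X),
    [/\ coarse_hom dX dY mX mY f, coarse_hom dY dX mY mX f',
      close_maps dX (f' \o f) id & close_maps dY (f \o f') id].

Definition coarse_mul (X : Type) (dX : X -> X -> R) (mX : X -> X -> X) (A : set X)
    (star : A -> A -> A) : Prop :=
  exists r : R, 0 <= r /\ forall a b : A, dX (val (star a b)) (mX (val a) (val b)) <= r.

(* The coarse group structure carried by the subset A of X is the one given by any
   star as in coarse_mul, for the restricted metric. *)
Definition coarse_subset_isomorphic (X Y : Type) (dX : X -> X -> R)
    (mX : X -> X -> X) (A : set X) (dY : Y -> Y -> R) (mY : Y -> Y -> Y) : Prop :=
  (exists star : A -> A -> A, coarse_mul dX mX star) /\
  forall star : A -> A -> A, coarse_mul dX mX star ->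
    coarse_isomorphic (fun a b => dX (val a) (val b)) star dY mY.

End Coarse.

Section Main.
Context (R : realType) (G : groupType) (N : groupClosed G).

Definition iota_coarse_kernel (A : set (rat_chains N)) : Prop :=
  coarse_kernel (@scl_dist G N R) (@scl_dist G predT R) (@iotaQ G N) A.

(* A is replaced by A `|` [set 0], to contain the unit. *)
Definition kernel_coarsely_isomorphic (A : set (rat_chains N)) (V : zmodType)
    (p : V -> R) : Prop :=
  coarse_subset_isomorphic (@scl_dist G N R) +%R (A `|` [set 0])
    (fun u v => p (u - v)) +%R.

End Main.

(* Main.v *)
(* Let p = scl_{G,N} and q = scl_G on X = C_Q(G,N). A functional f on X with
   |f| <= 2C p, extended Q-linearly to all chains, restricts to a G-invariant
   homogeneous quasimorphism on N of defect at most C, because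
   scl_{G,N}(x + y - xy) <= 1/2; so the dual of (X, 2p) is Q(N)^G/H^1(N)^G with the norm
   D_N. By Hahn-Banach, i^* Q(G) corresponds to the subspace I of q-bounded functionals.

   The existence of a coarse kernel and the closedness of I are both equivalent to the
   existence of c such that each x with q(x) <= 1 is within p-distance c of elements of
   arbitrarily small q. For the coarse kernel this follows by rescaling and iterating.
   If I is closed, a gliding hump bounds the q-norm by the p-norm on I, and Hahn-Banach
   separation gives c.

   Then V is the kernel of q in the completion of (X, 2p), realized in the bidual of X.
   By Hahn-Banach V^* is X^*/I = W(G,N), and nearest points relate V to the q-balls of X,
   which are the coarse kernels. If W is finite-dimensional, the gliding hump applied to
   subsequences shows that I is closed, and V is W^*. *)

(* Chains have rational coefficients and scl is homogeneous only over the rationals, while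
   functionals are real valued. Hence Hahn-Banach is proved for abelian groups, with natural
   multiples as the only scalars; real scalars reappear in the bidual, as limits of rational ones.
   The definition of scl involves a limit, arbitrary expressions and an infimum over conjugates.
   Each manipulation of a product of [k]-th powers (permuting, conjugating, cancelling, splitting
   the exponent) costs a number of mixed commutators that is independent of [k], hence nothing in
   the limit. The factor 2 is that of Bavard duality: a quasimorphism of defect [D] is at most
   [2 D n] on a product of [n] commutators, and scl at most 1/2 on [x + y - xy] gives the defect
   back. The two constants match, which makes the duality isometric. In place of the open mapping
   and closed range theorems for Banach spaces, the analytic part sums explicit geometric series in
   [X] and in its dual. It is carried out for an abstract [dualPair]; group theory enters only
   through the fields of this record. *)
Require Import Defs.
From HB Require Import structures.
From mathcomp Require Import all_boot all_order all_algebra.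
From mathcomp Require Import all_classical all_reals all_analysis.
From mathcomp Require Import zify freeg ring lra.
Set Implicit Arguments.
Unset Strict Implicit.
Unset Printing Implicit Defensive.
Import Order.TTheory GRing.Theory Num.Theory.
Import numFieldNormedType.Exports.
Local Open Scope classical_set_scope.
Local Open Scope ring_scope.

(** * Hahn-Banach for abelian groups *)

Section HahnBanach.
Context (R : realType) (A : zmodType).
Implicit Types (p : A -> R).

(* Over an abelian group, homogeneity under natural multiples replaces positive
   homogeneity. *)
Definition sublinear p :=
  (forall x y, p (x + y) <= p x + p y) /\ (forall n x, p (x *+ n) = n%:R * p x).

Lemma sublinear0 p : sublinear p -> p 0 = 0.
Proof. by move=> [_ h]; rewrite -(mulr0n 0) h mul0r. Qed.

Lemma sublinearN_le p x : sublinear p -> - p (- x) <= p x.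
Proof.
move=> sp; rewrite lerNl -subr_ge0 opprK addrC -(sublinear0 sp) -(subrr x).
by apply: sp.1.
Qed.

Section Infimum.
Context (M : nmodType) (s : M -> A) (g : M -> R) (p : A -> R).
Hypotheses (s0 : s 0 = 0) (sD : forall m n, s (m + n) = s m + s n).
Hypotheses (g0 : g 0 = 0) (gD : forall m n, g (m + n) = g m + g n).
Hypotheses (sp : sublinear p) (gp : forall m, g m <= p (s m)).

Let E y := range (fun km : nat * M =>
  (p (y *+ km.1.+1 + s km.2) - g km.2) / km.1.+1%:R).

(* The largest sublinear minorant q of p with q (- s m) <= - g m. *)
Definition inf_conv y : R := inf (E y).

Let E_lb y : lbound (E y) (- p (- y)).
Proof.
move=> _ [[k m] _ <-]/=; rewrite ler_pdivlMr// lerBrDr.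
have := sp.1 (y *+ k.+1 + s m) (- y *+ k.+1).
rewrite mulNrn addrAC subrr add0r -mulNrn sp.2 => h.
have := gp m; rewrite mulNr mulrC; lra.
Qed.

Let E_hasinf y : has_inf (E y).
Proof.
split; last by exists (- p (- y)); exact: E_lb.
by eexists; exists (0%N, 0).
Qed.

Lemma inf_conv_le y k m :
  inf_conv y <= (p (y *+ k.+1 + s m) - g m) / k.+1%:R.
Proof. by apply: ge_inf; [case: (E_hasinf y)|exists (k, m)]. Qed.

Lemma inf_conv_ge y c :
  (forall k m, c <= (p (y *+ k.+1 + s m) - g m) / k.+1%:R) -> c <= inf_conv y.
Proof.
move=> h; apply: lb_le_inf; first by case: (E_hasinf y).
by move=> _ [[k m] _ <-].
Qed.

Let sMn m n : s (m *+ n) = s m *+ n.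
Proof. by elim: n => [|n IH]; rewrite ?mulr0n ?s0// !mulrS sD IH. Qed.

Let gMn m n : g (m *+ n) = n%:R * g m.
Proof.
elim: n => [|n IH]; rewrite ?mulr0n ?g0 ?mul0r// mulrS gD IH.
by rewrite -nat1r mulrDl mul1r.
Qed.

Lemma inf_conv_sub y : inf_conv y <= p y.
Proof.
by have := inf_conv_le y 0 0; rewrite mulr1n s0 addr0 g0 subr0 divr1.
Qed.

Lemma inf_conv_opp m : inf_conv (- s m) <= - g m.
Proof.
have := inf_conv_le (- s m) 0 m.
by rewrite mulr1n addNr (sublinear0 sp) sub0r divr1.
Qed.

Lemma inf_conv_sublinear : sublinear inf_conv.
Proof.
split=> [x y|n x].
  rewrite -lerBlDr; apply: inf_conv_ge => k m; rewrite lerBlDr -lerBlDl.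
  apply: inf_conv_ge => l n; rewrite lerBlDl.
  (* The competitors with denominators [k.+1] and [l.+1] are brought to the common denominator
     [k.+1 * l.+1]; the predecessor compensates for the index shift in [inf_conv]. *)
  have := inf_conv_le (x + y) (k.+1 * l.+1).-1 (m *+ l.+1 + n *+ k.+1).
  rewrite prednK ?muln_gt0// => /le_trans; apply.
  rewrite gD !gMn natrM sD !sMn.
  have -> : (x + y) *+ (k.+1 * l.+1) + (s m *+ l.+1 + s n *+ k.+1) =
      (x *+ k.+1 + s m) *+ l.+1 + (y *+ l.+1 + s n) *+ k.+1.
    by rewrite !mulrnDl addrACA -!mulrnA (mulnC l.+1).
  have -> : (p (x *+ k.+1 + s m) - g m) / k.+1%:R +
      (p (y *+ l.+1 + s n) - g n) / l.+1%:R =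
    (l.+1%:R * p (x *+ k.+1 + s m) + k.+1%:R * p (y *+ l.+1 + s n)
     - (l.+1%:R * g m + k.+1%:R * g n)) / (k.+1%:R * l.+1%:R).
    by field; rewrite !nat1r !pnatr_eq0.
  rewrite ler_wpM2r ?invr_ge0 ?mulr_ge0// lerD2r -!sp.2.
  exact: sp.1.
case: n => [|n].
  rewrite mulr0n mul0r; apply/eqP; rewrite eq_le; apply/andP; split.
    by rewrite (le_trans (inf_conv_sub _))// sublinear0.
  apply: inf_conv_ge => k m; rewrite mul0rn add0r divr_ge0// subr_ge0.
  exact: gp.
apply/eqP; rewrite eq_le; apply/andP; split.
  rewrite mulrC -ler_pdivrMr//; apply: inf_conv_ge => k m.
  rewrite ler_pdivrMr//.
  have := inf_conv_le (x *+ n.+1) k (m *+ n.+1) => /le_trans; apply.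
  rewrite gMn sMn mulrnAC -mulrnDl sp.2 -mulrBr.
  by rewrite -mulrA mulrC.
apply: inf_conv_ge => k m; rewrite mulrC -ler_pdivlMr//.
have := inf_conv_le x (k.+1 * n.+1).-1 m.
rewrite prednK ?muln_gt0// => /le_trans; apply.
have -> : x *+ (k.+1 * n.+1) = x *+ n.+1 *+ k.+1 by rewrite mulnC mulrnA.
by rewrite natrM invfM mulrA.
Qed.

End Infimum.

(* A minimal sublinear functional is additive: compare it with its minorant
   obtained from inf_conv with s n = x *+ n. *)
Lemma minimal_sublinear p : sublinear p ->
  exists f, [/\ sublinear f, forall x, f x <= p x & {morph f : x y / x + y}].
Proof.
move=> sp.
pose T := {q : A -> R | sublinear q /\ forall x, q x <= p x}.
(* The order is reversed: maximal elements for [le] are minimal functionals, and chains are bounded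
   by pointwise infima. *)
pose le (q r : T) := `[< forall x, sval r x <= sval q x >].
have [|||C Ctot|[f [sf fp]] fmin] := @Zorn T le.
- by move=> q; apply/asboolP.
- by move=> q r t /asboolP h1 /asboolP h2; apply/asboolP => x; exact: le_trans (h2 x) (h1 x).
- move=> [q hq] [r hr] /asboolP/= h1 /asboolP/= h2; apply: eq_exist => /=.
  by apply/funext => x; apply/eqP; rewrite eq_le h1 h2.
- have [C0|/set0P[q0 Cq0]] := eqVneq C set0.
    by exists (exist _ p (conj sp (fun=> lexx _))) => r; rewrite C0.
  pose S x := [set sval q x | q in C].
  have Slb x : lbound (S x) (- p (- x)).
    move=> _ [[q [sq qp]] Cq <-]/=; rewrite (le_trans _ (sublinearN_le x sq))//.
    by rewrite lerN2.
  have Sinf x : has_inf (S x).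
    by split; [exists (sval q0 x), q0|exists (- p (- x))].
  pose r x := inf (S x).
  have rle q x : C q -> r x <= sval q x.
    by move=> Cq; apply: ge_inf; [case: (Sinf x)|exists q].
  have rge c x : (forall q, C q -> c <= sval q x) -> c <= r x.
    by move=> h; apply: lb_le_inf; [case: (Sinf x)|move=> _ [q Cq <-]; exact: h].
  have sr : sublinear r.
    split=> [x y|n x].
      rewrite -lerBlDr; apply: (rge) => q Cq; rewrite lerBlDr -lerBlDl.
      apply: (rge) => q' Cq'; rewrite lerBlDl.
      case: (Ctot _ _ Cq Cq') => /asboolP h.
        apply: le_trans (rle _ _ Cq') _; apply: le_trans ((svalP q').1.1 _ _) _.
        by rewrite lerD2r.
      apply: le_trans (rle _ _ Cq) _; apply: le_trans ((svalP q).1.1 _ _) _.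
      by rewrite lerD2l.
    case: n => [|n].
      rewrite mulr0n mul0r; apply/eqP; rewrite eq_le; apply/andP; split.
        by rewrite (le_trans (rle _ _ Cq0))// sublinear0//; case: (svalP q0).
      by apply: (rge) => q Cq; rewrite sublinear0//; case: (svalP q).
    apply/eqP; rewrite eq_le; apply/andP; split.
      rewrite mulrC -ler_pdivrMr//; apply: (rge) => q Cq.
      by rewrite ler_pdivrMr// mulrC -(svalP q).1.2; exact: rle.
    apply: (rge) => q Cq; rewrite (svalP q).1.2 ler_wpM2l//; exact: rle.
  have rp x : r x <= p x by apply: le_trans (rle _ _ Cq0) _; case: (svalP q0).
  by exists (exist _ r (conj sr rp)) => q Cq; apply/asboolP => x; exact: rle.
exists f; split=> //.
have fodd x : f (- x) = - f x.
  pose q := inf_conv (fun n : nat => x *+ n) (fun n : nat => n%:R * f x) f.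
  have xD (m n : nat) : x *+ (m + n) = x *+ m + x *+ n by exact: mulrnDr.
  have fD (m n : nat) : (m + n)%:R * f x = m%:R * f x + n%:R * f x.
    by rewrite natrD mulrDl.
  have gp (m : nat) : m%:R * f x <= f (x *+ m) by rewrite sf.2.
  have sq : sublinear q by apply: inf_conv_sublinear => //; rewrite mul0r.
  have qf y : q y <= f y by apply: inf_conv_sub => //; rewrite mul0r.
  have qp y : q y <= p y by exact: le_trans (qf y) (fp y).
  have qx : q (- x) <= - f x.
    have := @inf_conv_opp nat (fun n => x *+ n) (fun n => n%:R * f x) f sf gp 1%N.
    by rewrite mulr1n mul1r.
  have /(congr1 sval)/= qE := fmin (exist _ q (conj sq qp)) (asboolT qf).
  apply/eqP; rewrite eq_le -{1}qE qx/=.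
  by have := sublinearN_le (- x) sf; rewrite opprK.
move=> x y; apply/eqP; rewrite eq_le sf.1/=.
have := sf.1 (x + y) (- y); rewrite addrK fodd; lra.
Qed.

(** An additive minorant [f] of [inf_conv] satisfies [f (- s m) <= - g m], that is [g m <= f (s m)];
    the same inequality at [- m] is the converse one. *)
Theorem hahn_banach (M : zmodType) (s : M -> A) (g : M -> R) p :
  {morph s : m n / m + n} -> {morph g : m n / m + n} -> sublinear p -> (forall m, g m <= p (s m)) ->
  exists f, [/\ {morph f : x y / x + y}, forall x, f x <= p x &
    forall m, f (s m) = g m].
Proof.
move=> sD gD sp gp.
have g0 : g 0 = 0 by apply: (@addrI _ (g 0)); rewrite -gD !addr0.
have s0 : s 0 = 0 by apply: (@addrI _ (s 0)); rewrite -sD !addr0.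
have sN x : s (- x) = - s x by apply: (@addrI _ (s x)); rewrite -sD !subrr.
have [f [_ fq fD]] := minimal_sublinear (inf_conv_sublinear s0 sD g0 gD sp gp).
have f0 : f 0 = 0 by apply: (@addrI _ (f 0)); rewrite -fD !addr0.
have fN x : f (- x) = - f x by apply: (@addrI _ (f x)); rewrite -fD !subrr.
have gN x : g (- x) = - g x by apply: (@addrI _ (g x)); rewrite -gD !subrr.
have le m : g m <= f (s m).
  by rewrite -lerN2 -fN (le_trans (fq _))// inf_conv_opp.
exists f; split=> [|x|m]; [exact: fD| |].
  by apply: le_trans (fq x) _; exact: inf_conv_sub.
by apply/eqP; rewrite eq_le le andbT -lerN2 -fN -sN -gN le.
Qed.

(** Hahn-Banach on the multiples of [x], with the functional [m |-> m p(x)] on the integers. For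
    negative [m] the domination holds because [p] is nonnegative. *)
Corollary norming_functional p x : sublinear p -> (forall y, p (- y) = p y) ->
  exists f, [/\ {morph f : x y / x + y}, forall y, `|f y| <= p y & f x = p x].
Proof.
move=> sp pN.
have gp (m : int) : m%:~R * p x <= p (x *~ m).
  case: m => n; first by rewrite -[x *~ _]/(x *+ n) sp.2.
  rewrite -[x *~ _]/(- (x *+ n.+1)) pN sp.2 NegzE rmorphN/= mulNr.
  have p0 : 0 <= p x by have := sublinearN_le x sp; rewrite pN; lra.
  have : 0 <= n.+1%:R * p x by rewrite mulr_ge0.
  rewrite -[_%:~R]/(n.+1%:R : R); lra.
have gD : {morph (fun m : int => m%:~R * p x) : m n / m + n}.
  by move=> m n /=; rewrite rmorphD mulrDl.
have [f [fD fp fE]] := hahn_banach (s := *~%R x) (mulrzDr x) gD sp gp.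
exists f; split=> // [y|]; last by rewrite -[x]mulr1z fE mulr1z mul1r.
rewrite ler_norml fp andbT lerNl.
have f0 : f 0 = 0 by apply: (@addrI _ (f 0)); rewrite -fD !addr0.
have -> : - f y = f (- y) by apply: (@addrI _ (f y)); rewrite -fD !subrr.
by rewrite -pN.
Qed.

End HahnBanach.

(** * Limits of quotients by [k] *)

Section Fekete.
Context (R : realType).

(** [u + C] is subadditive, and the added constant disappears after division by [k]. *)
Lemma fekete (u : nat -> R) (C : R) : 0 <= C -> (forall k, 0 <= u k) ->
  (forall k l, u (k + l)%N <= u k + u l + C) -> cvgn (fun k => u k / k%:R).
Proof.
move=> C0 u0 uD.
pose v k := u k + C.
have v0 k : 0 <= v k by rewrite addr_ge0.
have vD k l : v (k + l)%N <= v k + v l by have := uD k l; rewrite /v; lra.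
pose E := range (fun k => v k.+1 / k.+1%:R).
have Einf : has_inf E.
  split; first by exists (v 1%N / 1%:R), 0%N.
  by exists 0 => _ [k _ <-]; rewrite divr_ge0.
pose L := inf E.
have Lle k : L <= v k.+1 / k.+1%:R by apply: ge_inf; [case: Einf|exists k].
have L0 : 0 <= L.
  by apply: lb_le_inf; [case: Einf|move=> _ [k _ <-]; rewrite divr_ge0].
apply/cvg_ex; exists L; apply/cvgrPdist_le => e e0.
have e2 : 0 < e / 2 by lra.
have [_ [m _ <-] mL] := inf_adherent e2 Einf.
set M := m.+1 in mL; rewrite -/L in mL.
pose B := \sum_(r < M) v r.
have vqM q r : v (q * M + r)%N <= q%:R * v M + v r.
  elim: q => [|q IH]; first by rewrite mul0n add0n mul0r add0r.
  rewrite mulSn -addnA; apply: le_trans (vD _ _) _.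
  have -> : q.+1%:R = 1 + q%:R :> R by rewrite nat1r.
  rewrite mulrDl mul1r; lra.
have vub n : v n <= n%:R * (L + e / 2) + B.
  rewrite {1}(divn_eq n M); apply: le_trans (vqM _ _) _; apply: lerD.
    have vM : v M <= M%:R * (L + e / 2) by rewrite mulrC -ler_pdivrMr// ltW.
    apply: le_trans (ler_wpM2l _ vM) _; first exact: ler0n.
    rewrite mulrA ler_wpM2r//; first lra.
    by rewrite -natrM ler_nat leq_divM.
  have rM : (n %% M < M)%N by rewrite ltn_mod.
  by rewrite /B (bigD1 (Ordinal rM))//= lerDl sumr_ge0.
near=> n.
have n0 : (0 < n)%N by near: n; exists 1%N.
have n0R : (0 : R) < n%:R by rewrite ltr0n.
have nB : B + C <= n%:R * (e / 2).
  rewrite -ler_pdivrMr//; near: n; exact: nbhs_infty_ger.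
have B0 : 0 <= B by rewrite sumr_ge0.
have h1 := vub n.
have h2 : L * n%:R <= v n.
  by rewrite -ler_pdivlMr//; have := Lle n.-1; rewrite prednK.
have uE : u n / n%:R * n%:R = u n by rewrite divfK ?gt_eqF.
have aux (x a N0 : R) : 0 < N0 -> x * N0 = a -> a + C <= N0 * (L + e / 2) + B ->
    L * N0 <= a + C -> B + C <= N0 * (e / 2) -> `|L - x| <= e.
  clear -B0 C0 => N0_gt0 xN0 h3 h4 h5.
  have : N0 * x <= N0 * (L + e) by nra.
  have : N0 * (L - e) <= N0 * x by nra.
  rewrite !ler_pM2l// distrC ler_norml => h6 h7.
  by apply/andP; split; lra.
exact: aux n0R uE h1 h2 nB.
Unshelve. all: by end_near.
Qed.

Lemma cvg_div_nat (C : R) : (fun k => C / k%:R) @ \oo --> (0 : R).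
Proof.
apply/cvgr0Pnorm_le => e e0; near=> n.
have n0 : (0 : R) < n%:R by rewrite ltr0n; near: n; exists 1%N.
rewrite normrM normfV normr_nat ler_pdivrMr// mulrC.
rewrite -ler_pdivrMr//; near: n; exact: nbhs_infty_ger.
Unshelve. all: by end_near.
Qed.

(** Errors bounded independently of [k] vanish after division by [k]. Through this and [le_cvg_div],
    bounded numbers of extra commutators become invisible to scl. *)
Lemma cvg_div_close (u v : nat -> R) (C a : R) : (forall k, `|v k - u k| <= C) ->
  (fun k => u k / k%:R) @ \oo --> a -> (fun k => v k / k%:R) @ \oo --> a.
Proof.
move=> uv ua; have h : (fun k => (v k - u k) / k%:R) @ \oo --> (0 : R).
  apply: norm_cvg0.
  apply: (@squeeze_cvgr _ _ _ _ (fun=> 0) (fun k => C / k%:R)).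
  - near=> k; rewrite normr_ge0/= normrM normfV normr_nat.
    by rewrite ler_wpM2r ?invr_ge0// uv.
  - exact: cvg_cst.
  - exact: cvg_div_nat.
rewrite -[a]add0r; apply: cvg_trans (cvgD h ua).
apply: near_eq_cvg; near=> k; rewrite /= -mulrDl subrK//.
Unshelve. all: by end_near.
Qed.

Lemma le_cvg_div (u v : nat -> R) (C a b : R) : (forall k, u k <= v k + C) ->
  (fun k => u k / k%:R) @ \oo --> a -> (fun k => v k / k%:R) @ \oo --> b ->
  a <= b.
Proof.
move=> uv ua vb; rewrite -[b]addr0.
apply: ler_cvg_to ua (cvgD vb (cvg_div_nat C)) _; near=> k.
by rewrite /= -mulrDl ler_wpM2r ?invr_ge0.
Unshelve. all: by end_near.
Qed.

End Fekete.

(** * Coefficients of chains and clearing of denominators *)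

Section FreegTheory.
Context (K : nzRingType) (X : choiceType).
Implicit Types (s t : seq X) (c : {freeg X / K}).

Lemma freegP c d : (forall x, coeff x c = coeff x d) -> c = d.
Proof. by move=> h; apply/eqP/freeg_eqP. Qed.

Lemma coeff1 x y : coeff y (<< x >> : {freeg X / K}) = (x == y)%:R.
Proof. by rewrite coeffU mul1r. Qed.

Lemma coeff_sum1 s x :
  coeff x (\sum_(y <- s) << y >> : {freeg X / K}) = (count_mem x s)%:R.
Proof.
rewrite raddf_sum/=; elim: s => [|y s IH]; first by rewrite big_nil.
by rewrite big_cons IH coeff1 /= natrD.
Qed.

End FreegTheory.

Lemma perm_eq_freeg (X : choiceType) (s t : seq X) :
  \sum_(x <- s) << x >> = \sum_(x <- t) << x >> :> {freeg X / int} -> perm_eq s t.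
Proof.
move=> st; apply/allP => x _ /=; apply/eqP.
by have := congr1 (coeff x) st; rewrite !coeff_sum1 !natz => -[].
Qed.

Lemma mem_chains1 (K : nzRingType) (G : groupType) (N : {pred G})
    (c : {freeg G / K}) :
  chains1 N c <-> forall x, x \notin N -> coeff x c = 0.
Proof.
split=> [[s [sN ->]] x xN|h].
  rewrite raddf_sum big_seq big1// => p /sN[y /= yN <-].
  rewrite /= coeffZ coeff1; case: eqP => [yx|]; last by rewrite mulr0.
  by move: xN; rewrite -yx yN.
exists [seq (coeff x c, << x >>) | x <- dom c]; split=> [p /mapP[x xc ->]/=|].
  exists x => //=; apply: contraTT xc => /h.
  by rewrite mem_dom => ->; rewrite eqxx.
rewrite big_map /= -[LHS]freeg_sumE; apply: eq_bigr => x _.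
by apply: freegP => y; rewrite coeffZ coeff1 coeffU.
Qed.

Section ChainRat.
Context (G : groupType).
Implicit Types (c d : {freeg G / int}).

Lemma coeff_chain_rat c x : coeff x (chain_rat c) = (coeff x c)%:~R :> rat.
Proof.
rewrite -{2}[c]freeg_sumE /chain_rat !raddf_sum/=; apply: eq_bigr => y _.
by rewrite !coeffU intrM; case: eqP.
Qed.

Lemma chain_rat_inj : injective (@chain_rat G).
Proof.
move=> c d cd; apply: freegP => x; apply: (@intr_inj rat).
by rewrite -!coeff_chain_rat cd.
Qed.

Lemma chain_rat_linear (a : int) c d :
  chain_rat (a *: c + d) = a%:~R *: chain_rat c + chain_rat d.
Proof.
apply: freegP => x; rewrite coeffD coeffZ !coeff_chain_rat coeffD coeffZ.
by rewrite intrD intrM.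
Qed.

Lemma chain_ratD c d : chain_rat (c + d) = chain_rat c + chain_rat d.
Proof. by have := chain_rat_linear 1 c d; rewrite !scale1r. Qed.

Lemma chain_ratN c : chain_rat (- c) = - chain_rat c.
Proof. by apply: freegP => x; rewrite coeffN !coeff_chain_rat coeffN intrN. Qed.

Lemma chain_ratMn c n : chain_rat (c *+ n) = chain_rat c *+ n.
Proof. by apply: freegP => x; rewrite coeffMn !coeff_chain_rat coeffMn rmorphMn. Qed.

Lemma chain_rat1 (x : G) : chain_rat << x >> = << x >>.
Proof.
by apply: freegP => y; rewrite coeff_chain_rat !coeff1; case: eqP.
Qed.

Lemma chain_ratZ (a : int) c : chain_rat (a *: c) = a%:~R *: chain_rat c.
Proof. by apply: freegP => x; rewrite coeffZ !coeff_chain_rat coeffZ intrM. Qed.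

Lemma chain_rat_boundary1 (g : G * G) : chain_rat (boundary << g >>) = boundary << g >>.
Proof.
rewrite /boundary !liftU !scale1r !chain_ratD chain_ratN.
by rewrite !chain_rat1.
Qed.

(** The denominators in a bounding 2-chain are cleared one generator at a time. Membership of [z] in
    [chains1 N] is then read off from the coefficients of [chain_rat z]. *)
Lemma mixed_chains_clear (N : {pred G}) (c : {freeg G / rat}) : mixed_chains N c ->
  exists k z, [/\ (0 < k)%N, mixed_chains N z & k%:R *: c = chain_rat z].
Proof.
move=> [c1 [_ [s [sN ->]] cE]].
suff [k [z [k0 zN zE]]] : exists k (z : {freeg G / int}),
    [/\ (0 < k)%N, (@boundary int G @` chains2' N) z & k%:R *: c = chain_rat z].
  exists k, z; split=> //; split=> //; apply/mem_chains1 => x xN.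
  apply: (@intr_inj rat); rewrite -coeff_chain_rat -zE coeffZ.
  by move/mem_chains1: c1 => ->//; rewrite mulr0.
rewrite -cE {c c1 cE}; elim: s sN => [|p s IH] sN.
  exists 1%N, 0; split=> //.
    by exists 0; [exact: gen_submod0|rewrite /boundary raddf0].
  rewrite big_nil /boundary raddf0 scaler0; apply: freegP => x.
  by rewrite coeff_chain_rat !coeff0.
have [|k [z [k0 [b bN bz] zE]]] := IH.
  by move=> q qs; apply: sN; rewrite inE qs orbT.
have /sN[g /= gN gE] := mem_head p s.
pose d := `|denq p.1|%N; pose n := numq p.1.
have d0 : (0 < d)%N by rewrite absz_gt0 denq_neq0.
have pE : d%:R * p.1 = n%:~R :> rat.
  rewrite -[p.1 in LHS]divq_num_den mulrCA -[d%:R]/(d%:~R) /d absz_denq divff ?mulr1//.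
  by rewrite intr_eq0 denq_neq0.
(* With [p.1 = n / d] and [z] equal to [k] times the remaining sum, multiplication by [d k] gives
   [n k] times the boundary of [g] plus [d z]. *)
exists (d * k)%N, ((n * k%:Z) *: boundary << g >> + (d%:Z : int) *: z).
split; first by rewrite muln_gt0 d0.
  exists ((n * k%:Z) *: << g >> + (d%:Z : int) *: b); last first.
    by rewrite [LHS]fglift_linear; congr +%R; rewrite -bz -[(d%:Z : int) *: b]addr0
      [LHS]fglift_linear [fglift _ 0]raddf0 addr0.
  apply: gen_submodP.
    by exists [:: (1, << g >>)]; split; [move=> q; rewrite inE => /eqP ->; exists g
      |rewrite big_seq1 scale1r].
  by rewrite -[_ *: b]addr0; apply: gen_submodP => //; exact: gen_submod0.
rewrite big_cons [boundary _]fglift_linear -!/(boundary _) -gE chain_rat_linear.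
rewrite chain_ratZ -zE chain_rat_boundary1 scalerDr !scalerA natrM -natrM.
by congr (_ *: _ + _); rewrite natrM mulrAC pE intrM.
Qed.

End ChainRat.

(** * Mixed commutator length *)

Section MixedCommutators.
Local Open Scope group_scope.
Context (G : groupType) (N : {pred G}).
Hypotheses (gN : group_closed N) (nN : forall x g, x \in N -> x ^ g \in N).
Implicit Types (x y z g h : G) (s t : seq G) (m n : nat).

(** Products of at most [n] commutators: allowing fewer makes the bound monotone in [n] and keeps
    the counting in the natural numbers, without an infimum. *)
Definition mixed_comm n y := exists2 s : seq (G * G),
  forall p, p \in s -> p.2 \in N &
  (size s <= n)%N /\ y = \prod_(p <- s) (p.1 * p.2 * p.1^-1 * p.2^-1).

Let N1 : 1 \in N := gN.1.
Let NV x : x \in N -> x^-1 \in N. Proof. exact: group_closedV. Qed.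
Let NM x y : x \in N -> y \in N -> x * y \in N. Proof. exact: group_closedM. Qed.

Lemma groupX_in n x : x \in N -> x ^+ n \in N.
Proof. by move=> xN; elim: n => [|n IH]; rewrite ?expg0// expgS NM. Qed.

Lemma prod_in (T : eqType) (s : seq T) (f : T -> G) :
  (forall i, i \in s -> f i \in N) -> \prod_(i <- s) f i \in N.
Proof.
move=> h; rewrite big_seq; elim/big_ind: _ => //.
Qed.

Lemma mixed_comm_in n y : mixed_comm n y -> y \in N.
Proof.
move=> [s sN [_ ->]]; apply: prod_in => p /sN pN.
by rewrite NM ?NV// -{1}[p.1]invgK -mulgA -conjgE nN.
Qed.

Lemma mixed_comm1 n : mixed_comm n 1.
Proof. by exists [::] => //; rewrite big_nil. Qed.

Lemma mixed_commW m n y : (m <= n)%N -> mixed_comm m y -> mixed_comm n y.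
Proof. by move=> mn [s sN [sm ->]]; exists s => //; rewrite (leq_trans sm). Qed.

Lemma mixed_commM m n x y :
  mixed_comm m x -> mixed_comm n y -> mixed_comm (m + n) (x * y).
Proof.
move=> [s sN [sm ->]] [t tN [tn ->]]; exists (s ++ t).
  by move=> p; rewrite mem_cat => /orP[/sN|/tN].
by rewrite size_cat leq_add// big_cat.
Qed.

Lemma mixed_comm_comm g x : x \in N -> mixed_comm 1 (g * x * g^-1 * x^-1).
Proof.
move=> xN; exists [:: (g, x)]; first by move=> p; rewrite inE => /eqP ->.
by rewrite big_seq1.
Qed.

Lemma mixed_comm_ind (P : nat -> G -> Prop) : P 0%N 1 ->
  (forall n g x y, x \in N -> mixed_comm n y -> P n y ->
    P n.+1 (g * x * g^-1 * x^-1 * y)) ->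
  (forall m n y, (m <= n)%N -> P m y -> P n y) ->
  forall n y, mixed_comm n y -> P n y.
Proof.
move=> P1 PM PW n y [s sN [sn ->]]; apply: PW sn _.
elim: s sN => [|p s IH] sN; first by rewrite big_nil.
rewrite big_cons; apply: PM.
- by apply: sN; rewrite mem_head.
- by exists s => // q qs; apply: sN; rewrite inE qs orbT.
- by apply: IH => q qs; apply: sN; rewrite inE qs orbT.
Qed.

Lemma mixed_commJ n y h : mixed_comm n y -> mixed_comm n (y ^ h).
Proof.
move: n y; apply: mixed_comm_ind; first by rewrite conj1g; exact: mixed_comm1.
  move=> n g x y xN _ IH; rewrite conjMg -add1n; apply: mixed_commM => //.
  by rewrite !conjMg !conjVg; apply: mixed_comm_comm; exact: nN.
by move=> m n y; exact: mixed_commW.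
Qed.

Lemma mixed_commV n y : mixed_comm n y -> mixed_comm n y^-1.
Proof.
move: n y; apply: mixed_comm_ind; first by rewrite invg1; exact: mixed_comm1.
  move=> n g x y xN _ IH; rewrite invgM -addn1; apply: mixed_commM => //.
  have -> : (g * x * g^-1 * x^-1)^-1 = g^-1 * (x ^ g^-1) * g^-1^-1 * (x ^ g^-1)^-1.
    by rewrite conjgE !invgM !invgK !mulgA mulVg mul1g mulgVK.
  by apply: mixed_comm_comm; exact: nN.
by move=> m n y; exact: mixed_commW.
Qed.

(** A distance on [G], invariant under translations and conjugation, whose balls about 1 are given
    by [mixed_comm]; it is finite exactly inside the cosets of [[G,N]]. *)
Definition near n x y := mixed_comm n (x * y^-1).

Lemma near0 x : near 0 x x.
Proof. by rewrite /near mulgV; exact: mixed_comm1. Qed.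

Lemma near_sym n x y : near n x y -> near n y x.
Proof. by move/mixed_commV; rewrite /near invgM invgK. Qed.

Lemma near_trans m n x y z : near m x y -> near n y z -> near (m + n) x z.
Proof. by move=> h1 h2; have := mixed_commM h1 h2; rewrite mulgA mulgVK. Qed.

Lemma nearM m n x y x' y' :
  near m x y -> near n x' y' -> near (m + n) (x * x') (y * y').
Proof.
move=> h1 h2; rewrite /near addnC.
have := mixed_commM (mixed_commJ x^-1 h2) h1.
by rewrite conjgE invgK !mulgA !invgM !mulgA mulgVK.
Qed.

Lemma nearV n x y : near n x y -> near n x^-1 y^-1.
Proof.
move=> h; rewrite /near invgK; have := mixed_commV (mixed_commJ y h).
by rewrite conjgE mulgVK invgM invgK.
Qed.

Lemma near_mixed_comm m n x y : near m x y -> mixed_comm n y -> mixed_comm (m + n) x.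
Proof.
by move=> h1 h2; rewrite -(mulgVK y x); exact: mixed_commM.
Qed.

Lemma nearJ x g : x \in N -> near 1 (x ^ g) x.
Proof.
move=> xN; rewrite /near conjgE -{2}[g]invgK mulgA.
exact: mixed_comm_comm.
Qed.

Lemma nearC x y : y \in N -> near 1 (x * y) (y * x).
Proof. by move=> yN; rewrite /near invgM mulgA; exact: mixed_comm_comm. Qed.

(* Reversing three consecutive blocks costs a single commutator, since
   abc (cba)^-1 = [ab, ca^-1]. *)
Lemma near_rev3 a b c : c * a^-1 \in N -> near 1 (a * b * c) (c * b * a).
Proof.
move=> caN; rewrite /near.
have := mixed_comm_comm (a * b) caN.
by rewrite !invgM !invgK !mulgA mulgVK -!mulgA.
Qed.

(** Raising the exponent by two costs one commutator: in [x^m (x (xy) y^m) y] the bracket is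
    reversed by [near_rev3], which leaves [x^m y^m (xy)^2]. This rate, one commutator for two
    factors [xy], is the source of the bound 1/2 in [stl_mul]. *)
Lemma near_power n x y : x \in N -> y \in N ->
  near n (x ^+ n.*2 * y ^+ n.*2) ((x * y) ^+ n.*2).
Proof.
move=> xN yN; elim: n => [|n IH]; first by rewrite !expg0 mulg1; exact: near0.
have {}IH := nearM IH (near0 ((x * y) * (x * y))).
rewrite addn0 in IH; rewrite doubleS; set m := n.*2 in IH *.
have E z : z ^+ m.+2 = z ^+ m * (z * z) by rewrite !expgSr mulgA.
rewrite (E (x * y)) -add1n; apply: near_trans IH.
have yxN : y ^+ m * x^-1 \in N by rewrite NM ?groupX_in ?NV.
have h := near_rev3 (x * y) yxN.
have := nearM (nearM (near0 (x ^+ m)) h) (near0 y).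
rewrite !addn0.
have -> : x ^+ m * (x * (x * y) * y ^+ m) * y = x ^+ m.+2 * y ^+ m.+2.
  by rewrite expgSr expgSr (expgSr y) (expgS y) !mulgA.
by rewrite !mulgA.
Qed.

Lemma near_prod (I : Type) (r : seq I) (f g : I -> G) :
  (forall i, near 1 (f i) (g i)) ->
  near (size r) (\prod_(i <- r) f i) (\prod_(i <- r) g i).
Proof.
move=> h; elim: r => [|i r IH]; first by rewrite !big_nil; exact: near0.
by rewrite !big_cons /= -add1n; exact: nearM.
Qed.

(** One commutator moves an element of [N] past a block of any length, so the cost is the number of
    elements and not the number of transpositions. *)
Lemma near_perm s t : {subset s <= N} -> perm_eq s t ->
  near (size s) (\prod_(x <- s) x) (\prod_(x <- t) x).
Proof.
elim: s t => [|x s IH] t sN st.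
  by move: st; rewrite perm_sym => /perm_nilP ->; rewrite big_nil; exact: near0.
have xt : x \in t by rewrite -(perm_mem st) mem_head.
have xN : x \in N by apply: sN; rewrite mem_head.
case/splitPr: xt st => t1 t2.
move=> st; have {}st : perm_eq s (t1 ++ t2).
  rewrite -(perm_cons x); apply: perm_trans st _.
  by rewrite -cat1s perm_catCA.
have {IH st} h : near (size s) (\prod_(z <- s) z) (\prod_(z <- t1 ++ t2) z).
  by apply: IH => // z zs; apply: sN; rewrite inE zs orbT.
rewrite big_cons; have := nearM (near0 x) h => {}h.
rewrite /= -addn1; apply: near_trans h _.
rewrite !big_cat big_cons /= !mulgA.
by rewrite -[1%N]addn0; apply: nearM; [apply: near_sym; exact: nearC|exact: near0].
Qed.

Definition prod_pow s k := \prod_(x <- s) x ^+ k.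

Lemma prod_pow_cat s t k : prod_pow (s ++ t) k = prod_pow s k * prod_pow t k.
Proof. exact: big_cat. Qed.

Lemma prod_pow1 s : prod_pow s 1 = \prod_(x <- s) x.
Proof. by apply: eq_bigr => x _; rewrite expg1. Qed.

Lemma prod_pow_in s k : {subset s <= N} -> prod_pow s k \in N.
Proof. by move=> sN; apply: prod_in => x /sN; exact: groupX_in. Qed.

Let subset_cons x s : {subset x :: s <= N} -> x \in N /\ {subset s <= N}.
Proof.
move=> h; split; first by apply: h; rewrite mem_head.
by move=> y ys; apply: h; rewrite inE ys orbT.
Qed.

(** The cost does not depend on the exponents, since [x^l] is moved past a whole product at once.
    This is the almost subadditivity to which [fekete] applies. *)
Lemma near_prod_powD s k l : {subset s <= N} ->
  near (size s) (prod_pow s (k + l)) (prod_pow s k * prod_pow s l).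
Proof.
elim: s => [|x s IH]; first by rewrite /prod_pow !big_nil mulg1 => _; exact: near0.
move=> /subset_cons[xN sN]; rewrite /prod_pow !big_cons -!/(prod_pow _ _) /= -addn1.
rewrite expgnDr.
apply: (near_trans (y := x ^+ k * x ^+ l * (prod_pow s k * prod_pow s l))).
  by rewrite -[size s]add0n; apply: nearM; [exact: near0|exact: IH].
rewrite -!mulgA -[1%N]add0n; apply: nearM; first exact: near0.
rewrite !mulgA -[1%N]addn0; apply: nearM; last exact: near0.
by apply: nearC; exact: prod_pow_in.
Qed.

Lemma near_prod_powM s k n : {subset s <= N} ->
  near (n * size s) (prod_pow s (k * n)) (prod_pow s k ^+ n).
Proof.
move=> sN; elim: n => [|n IH].
  rewrite muln0 expg0 /prod_pow big1; first exact: near0.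
  by move=> x _; rewrite expg0.
rewrite mulnS expgS mulSn; apply: near_trans (near_prod_powD _ _ sN) _.
by rewrite -[(n * _)%N]add0n; apply: nearM => //; exact: near0.
Qed.

Lemma near_prod_powV s k : {subset s <= N} ->
  near (size s) (prod_pow [seq x^-1 | x <- s] k) (prod_pow s k)^-1.
Proof.
move=> sN; have -> : (prod_pow s k)^-1 = \prod_(x <- rev s) (x ^+ k)^-1.
  by rewrite prodgV revK.
rewrite /prod_pow big_map.
have -> : \prod_(x <- s) x^-1 ^+ k = \prod_(x <- [seq (x ^+ k)^-1 | x <- s]) x.
  by rewrite big_map; apply: eq_bigr => x _; rewrite expVgn.
have -> : \prod_(x <- rev s) (x ^+ k)^-1 =
    \prod_(x <- [seq (x ^+ k)^-1 | x <- rev s]) x by rewrite big_map.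
rewrite -[size s](size_map (fun x => (x ^+ k)^-1)); apply: near_perm.
  by move=> _ /mapP[x /sN xN ->]; rewrite NV// groupX_in.
by rewrite perm_map// perm_sym perm_rev.
Qed.

Lemma near_prod_pow_perm s t k : {subset s <= N} -> perm_eq s t ->
  near (size s) (prod_pow s k) (prod_pow t k).
Proof.
move=> sN st; rewrite /prod_pow -!(big_map (fun x => x ^+ k) predT id).
rewrite -[size s](size_map (fun x => x ^+ k)); apply: near_perm.
  by move=> _ /mapP[x /sN xN ->]; exact: groupX_in.
exact: perm_map.
Qed.

(* Stable mixed commutator length of sequences *)
Local Close Scope group_scope.
Context (R : realType).

(** Outside [[G,N]] the value is the default 0; for [balanced] sequences in [N], [balanced_pow]
    excludes this case. *)
Definition mlen y : nat :=
  match pselect (exists n, `[< mixed_comm n y >]) with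
  | left h => ex_minn h
  | right _ => 0%N
  end.

Lemma mlen_le n y : mixed_comm n y -> (mlen y <= n)%N.
Proof.
move=> h; rewrite /mlen; case: pselect => // hn.
by case: ex_minnP => m _; apply; exact/asboolP.
Qed.

Lemma mlenP n y : mixed_comm n y -> mixed_comm (mlen y) y.
Proof.
move=> h; rewrite /mlen; case: pselect => [hn|[]]; last by exists n; exact/asboolP.
by case: ex_minnP => m /asboolP.
Qed.

Definition balanced s := exists n, mixed_comm n (prod_pow s 1).

Lemma mixed_commX n y k : mixed_comm n y -> mixed_comm (k * n) (y ^+ k)%g.
Proof.
move=> h; elim: k => [|k IH]; first by rewrite expg0; exact: mixed_comm1.
by rewrite expgS mulSn; exact: mixed_commM.
Qed.

Lemma balanced_pow s k : {subset s <= N} -> balanced s ->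
  mixed_comm (mlen (prod_pow s k)) (prod_pow s k).
Proof.
move=> sN [n hn]; have := near_prod_powM 1 k sN; rewrite mul1n => h.
exact: mlenP (near_mixed_comm h (mixed_commX k hn)).
Qed.

(** This is scl without the infimum over conjugates: by [cl_chainP] the infimum changes the length
    by at most the number of elements, so the limits agree. *)
Definition stl s : R := limn (fun k => (mlen (prod_pow s k))%:R / k%:R : R).

Lemma stl_cvg s : {subset s <= N} -> balanced s ->
  (fun k => (mlen (prod_pow s k))%:R / k%:R : R) @ \oo --> stl s.
Proof.
move=> sN bs; apply: (@fekete _ _ (size s)%:R) => // k l.
rewrite -!natrD ler_nat; apply: mlen_le.
rewrite addnC; apply: near_mixed_comm (near_prod_powD k l sN) _.
by apply: mixed_commM; exact: balanced_pow.
Qed.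

Lemma stl_le s (u : nat -> R) (C L : R) : {subset s <= N} -> balanced s ->
  (forall k, (mlen (prod_pow s k))%:R <= u k + C) ->
  (fun k => u k / k%:R) @ \oo --> L -> stl s <= L.
Proof. by move=> sN bs h; apply: le_cvg_div h (stl_cvg sN bs). Qed.

Lemma stl_ge0 s : {subset s <= N} -> balanced s -> 0 <= stl s.
Proof.
move=> sN bs; apply: limr_ge; first by apply/cvg_ex; eexists; exact: stl_cvg.
by near=> k; rewrite divr_ge0.
Unshelve. all: by end_near.
Qed.

Lemma balanced_near n s t : near n (prod_pow s 1) (prod_pow t 1) ->
  balanced t -> balanced s.
Proof. by move=> h [m hm]; exists (n + m)%N; exact: near_mixed_comm h hm. Qed.

Lemma stl_near_le n s t : {subset s <= N} -> {subset t <= N} -> balanced t ->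
  (forall k, near n (prod_pow s k) (prod_pow t k)) -> stl s <= stl t.
Proof.
move=> sN tN bt st; have bs := balanced_near (st 1%N) bt.
apply: (stl_le (C := n%:R) sN bs _ (stl_cvg tN bt)) => k.
rewrite -natrD ler_nat addnC; apply: mlen_le.
by apply: near_mixed_comm (st k) _; exact: balanced_pow.
Qed.

Lemma stl_near n s t : {subset s <= N} -> {subset t <= N} -> balanced t ->
  (forall k, near n (prod_pow s k) (prod_pow t k)) -> stl s = stl t.
Proof.
move=> sN tN bt st; apply/eqP; rewrite eq_le (stl_near_le sN tN bt st)/=.
have st' k : near n (prod_pow t k) (prod_pow s k) by exact: near_sym.
by apply: stl_near_le st' => //; exact: balanced_near (st 1%N) bt.
Qed.

Lemma stl_cat s t : {subset s <= N} -> {subset t <= N} ->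
  balanced s -> balanced t -> balanced (s ++ t) /\ stl (s ++ t) <= stl s + stl t.
Proof.
move=> sN tN bs bt.
have stN : {subset s ++ t <= N} by move=> x; rewrite mem_cat => /orP[/sN|/tN].
have bst : balanced (s ++ t).
  case: bs bt => [m hm] [n hn]; exists (m + n)%N.
  by rewrite prod_pow_cat; exact: mixed_commM.
split=> //; pose u k : R := (mlen (prod_pow s k))%:R + (mlen (prod_pow t k))%:R.
apply: (stl_le (u := u) (C := 0)) => //.
  move=> k; rewrite addr0 /u -natrD ler_nat prod_pow_cat; apply: mlen_le.
  by apply: mixed_commM; exact: balanced_pow.
rewrite (_ : (fun k => _) = (fun k => (mlen (prod_pow s k))%:R / k%:R +
   (mlen (prod_pow t k))%:R / k%:R)); last by apply/funext => k; rewrite mulrDl.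
by apply: cvgD; exact: stl_cvg.
Qed.

Lemma stl_inv s : {subset s <= N} -> balanced s ->
  balanced [seq x^-1 | x <- s]%g /\ stl [seq x^-1 | x <- s]%g = stl s.
Proof.
move=> sN bs; set t := map _ s.
have tN : {subset t <= N} by move=> _ /mapP[x /sN xN ->]; exact: NV.
have bt : balanced t.
  case: bs => n hn; exists (size s + n)%N.
  by apply: near_mixed_comm (near_prod_powV 1 sN) _; exact: mixed_commV.
split=> //; apply/eqP; rewrite eq_le; apply/andP; split.
  apply: (stl_le (C := (size s)%:R) tN bt _ (stl_cvg sN bs)) => k.
  rewrite -natrD ler_nat addnC; apply: mlen_le.
  apply: near_mixed_comm (near_prod_powV k sN) _; apply: mixed_commV.
  exact: balanced_pow.
apply: (stl_le (C := (size s)%:R) sN bs _ (stl_cvg tN bt)) => k.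
rewrite -natrD ler_nat addnC; apply: mlen_le.
have := nearV (near_prod_powV k sN); rewrite invgK => /near_sym h.
by apply: near_mixed_comm h _; apply: mixed_commV; exact: balanced_pow.
Qed.

Lemma prod_pow_rep s n k :
  prod_pow (flatten (nseq n s)) k = (prod_pow s k ^+ n)%g.
Proof.
elim: n => [|n IH]; first by rewrite /prod_pow big_nil expg0.
by rewrite /= prod_pow_cat IH expgS.
Qed.

Lemma stl_rep s n : {subset s <= N} -> balanced s ->
  balanced (flatten (nseq n s)) /\ stl (flatten (nseq n s)) = n%:R * stl s.
Proof.
move=> sN bs; set t := flatten _.
have tN : {subset t <= N}.
  by move=> x /flattenP[s' /nseqP[-> _] /sN].
have bt : balanced t.
  by case: bs => m hm; exists (n * m)%N; rewrite prod_pow_rep; exact: mixed_commX.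
split=> //.
(* Along the multiples of [n], dividing by [k] instead of [k n] gains the factor [n]. *)
have cn : (fun k => (mlen (prod_pow s (k * n)))%:R / k%:R : R) @ \oo -->
    n%:R * stl s.
  case: n {t tN bt} => [|n].
    rewrite mul0r (_ : (fun _ => _) = (fun=> 0)); first exact: cvg_cst.
    apply/funext => k; rewrite muln0.
    have -> : mlen (prod_pow s 0) = 0%N.
      apply/eqP; rewrite -leqn0; apply: mlen_le.
      rewrite /prod_pow big1; first exact: mixed_comm1.
      by move=> x _; rewrite expg0.
    by rewrite mul0r.
  have h : (fun k => (mlen (prod_pow s (k * n.+1)))%:R / (k * n.+1)%:R : R) @ \oo
      --> stl s.
    apply: (@cvg_comp _ _ _ (fun k => (k * n.+1)%N) _ _ _ _ _ (stl_cvg sN bs)).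
    move=> A [m _ mA]; exists m => // k mk; apply: mA => /=.
    by rewrite (leq_trans mk)// leq_pmulr.
  have h2 : (fun k => n.+1%:R * ((mlen (prod_pow s (k * n.+1)))%:R /
      (k * n.+1)%:R) : R) @ \oo --> n.+1%:R * stl s by exact: cvgM (cvg_cst _) h.
  apply: cvg_trans h2.
  apply: near_eq_cvg; near=> k; rewrite /= natrM.
  have k0 : k%:R != 0 :> R by rewrite pnatr_eq0 -lt0n; near: k; exists 1%N.
  by field; rewrite k0 nat1r pnatr_eq0.
apply/eqP; rewrite eq_le; apply/andP; split.
  apply: (stl_le (C := (n * size s)%:R) tN bt _ cn) => k.
  rewrite -natrD ler_nat addnC; apply: mlen_le.
  rewrite prod_pow_rep; apply: near_mixed_comm (balanced_pow _ sN bs).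
  exact: near_sym (near_prod_powM k n sN).
apply: (le_cvg_div (C := (n * size s)%:R) _ cn (stl_cvg tN bt)) => k.
rewrite -natrD ler_nat addnC; apply: mlen_le.
apply: near_mixed_comm (near_prod_powM k n sN) _.
by rewrite -prod_pow_rep; exact: balanced_pow.
Unshelve. all: by end_near.
Qed.

Lemma stl_bounded n s : {subset s <= N} ->
  (forall k, mixed_comm n (prod_pow s k)) -> balanced s /\ stl s = 0.
Proof.
move=> sN h; have bs : balanced s by exists n; exact: h.
split=> //; apply/eqP; rewrite eq_le stl_ge0// andbT.
apply: (stl_le (u := fun=> 0) (C := n%:R)) => // [k|].
  by rewrite add0r ler_nat; exact: mlen_le.
rewrite (_ : (fun _ => _) = (fun=> 0)); first exact: cvg_cst.
by apply/funext => k; rewrite mul0r.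
Qed.

Lemma stl_mul x y : x \in N -> y \in N ->
  balanced [:: x; y; (x * y)^-1]%g /\ stl [:: x; y; (x * y)^-1]%g <= 2^-1.
Proof.
move=> xN yN; set s := [:: _; _; _].
have sN : {subset s <= N}.
  move=> z; rewrite !inE => /or3P[] /eqP -> //; exact/NV/NM.
have E k : prod_pow s k = (x ^+ k * y ^+ k * ((x * y) ^+ k)^-1)%g.
  by rewrite /prod_pow !big_cons big_nil mulg1 expVgn mulgA.
have E1 (b : bool) : prod_pow s b = 1%g.
  rewrite E; case: b; first exact: mulgV.
  by rewrite !expg0 mulg1 mulgV.
have bs : balanced s by exists 0%N; rewrite (E1 true); exact: mixed_comm1.
split=> //; apply: (stl_le (u := fun k => k%:R / 2) (C := 3)) => // [k|].
  have h := near_prod_powD (odd k) k./2.*2 sN.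
  rewrite odd_double_half E1 mul1g [X in near _ _ X]E in h.
  have := mlen_le (near_mixed_comm h (near_power k./2 xN yN)).
  rewrite -(ler_nat R) natrD => /le_trans; apply.
  rewrite addrC lerD2r ler_pdivlMr// -natrM ler_nat muln2.
  by rewrite -[X in (_ <= X)%N]odd_double_half leq_addl.
have h : (fun=> 2^-1 : R) @ \oo --> (2^-1 : R) by exact: cvg_cst.
apply: cvg_trans h; apply: near_eq_cvg; near=> k.
have k0 : k%:R != 0 :> R by rewrite pnatr_eq0 -lt0n; near: k; exists 1%N.
by field.
Unshelve. all: by end_near.
Qed.

Lemma cl_le n y : (cl R N y <= n%:R%:E)%E <-> mixed_comm n y.
Proof.
split=> [yn|[s sN [sn yE]]].
  have : (cl R N y < n.+1%:R%:E)%E by apply: le_lt_trans yn _; rewrite lte_fin ltr_nat.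
  move=> /ereal_inf_lt[_ [s [sN yE] <-]]; rewrite lte_fin ltr_nat ltnS => sn.
  by exists s.
apply: (@le_trans _ _ (size s)%:R%:E); last by rewrite lee_fin ler_nat.
by apply: ereal_inf_lbound; exists s.
Qed.

Definition signed_seq (xs ys : seq G) : seq G := xs ++ [seq y^-1 | y <- ys]%g.

Lemma signed_seq_in xs ys : {subset xs <= N} -> {subset ys <= N} ->
  {subset signed_seq xs ys <= N}.
Proof.
move=> xsN ysN x; rewrite mem_cat => /orP[/xsN//|/mapP[y /ysN yN ->]].
exact: NV.
Qed.

(** Conjugating one factor costs one commutator, so the choice of the conjugates matters by at most
    the number of factors. *)
Lemma cl_chainP xs ys n : {subset xs <= N} -> {subset ys <= N} ->
  mixed_comm n (prod_pow (signed_seq xs ys) 1) ->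
  exists m, [/\ cl_chain R N xs ys = m%:R%:E,
    (m <= mlen (prod_pow (signed_seq xs ys) 1))%N &
    (mlen (prod_pow (signed_seq xs ys) 1) <= m + size (signed_seq xs ys))%N].
Proof.
move=> xsN ysN hn; set s := signed_seq xs ys in hn *.
pose W (gh : (nat -> G) * (nat -> G)) : G :=
  ((\prod_(i < size xs) (nth 1 xs i ^ gh.1 i)) *
   (\prod_(j < size ys) (nth 1 ys j ^ gh.2 j)^-1))%g.
have sE : prod_pow s 1 = ((\prod_(i < size xs) nth 1 xs i) *
    (\prod_(j < size ys) (nth 1 ys j)^-1))%g.
  rewrite prod_pow1 big_cat/= big_map (big_nth 1%g) big_mkord; congr (_ * _)%g.
  by rewrite (big_nth 1%g) big_mkord.
have sz n' : size (index_enum 'I_n') = n' by rewrite -[RHS]card_ord cardT enumT.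
have nW gh : near (size s) (prod_pow s 1) (W gh).
  rewrite sE size_cat size_map; apply: nearM.
    rewrite -[X in near X]sz; apply: near_prod => i; apply: near_sym; apply: nearJ.
    by apply: xsN; rewrite mem_nth.
  rewrite -[X in near X]sz; apply: near_prod => i; apply: nearV.
  by apply: near_sym; apply: nearJ; apply: ysN; rewrite mem_nth.
have W1 : W (fun=> 1%g, fun=> 1%g) = prod_pow s 1.
  by rewrite sE /W /=; congr (_ * _)%g; apply: eq_bigr => i _; rewrite conjg1.
have le m : mixed_comm m (prod_pow s 1) -> (cl_chain R N xs ys <= m%:R%:E)%E.
  rewrite -W1 => /cl_le; apply: le_trans.
  by apply: ereal_inf_lbound; exists (fun=> 1%g, fun=> 1%g).
have ex : exists m, (cl_chain R N xs ys <= m%:R%:E)%E by exists n; exact: le.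
case: (ex_minnP ex) => m mle mmin; exists m; split.
- apply/eqP; rewrite eq_le mle/= leNgt; apply/negP.
  move=> /ereal_inf_lt[_ [gh _ <-]].
  move=> /ereal_inf_lt[_ [t [tN tE] <-]]; rewrite lte_fin ltr_nat ltnNge.
  move=> /negP; apply; apply: mmin; apply: (@le_trans _ _ (cl R N (W gh))).
    by apply: ereal_inf_lbound; exists gh.
  by apply/cl_le; exists t.
- by apply: mmin; apply: le; exact: mlenP hn.
- have : (cl_chain R N xs ys < m.+1%:R%:E)%E.
    by apply: le_lt_trans mle _; rewrite lte_fin ltr_nat.
  move=> /ereal_inf_lt[_ [gh _ <-]] /ereal_inf_lt[_ [t [tN tE] <-]].
  rewrite lte_fin ltr_nat ltnS => tm; apply: mlen_le; rewrite addnC.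
  by apply: near_mixed_comm (nW gh) _; exists t.
Qed.

Lemma cl_growth_cvg xs ys : {subset xs <= N} -> {subset ys <= N} ->
  balanced (signed_seq xs ys) ->
  cl_growth R N xs ys @ \oo --> stl (signed_seq xs ys).
Proof.
move=> xsN ysN bs; have sN := signed_seq_in xsN ysN.
pose v k : R := fine (cl_chain R N [seq (x ^+ k)%g | x <- xs] [seq (y ^+ k)%g | y <- ys]).
apply: (@cvg_div_close _ _ v (size (signed_seq xs ys))%:R _ _ (stl_cvg sN bs)) => k.
have kE : prod_pow (signed_seq [seq (x ^+ k)%g | x <- xs] [seq (y ^+ k)%g | y <- ys]) 1
    = prod_pow (signed_seq xs ys) k.
  rewrite prod_pow1 /prod_pow !big_cat/= !big_map; congr (_ * _)%g.
  by apply: eq_bigr => y _; rewrite expVgn.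
have kN zs : {subset zs <= N} -> {subset [seq (x ^+ k)%g | x <- zs] <= N}.
  by move=> zsN _ /mapP[x /zsN xN ->]; exact: groupX_in.
have := balanced_pow k sN bs; rewrite -[X in mixed_comm _ X]kE.
move=> /(cl_chainP (kN _ xsN) (kN _ ysN))[m []].
rewrite kE /v => -> /= mle mge.
rewrite distrC ger0_norm ?subr_ge0 ?ler_nat// lerBlDl -natrD ler_nat.
by move: mge; rewrite !size_cat !size_map.
Qed.

(* The restriction of phi to N is a G-invariant homogeneous quasimorphism of defect
   at most D. *)
Definition inv_hqm (D : R) (phi : G -> R) :=
  [/\ forall x y, x \in N -> y \in N -> `|phi (x * y)%g - phi x - phi y| <= D,
      forall x n, x \in N -> phi (x ^+ n)%g = n%:R * phi x &
      forall x g, x \in N -> phi (x ^ g)%g = phi x].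

Lemma inv_hqm_ge0 D phi : inv_hqm D phi -> 0 <= D.
Proof. by move=> [h _ _]; exact: le_trans (h 1%g 1%g N1 N1). Qed.

Lemma inv_hqm1 D phi : inv_hqm D phi -> phi 1%g = 0.
Proof. by move=> [_ h _]; have := h 1%g 0%N N1; rewrite expg0 mul0r. Qed.

Lemma inv_hqmV D phi x : inv_hqm D phi -> x \in N -> phi (x^-1)%g = - phi x.
Proof.
move=> hphi xN; have [h1 h2 _] := hphi.
have bnd n : n%:R * `|phi x + phi (x^-1)%g| <= D.
  have := h1 (x ^+ n)%g (x^-1 ^+ n)%g (groupX_in n xN) (groupX_in n (NV xN)).
  rewrite !h2 ?NV// expVgn mulgV (inv_hqm1 hphi) sub0r -opprD normrN -mulrDr.
  by rewrite normrM normr_nat.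
apply/eqP; rewrite -addr_eq0 addrC -normr_le0 leNgt; apply/negP => d0.
have := bnd (Num.bound (D / `|phi x + phi (x^-1)%g|)).
rewrite leNgt -ltr_pdivrMr// archi_boundP// divr_ge0//; exact: inv_hqm_ge0 hphi.
Qed.

(** Each commutator costs [D] twice: once for its own value, since [gxg^-1] and [x^-1] have opposite
    values, and once for multiplying it with the remaining product. *)
Lemma inv_hqm_mixed_comm D phi n y : inv_hqm D phi -> mixed_comm n y ->
  `|phi y| <= 2 * D * n%:R.
Proof.
move=> hphi; have [h1 h2 h3] := hphi; have D0 := inv_hqm_ge0 hphi.
move: n y; apply: mixed_comm_ind.
- by rewrite (inv_hqm1 hphi) normr0 mulr0.
- move=> n g x y xN hy IH.
  have cE : (g * x * g^-1 = x ^ g^-1)%g by rewrite conjgE invgK mulgA.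
  rewrite cE -[n.+1%:R]nat1r mulrDr mulr1.
  have xgN : (x ^ g^-1)%g \in N by exact: nN.
  have := h1 _ _ xgN (NV xN); rewrite (inv_hqmV hphi xN) h3// opprK subrK => hc.
  have := h1 _ _ (NM xgN (NV xN)) (mixed_comm_in hy).
  move: IH hc; rewrite !ler_norml => /andP[? ?] /andP[? ?] /andP[? ?].
  by apply/andP; split; lra.
- move=> m n y mn /le_trans; apply; rewrite ler_wpM2l ?mulr_ge0// ler_nat//.
Qed.

Lemma inv_hqm_prod D phi (s : seq G) (f : G -> G) : inv_hqm D phi ->
  {subset s <= N} -> (forall x, x \in N -> f x \in N) ->
  `|phi (\prod_(x <- s) f x)%g - \sum_(x <- s) phi (f x)| <= (size s)%:R * D.
Proof.
move=> hphi sN fN; elim: s sN => [|x s IH].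
  by rewrite !big_nil (inv_hqm1 hphi) subr0 normr0 mul0r.
move=> /subset_cons[xN sN]; rewrite !big_cons /= -nat1r mulrDl mul1r.
have psN : (\prod_(z <- s) f z)%g \in N by apply: prod_in => z /sN; exact: fN.
have [h1 _ _] := hphi; have := h1 _ _ (fN _ xN) psN.
move: (IH sN); rewrite !ler_norml => /andP[? ?] /andP[? ?].
by apply/andP; split; lra.
Qed.

(** The easy half of Bavard duality: on [k]-th powers the sum is [k] times as large, and it differs
    from the value of [phi] on the product by at most [D] per element. *)
Lemma inv_hqm_stl D phi s : inv_hqm D phi -> {subset s <= N} -> balanced s ->
  `|\sum_(x <- s) phi x| <= 2 * D * stl s.
Proof.
move=> hphi sN bs; have D0 := inv_hqm_ge0 hphi; have [h1 h2 _] := hphi.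
set a := \sum_(x <- s) phi x.
have le k : k%:R * `|a| <= 2 * D * (mlen (prod_pow s k))%:R + (size s)%:R * D.
  have kE : k%:R * a = \sum_(x <- s) phi (x ^+ k)%g.
    by rewrite mulr_sumr big_seq [RHS]big_seq; apply: eq_bigr => x /sN /h2 ->.
  have := inv_hqm_mixed_comm hphi (balanced_pow k sN bs).
  have := inv_hqm_prod hphi sN (fun x => @groupX_in k x).
  rewrite -[k%:R]normr_nat -normrM kE -/(prod_pow s k) !ler_norml.
  by move=> /andP[? ?] /andP[? ?]; apply/andP; split; lra.
have c1 : (fun k => k%:R * `|a| / k%:R : R) @ \oo --> `|a|.
  have h : (fun=> `|a| : R) @ \oo --> (`|a| : R) by exact: cvg_cst.
  apply: cvg_trans h; apply: near_eq_cvg; near=> k.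
  have k0 : k%:R != 0 :> R by rewrite pnatr_eq0 -lt0n; near: k; exists 1%N.
  by rewrite /= mulrAC divff// mul1r.
apply: (le_cvg_div le c1).
rewrite (_ : (fun k => _) = (fun k => 2 * D * ((mlen (prod_pow s k))%:R / k%:R))).
  by apply: cvgM; [exact: cvg_cst|exact: stl_cvg].
by apply/funext => k; rewrite mulrA.
Unshelve. all: by end_near.
Qed.

(** A single bound serves all exponents, so that stable lengths agree. *)
Definition near_seq s t := exists n, forall k, near n (prod_pow s k) (prod_pow t k).

Lemma near_seq_refl s : near_seq s s.
Proof. by exists 0%N => k; exact: near0. Qed.

Lemma near_seq_sym s t : near_seq s t -> near_seq t s.
Proof. by move=> [n h]; exists n => k; exact: near_sym. Qed.

Lemma near_seq_trans s t u : near_seq s t -> near_seq t u -> near_seq s u.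
Proof. by move=> [m h] [n h']; exists (m + n)%N => k; exact: near_trans (h k) (h' k). Qed.

Lemma near_seq_cat s t s' t' : near_seq s t -> near_seq s' t' ->
  near_seq (s ++ s') (t ++ t').
Proof.
move=> [m h] [n h']; exists (m + n)%N => k; rewrite !prod_pow_cat; exact: nearM.
Qed.

Lemma near_seq_perm s t : {subset s <= N} -> perm_eq s t -> near_seq s t.
Proof. by move=> sN st; exists (size s) => k; exact: near_prod_pow_perm. Qed.

Lemma near_seq_cancel s : {subset s <= N} ->
  near_seq (s ++ [seq x^-1 | x <- s]%g) [::].
Proof.
move=> sN; exists (size s) => k; rewrite prod_pow_cat [X in near _ _ X]big_nil.
have := nearM (near0 (prod_pow s k)) (near_prod_powV k sN).
by rewrite mulgV.
Qed.

Lemma near_seq_stl s t : {subset s <= N} -> {subset t <= N} -> near_seq s t ->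
  balanced t -> balanced s /\ stl s = stl t.
Proof.
move=> sN tN [n st] bt; split; first exact: balanced_near (st 1%N) bt.
exact: stl_near st.
Qed.

(** * Independence of scl from the expression *)

Definition expression (c : {freeg G / int}) (xs ys : seq G) :=
  [/\ {subset xs <= N}, {subset ys <= N} &
    c = \sum_(x <- xs) << x >> - \sum_(y <- ys) << y >>].

Let subset_cat s t : {subset s <= N} -> {subset t <= N} -> {subset s ++ t <= N}.
Proof. by move=> sN tN x; rewrite mem_cat => /orP[/sN|/tN]. Qed.

Let subset_inv s : {subset s <= N} -> {subset [seq x^-1 | x <- s]%g <= N}.
Proof. by move=> sN _ /mapP[x /sN xN ->]; exact: NV. Qed.

(** Equality of the chains makes [xs ++ ys'] a permutation of [xs' ++ ys]. Appending [ys'],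
    respectively [ys], together with its inverses turns the two signed sequences into permutations
    of each other. *)
Lemma expression_near c xs ys xs' ys' : expression c xs ys ->
  expression c xs' ys' -> near_seq (signed_seq xs ys) (signed_seq xs' ys').
Proof.
move=> [xsN ysN cE] [xsN' ysN' cE'].
have p : perm_eq (xs ++ ys') (xs' ++ ys).
  apply: perm_eq_freeg; rewrite !big_cat/=.
  have -> : \sum_(x <- xs) << x >> = c + \sum_(y <- ys) << y >> by rewrite cE subrK.
  have -> : \sum_(x <- xs') << x >> = c + \sum_(y <- ys') << y >> by rewrite cE' subrK.
  by rewrite addrAC.
have cancel us vs : {subset us <= N} -> {subset vs <= N} ->
    near_seq us ((us ++ vs) ++ [seq y^-1 | y <- vs]%g).
  move=> usN vsN; apply: near_seq_sym; rewrite -catA -[X in near_seq _ X]cats0.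
  by apply: near_seq_cat; [exact: near_seq_refl|exact: near_seq_cancel].
apply: near_seq_trans (cancel (signed_seq xs ys) ys' _ _) _ => //.
  exact: signed_seq_in.
apply: near_seq_sym.
apply: near_seq_trans (cancel (signed_seq xs' ys') ys _ _) _ => //.
  exact: signed_seq_in.
apply: near_seq_perm.
  by apply: subset_cat; [apply: subset_cat => //; exact: signed_seq_in|exact: subset_inv].
apply/permP => a; move/permP/(_ a): p; rewrite !count_cat; lia.
Qed.

Lemma signed_seq_cat xs ys xs' ys' :
  perm_eq (signed_seq (xs ++ xs') (ys ++ ys'))
    (signed_seq xs ys ++ signed_seq xs' ys').
Proof. by apply/permP => a; rewrite /signed_seq map_cat !count_cat; lia. Qed.

Lemma expression0 : expression 0 [::] [::].
Proof. by split=> //; rewrite !big_nil subr0. Qed.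

Lemma expressionD c c' xs ys xs' ys' : expression c xs ys ->
  expression c' xs' ys' -> expression (c + c') (xs ++ xs') (ys ++ ys').
Proof.
move=> [xsN ysN ->] [xsN' ysN' ->]; split; [exact: subset_cat|exact: subset_cat|].
by rewrite !big_cat/= opprD addrACA.
Qed.

Lemma expressionN c xs ys : expression c xs ys -> expression (- c) ys xs.
Proof. by move=> [xsN ysN ->]; split=> //; rewrite opprB. Qed.

Lemma expression_balanced c xs ys xs' ys' : expression c xs ys ->
  expression c xs' ys' -> balanced (signed_seq xs ys) ->
  balanced (signed_seq xs' ys') /\ stl (signed_seq xs' ys') = stl (signed_seq xs ys).
Proof.
move=> e e' b; have [xsN ysN _] := e; have [xsN' ysN' _] := e'.
by apply: near_seq_stl b; [exact: signed_seq_in..|exact: expression_near e' e].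
Qed.

(* The chains x_1 + ... + x_m - y_1 - ... - y_n with x_1 ... x_m (y_1 ... y_n)^-1
   in [G,N]. *)
Definition balanced_chain (c : {freeg G / int}) :=
  exists xs ys, expression c xs ys /\ balanced (signed_seq xs ys).

Lemma balanced_chain_expression c xs ys : balanced_chain c ->
  expression c xs ys -> balanced (signed_seq xs ys).
Proof. by move=> [xs' [ys' [e' b']]] e; case: (expression_balanced e' e b'). Qed.

Lemma stl_signedD xs ys xs' ys' : {subset xs <= N} -> {subset ys <= N} ->
  {subset xs' <= N} -> {subset ys' <= N} ->
  balanced (signed_seq xs ys) -> balanced (signed_seq xs' ys') ->
  balanced (signed_seq (xs ++ xs') (ys ++ ys')) /\
  stl (signed_seq (xs ++ xs') (ys ++ ys')) <=
    stl (signed_seq xs ys) + stl (signed_seq xs' ys').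
Proof.
move=> xsN ysN xsN' ysN' b b'.
have [bc sc] := stl_cat (signed_seq_in xsN ysN) (signed_seq_in xsN' ysN') b b'.
have catN : {subset signed_seq (xs ++ xs') (ys ++ ys') <= N}.
  by apply: signed_seq_in; exact: subset_cat.
have [|bc' sE] := near_seq_stl catN _ (near_seq_perm catN (signed_seq_cat xs ys xs' ys')) bc.
  by apply: subset_cat; exact: signed_seq_in.
by rewrite sE.
Qed.

Lemma stl_signedN xs ys : {subset xs <= N} -> {subset ys <= N} ->
  balanced (signed_seq xs ys) ->
  balanced (signed_seq ys xs) /\ stl (signed_seq ys xs) = stl (signed_seq xs ys).
Proof.
move=> xsN ysN b; have [bi si] := stl_inv (signed_seq_in xsN ysN) b.
have sN := signed_seq_in ysN xsN.
rewrite -si; apply: near_seq_stl => //.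
  by apply: subset_inv; exact: signed_seq_in.
apply: near_seq_perm => //; rewrite /signed_seq map_cat.
have -> : [seq x^-1 | x <- [seq y^-1 | y <- ys]]%g = ys.
  by rewrite -map_comp map_id_in// => x _; exact: invgK.
by rewrite perm_catC.
Qed.

Lemma signed_seq_rep xs ys n :
  perm_eq (signed_seq (flatten (nseq n xs)) (flatten (nseq n ys)))
    (flatten (nseq n (signed_seq xs ys))).
Proof.
elim: n => [|n IH] //; apply: perm_trans (signed_seq_cat _ _ _ _) _.
by rewrite /= perm_cat2l.
Qed.

Lemma expressionMn c xs ys n : expression c xs ys ->
  expression (c *+ n) (flatten (nseq n xs)) (flatten (nseq n ys)).
Proof.
move=> e; elim: n => [|n IH]; first exact: expression0.
by rewrite mulrS; exact: expressionD.
Qed.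

Lemma stl_signedMn xs ys n : {subset xs <= N} -> {subset ys <= N} ->
  balanced (signed_seq xs ys) ->
  let xsn := flatten (nseq n xs) in let ysn := flatten (nseq n ys) in
  balanced (signed_seq xsn ysn) /\
  stl (signed_seq xsn ysn) = n%:R * stl (signed_seq xs ys).
Proof.
move=> xsN ysN b xsn ysn; have sN := signed_seq_in xsN ysN.
have repN zs : {subset zs <= N} -> {subset flatten (nseq n zs) <= N}.
  by move=> zsN z /flattenP[s /nseqP[-> _] /zsN].
have [br <-] := stl_rep n sN b.
have nN' := signed_seq_in (repN _ xsN) (repN _ ysN).
by apply: near_seq_stl br => //; [exact: repN|exact/near_seq_perm/signed_seq_rep].
Qed.

Lemma balanced_chainP (a : int) c d : balanced_chain c -> balanced_chain d ->
  balanced_chain (a *: c + d).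
Proof.
have add u v : balanced_chain u -> balanced_chain v -> balanced_chain (u + v).
  move=> [xs [ys [e b]]] [xs' [ys' [e' b']]]; exists (xs ++ xs'), (ys ++ ys').
  split; first exact: expressionD.
  have [xsN ysN _] := e; have [xsN' ysN' _] := e'.
  by case: (stl_signedD xsN ysN xsN' ysN' b b').
have opp u : balanced_chain u -> balanced_chain (- u).
  move=> [xs [ys [e b]]]; exists ys, xs; split; first exact: expressionN.
  by have [xsN ysN _] := e; case: (stl_signedN xsN ysN b).
have muln u n : balanced_chain u -> balanced_chain (u *+ n).
  move=> bu; elim: n => [|n IH]; last by rewrite mulrS; exact: add.
  exists [::], [::]; split; first exact: expression0.
  by exists 0%N; rewrite /prod_pow big_nil; exact: mixed_comm1.
move=> bc bd; apply: add => //; rewrite -[a]intz scaler_int.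
case: a => n; first exact: muln.
exact/opp/muln.
Qed.

(* Choosing for each coset of N a representative sigma, with sigma N = 1, the
   pushforward along g |-> sigma(gN)^-1 g is a retraction of the chains of G onto the
   chains of N that sends the boundaries of C'_2(G,N) to balanced chains. *)
Definition coset_rep g : G :=
  if g \in N then 1%g else xget 1%g [set h | (h^-1 * g)%g \in N].

Lemma coset_repP g : ((coset_rep g)^-1 * g)%g \in N.
Proof.
rewrite /coset_rep; case: ifPn => [gN'|_]; first by rewrite invg1 mul1g.
by apply: (@xgetPex _ 1%g [set h | (h^-1 * g)%g \in N]); exists g; rewrite /= mulVg.
Qed.

Lemma coset_repM g x : x \in N -> coset_rep (g * x)%g = coset_rep g.
Proof.
move=> xN; rewrite /coset_rep.
have Mx h : (h * x \in N)%g = (h \in N).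
  apply/idP/idP => [hx|hN]; last exact: NM.
  by rewrite -[h](mulgK x) NM ?NV.
by rewrite Mx; congr (if _ then _ else xget _ _); apply/seteqP; split=> h /=;
  rewrite mulgA Mx.
Qed.

Definition retract (c : {freeg G / int}) : {freeg G / int} :=
  fglift (fun g => << ((coset_rep g)^-1 * g)%g >>) c.

Lemma retract1 g : retract << g >> = << ((coset_rep g)^-1 * g)%g >>.
Proof. by rewrite /retract liftU scale1r. Qed.

Lemma retract_linear : linear retract.
Proof. exact: fglift_linear. Qed.

HB.instance Definition _ :=
  GRing.isLinear.Build int {freeg G / int} {freeg G / int} *:%R retract retract_linear.

Lemma retract_id c : chains1 N c -> retract c = c.
Proof.
move=> [s [sN ->]]; rewrite linear_sum big_seq [RHS]big_seq.
apply: eq_bigr => p /sN[x /= xN <-].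
by rewrite linearZ /= retract1 /coset_rep xN invg1 mul1g.
Qed.

Lemma balanced_boundary x y : x \in N -> y \in N ->
  balanced_chain (<< x >> + << y >> - << (x * y)%g >>).
Proof.
move=> xN yN; exists [:: x; y], [:: (x * y)%g]; split; last by case: (stl_mul xN yN).
split; [by move=> z; rewrite !inE => /orP[] /eqP ->| |].
  by move=> z; rewrite inE => /eqP ->; exact: NM.
by rewrite !big_cons !big_nil !addr0.
Qed.

Lemma balanced_conj x g : x \in N -> balanced_chain (<< x >> - << (x ^ g)%g >>).
Proof.
move=> xN; exists [:: x], [:: (x ^ g)%g]; split.
  split; [by move=> z; rewrite inE => /eqP ->| |].
    by move=> z; rewrite inE => /eqP ->; exact: nN.
  by rewrite !big_seq1.
exists 1%N; rewrite prod_pow1 big_cons big_seq1.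
by apply: near_sym; exact: nearJ.
Qed.

Lemma mixed_chains_balanced c : mixed_chains N c -> balanced_chain c.
Proof.
move=> [c1 [b [s [sN ->]] cE]]; rewrite -(retract_id c1) -cE {c c1 cE}.
have b0 : balanced_chain 0.
  exists [::], [::]; split; first exact: expression0.
  by exists 0%N; rewrite /prod_pow big_nil; exact: mixed_comm1.
elim: s sN => [|p s IH] sN; first by rewrite big_nil /boundary raddf0 raddf0.
rewrite big_cons [boundary _]fglift_linear linearP; apply: balanced_chainP; last first.
  by apply: IH => q qs; apply: sN; rewrite inE qs orbT.
have /sN[[g h] /= ghN <-] := mem_head p s.
rewrite liftU scale1r /= linearD linearB /= !retract1.
have id1 x : x \in N -> ((coset_rep x)^-1 * x)%g = x.
  by move=> xN; rewrite /coset_rep xN invg1 mul1g.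
have [hN|hN] := boolP (h \in N).
  (* As [g] and [gh] lie in one coset, the retraction sends the boundary to [h - r h + r], with [r]
     the image of [g]. *)
  rewrite (coset_repM g hN) (id1 h hN) mulgA addrC addrA.
  exact: balanced_boundary (coset_repP g) hN.
have gN' : g \in N by move: ghN; rewrite (negbTE hN) orbF.
(* Here [gh = h g^h]. With [r] the image of [h], the boundary goes to [r - r g^h + g], the sum of
   [g - g^h] and [g^h + r - r g^h]. *)
rewrite (id1 g gN') conjgC (coset_repM h (nN h gN')) mulgA.
have h1 := balanced_boundary (coset_repP h) (nN h gN').
have h2 := balanced_chainP 1 (balanced_conj h gN') h1.
move: h2; rewrite scale1r; congr balanced_chain.
set u := << _ >>; set v := << _ >>; set w := << _ >>; set t := << _ >>.
by rewrite (addrAC w v) (addrC (u - v)) -(addrA _ v) (addrC v) subrK.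
Qed.

Lemma scl_intE c xs ys : mixed_chains N c -> expression c xs ys ->
  scl_int R N c = stl (signed_seq xs ys).
Proof.
move=> cN e; apply: xget_subset1 => [|u v].
  have [xsN ysN cE] := e; exists xs, ys; split=> //.
  apply: cl_growth_cvg => //.
  exact: balanced_chain_expression (mixed_chains_balanced cN) e.
have uE w : [set s : R | exists xs ys : seq G,
    [/\ {subset xs <= N}, {subset ys <= N},
      c = \sum_(x <- xs) << x >> - \sum_(y <- ys) << y >> &
      cl_growth R N xs ys @ \oo --> s]] w -> w = stl (signed_seq xs ys).
  move=> [xs' [ys' [xsN ysN cE cvg]]].
  have e' : expression c xs' ys' by [].
  have b' := balanced_chain_expression (mixed_chains_balanced cN) e'.
  have [_ ->] := expression_balanced e' e b'.
  exact: cvg_unique cvg (cl_growth_cvg xsN ysN b').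
by move=> /uE -> /uE ->.
Qed.

Lemma scl_intP c : mixed_chains N c -> exists xs ys,
  [/\ expression c xs ys, balanced (signed_seq xs ys) &
    scl_int R N c = stl (signed_seq xs ys)].
Proof.
move=> cN; have [xs [ys [e b]]] := mixed_chains_balanced cN.
by exists xs, ys; split=> //; exact: scl_intE.
Qed.

Let mixedD (K : nzRingType) (c d : {freeg G / K}) : mixed_chains N c ->
  mixed_chains N d -> mixed_chains N (c + d).
Proof. by move=> cN dN; rewrite -[c]scale1r; exact: mixed_chainsP. Qed.

Let mixedZ (K : nzRingType) (a : K) (c : {freeg G / K}) : mixed_chains N c ->
  mixed_chains N (a *: c).
Proof.
by move=> cN; rewrite -[_ *: _]addr0; apply: mixed_chainsP => //; exact: mixed_chains0.
Qed.

Let mixedMn (K : nzRingType) (c : {freeg G / K}) n : mixed_chains N c ->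
  mixed_chains N (c *+ n).
Proof. by rewrite -scaler_nat; exact: mixedZ. Qed.

Lemma scl_intD c d : mixed_chains N c -> mixed_chains N d ->
  scl_int R N (c + d) <= scl_int R N c + scl_int R N d.
Proof.
move=> cN dN; have [xs [ys [e b ->]]] := scl_intP cN.
have [xs' [ys' [e' b' ->]]] := scl_intP dN.
rewrite (scl_intE (mixedD cN dN) (expressionD e e')).
have [xsN ysN _] := e; have [xsN' ysN' _] := e'.
by case: (stl_signedD xsN ysN xsN' ysN' b b').
Qed.

Lemma scl_intMn c n : mixed_chains N c ->
  scl_int R N (c *+ n) = n%:R * scl_int R N c.
Proof.
move=> cN; have [xs [ys [e b ->]]] := scl_intP cN.
rewrite (scl_intE (mixedMn n cN) (expressionMn n e)).
by have [xsN ysN _] := e; case: (stl_signedMn n xsN ysN b).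
Qed.

Lemma scl_intN c : mixed_chains N c -> scl_int R N (- c) = scl_int R N c.
Proof.
move=> cN; have [xs [ys [e b ->]]] := scl_intP cN.
have ncN : mixed_chains N (- c) by rewrite -scaleN1r; exact: mixedZ.
rewrite (scl_intE ncN (expressionN e)).
by have [xsN ysN _] := e; case: (stl_signedN xsN ysN b).
Qed.

Lemma scl_ratE c k (z : {freeg G / int}) :
  (0 < k)%N -> mixed_chains N z -> k%:R *: c = chain_rat z ->
  scl_rat R N c = scl_int R N z / k%:R.
Proof.
move=> k0 zN zE; apply: xget_subset1; first by exists k, z.
have uE w : [set s : R | exists (k : nat) (z : {freeg G / int}),
    [/\ (0 < k)%N, mixed_chains N z, k%:R *: c = chain_rat z &
      s = scl_int R N z / k%:R]] w -> w = scl_int R N z / k%:R.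
  move=> [l [t [l0 tN tE ->]]].
  have h : t *+ k = z *+ l.
    apply: chain_rat_inj; rewrite !chain_ratMn -zE -tE -!scaler_nat !scalerA.
    by rewrite mulrC.
  have := congr1 (scl_int R N) h; rewrite !scl_intMn// => {}h.
  have k0' : k%:R != 0 :> R by rewrite pnatr_eq0 -lt0n.
  have l0' : l%:R != 0 :> R by rewrite pnatr_eq0 -lt0n.
  by apply/eqP; rewrite eqr_div// mulrC h mulrC.
by move=> u v /uE -> /uE ->.
Qed.

Lemma scl_rat_chain (z : {freeg G / int}) : mixed_chains N z ->
  scl_rat R N (chain_rat z) = scl_int R N z.
Proof. by move=> zN; rewrite (@scl_ratE _ 1 z) ?divr1// scale1r. Qed.

Lemma scl_ratD c d : mixed_chains N c -> mixed_chains N d ->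
  scl_rat R N (c + d) <= scl_rat R N c + scl_rat R N d.
Proof.
move=> /mixed_chains_clear[k [z [k0 zN zE]]] /mixed_chains_clear[l [t [l0 tN tE]]].
have k0' : (0 : R) < k%:R by rewrite ltr0n.
have l0' : (0 : R) < l%:R by rewrite ltr0n.
rewrite (scl_ratE k0 zN zE) (scl_ratE l0 tN tE).
rewrite (@scl_ratE _ (k * l) (z *+ l + t *+ k)); first last.
- rewrite chain_ratD !chain_ratMn -zE -tE -!scaler_nat !scalerA scalerDr natrM.
  by rewrite [k%:R * _]mulrC [l%:R * k%:R in X in _ + X]mulrC.
- by apply: mixedD; exact: mixedMn.
- by rewrite muln_gt0 k0.
rewrite ler_pdivrMr ?natrM ?mulr_gt0//.
have -> : (scl_int R N z / k%:R + scl_int R N t / l%:R) * (k%:R * l%:R) =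
    l%:R * scl_int R N z + k%:R * scl_int R N t.
  by field; rewrite !gt_eqF.
by rewrite -!scl_intMn//; apply: scl_intD; exact: mixedMn.
Qed.

Lemma scl_ratMn c n : mixed_chains N c ->
  scl_rat R N (c *+ n) = n%:R * scl_rat R N c.
Proof.
move=> /mixed_chains_clear[k [z [k0 zN zE]]].
rewrite (scl_ratE k0 zN zE) (@scl_ratE _ k (z *+ n)) ?scl_intMn ?mulrA//.
  exact: mixedMn.
by rewrite chain_ratMn -zE scalerMnr.
Qed.

Lemma scl_ratN c : mixed_chains N c -> scl_rat R N (- c) = scl_rat R N c.
Proof.
move=> /mixed_chains_clear[k [z [k0 zN zE]]].
rewrite (scl_ratE k0 zN zE) (@scl_ratE _ k (- z)) ?scl_intN//.
  by rewrite -scaleN1r; exact: mixedZ.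
by rewrite chain_ratN -zE scalerN.
Qed.

End MixedCommutators.

(** * Duality between mixed chains and invariant quasimorphisms *)

Section RationalExtension.
Context (R : realType) (A : lmodType rat).

Definition subspace (X : set A) :=
  X 0 /\ forall (a : rat) u v, X u -> X v -> X (a *: u + v).

Lemma subspace_complement (X : set A) : subspace X -> exists M : set A,
  [/\ subspace M, forall u, X u -> M u -> u = 0 &
    forall a, exists u v, [/\ X u, M v & a = u + v]].
Proof.
move=> [X0 XP].
pose P (M : set A) := (forall (a : rat) u v, M u -> M v -> M (a *: u + v)) /\
  forall u, X u -> M u -> u = 0.
have [|M [[MP MX] Mmax]] := @Zorn_bigcup A P.
  move=> F FP Ftot; split=> [a u v [S FS Su] [T FT Tv]|u Xu [S FS Su]]; last first.
    by have [_] := FP _ FS; apply.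
  have [ST|TS] := Ftot _ _ FS FT.
    by exists T => //; apply: (FP _ FT).1 => //; exact: ST.
  by exists S => //; apply: (FP _ FS).1 => //; exact: TS.
have {}Mmax B : M `<=` B -> P B -> B `<=` M.
  move=> MB PB b Bb; apply: contrapT => Mb; apply: Mmax PB; split=> // BM.
  exact/Mb/BM.
(* The empty family has empty union, so [P] cannot require 0; maximality supplies it. *)
have M0 : M 0.
  apply: (Mmax (M `|` [set 0])); [by move=> x; left| |by right].
  split=> [a u v [Mu|->] [Mv|->]|u Xu [|//]]; last exact: MX.
  - by left; exact: MP.
  - left; have := MP _ _ _ Mu (MP (-1) u u Mu Mu).
    by rewrite scaleN1r addNr.
  - by left; rewrite scaler0 add0r.
  - by right; rewrite scaler0 addr0.
exists M; split=> [//|//|a]; apply: contrapT => aXM.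
(* If [X] met the span of [M] and [a] in an element with nonzero coordinate along [a], dividing by
   it would put [a] in the sum of [X] and [M]. *)
pose B : set A := [set b | exists q m, M m /\ b = q *: a + m].
have XZ q u : X u -> X (q *: u) by move=> Xu; rewrite -[_ *: _]addr0; exact: XP.
have MZ q u : M u -> M (q *: u) by move=> Mu; rewrite -[_ *: _]addr0; exact: MP.
apply: (aXM); exists 0, a; split; rewrite ?add0r//.
apply: (Mmax B) => [m Mm||].
- by exists 0, m; rewrite scale0r add0r.
- split=> [q _ _ [r [m [Mm ->]]] [t [n [Mn ->]]]|u Xu [q [m [Mm uE]]]].
    exists (q * r + t), (q *: m + n); split; first exact: MP.
    by rewrite scalerDr scalerDl scalerA addrACA.
  have [q0|q0] := eqVneq q 0.
    by apply: MX => //; rewrite uE q0 scale0r add0r.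
  case: aXM; exists (q^-1 *: u), (- q^-1 *: m); split; [exact: XZ|exact: MZ|].
  by rewrite uE scalerDr scalerK// scaleNr addrK.
- by exists 1, 0; rewrite scale1r addr0.
Qed.

(** Composition with the projection onto [X] along a rational complement; the extension carries no
    bound outside [X]. *)
Lemma additive_extension (X : set A) (f : A -> R) : subspace X ->
  (forall u v, X u -> X v -> f (u + v) = f u + f v) ->
  exists F : A -> R, {morph F : u v / u + v} /\ forall u, X u -> F u = f u.
Proof.
move=> sX fD; have [M [[M0 MP] MX XM]] := subspace_complement sX.
have [X0 XP] := sX.
have XB u v : X u -> X v -> X (u - v).
  by move=> Xu Xv; rewrite addrC -scaleN1r; exact: XP.
have MB u v : M u -> M v -> M (u - v).
  by move=> Mu Mv; rewrite addrC -scaleN1r; exact: MP.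
have /choice[p pP] : forall a, exists u, X u /\ M (a - u).
  by move=> a; have [u [v [Xu Mv ->]]] := XM a; exists u; rewrite addrC addKr.
have pE a u : X u -> M (a - u) -> p a = u.
  move=> Xu Mu; have [Xp Mp] := pP a; apply/eqP; rewrite -subr_eq0; apply/eqP.
  by apply: MX; [exact: XB|have := MB _ _ Mu Mp; rewrite opprB addrC subrKA].
exists (f \o p); split=> [u v|u Xu] /=; last first.
  by rewrite (pE u u)// subrr.
have [Xu Mu] := pP u; have [Xv Mv] := pP v.
rewrite -fD//; congr f; apply: pE; first by rewrite -[p u]scale1r; exact: XP.
by rewrite opprD addrACA -[u - _]scale1r; exact: MP.
Qed.

End RationalExtension.

Section AdditiveRational.
Context (R : realType) (A : lmodType rat) (f : A -> R).
Hypothesis fD : {morph f : u v / u + v}.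

Lemma morphD0 : f 0 = 0.
Proof. by apply: (@addrI _ (f 0)); rewrite -fD !addr0. Qed.

Lemma morphDN u : f (- u) = - f u.
Proof. by apply: (@addrI _ (f u)); rewrite -fD !subrr morphD0. Qed.

Lemma morphDB u v : f (u - v) = f u - f v.
Proof. by rewrite fD morphDN. Qed.

Lemma morphDMn u n : f (u *+ n) = n%:R * f u.
Proof.
elim: n => [|n IH]; first by rewrite mulr0n morphD0 mul0r.
by rewrite mulrS fD IH -nat1r mulrDl mul1r.
Qed.

Lemma morphD_sum (I : Type) (r : seq I) (F : I -> A) :
  f (\sum_(i <- r) F i) = \sum_(i <- r) f (F i).
Proof. exact: (big_morph _ fD morphD0). Qed.

Lemma morphDZ (q : rat) u : f (q *: u) = ratr q * f u.
Proof.
have d0 : (denq q)%:~R != 0 :> R by rewrite intr_eq0 denq_neq0.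
have fz (n : int) w : f (n%:~R *: w) = n%:~R * f w.
  rewrite scaler_int; case: n => n; first exact: morphDMn.
  by rewrite NegzE !mulrNz morphDN -!pmulrn morphDMn mulNr.
apply: (mulfI d0); rewrite -fz scalerA mulrA.
have -> : (denq q)%:~R * q = (numq q)%:~R.
  by rewrite -[q in _ * q]divq_num_den mulrCA divff ?mulr1// intr_eq0 denq_neq0.
by rewrite fz /ratr mulrCA divff ?mulr1.
Qed.

End AdditiveRational.

Section Evaluation.
Context (R : realType) (G : groupType).
Implicit Types (phi : G -> R) (c : {freeg G / rat}).

Definition ev phi c : R := \sum_(x <- dom c) ratr (coeff x c) * phi x.

Lemma ev_subset phi c s : uniq s -> {subset dom c <= s} ->
  ev phi c = \sum_(x <- s) ratr (coeff x c) * phi x.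
Proof.
move=> us cs; rewrite [RHS](bigID (mem (dom c)))/= [X in _ + X]big1 ?addr0.
  rewrite -[RHS]big_filter; apply: perm_big; apply: uniq_perm.
  - exact: uniq_dom.
  - exact: filter_uniq.
  - move=> x; rewrite mem_filter; case: (boolP (x \in dom c)) => //= /cs.
    by rewrite /= => ->.
by move=> x /coeff_outdom ->; rewrite rmorph0 mul0r.
Qed.

Lemma evD phi c d : ev phi (c + d) = ev phi c + ev phi d.
Proof.
pose s := undup (dom (c + d) ++ dom c ++ dom d).
have us : uniq s by exact: undup_uniq.
have sub t : t = c + d \/ t = c \/ t = d -> ev phi t =
    \sum_(x <- s) ratr (coeff x t) * phi x.
  move=> th; apply: ev_subset => // x xt; rewrite mem_undup !mem_cat.
  by case: th xt => [|[]] -> ->; rewrite ?orbT.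
rewrite !sub; [|by right; right|by right; left|by left].
by rewrite -big_split/=; apply: eq_bigr => x _; rewrite coeffD rmorphD mulrDl.
Qed.

Lemma ev1 phi x : ev phi << x >> = phi x.
Proof. by rewrite /ev domU1 big_seq1 coeff1 eqxx rmorph1 mul1r. Qed.

Lemma ev_lin phi psi (a : R) c :
  ev (fun x => a * phi x + psi x) c = a * ev phi c + ev psi c.
Proof.
rewrite /ev mulr_sumr -big_split; apply: eq_bigr => x _ /=.
by rewrite mulrDr mulrCA.
Qed.

Lemma eq_ev phi psi c (N : {pred G}) : chains1 N c ->
  (forall x, x \in N -> phi x = psi x) -> ev phi c = ev psi c.
Proof.
move=> /mem_chains1 cN h; rewrite /ev big_seq [RHS]big_seq; apply: eq_bigr => x xc.
rewrite h//; apply: contraTT xc => /cN xE.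
by rewrite mem_dom xE eqxx.
Qed.

End Evaluation.

Section MixedDuality.
Context (R : realType) (G : groupType) (N : {pred G}).
Hypotheses (gN : group_closed N) (nN : forall x g, x \in N -> (x ^ g)%g \in N).
Implicit Types (c d : {freeg G / rat}) (x y g : G) (phi : G -> R).

Let N1 : 1%g \in N := gN.1.
Let NM x y : x \in N -> y \in N -> (x * y)%g \in N. Proof. exact: group_closedM. Qed.

Lemma mixed_chains_subspace : subspace (@mixed_chains rat G N).
Proof. by split; [exact: mixed_chains0|move=> a u v; exact: mixed_chainsP]. Qed.

Lemma ev_bound D phi c : inv_hqm N D phi -> mixed_chains N c ->
  `|ev phi c| <= 2 * D * scl_rat R N c.
Proof.
move=> hphi /mixed_chains_clear[k [z [k0 zN zE]]].
rewrite (scl_ratE gN nN R k0 zN zE).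
have [xs [ys [[xsN ysN ze] b ->]]] := scl_intP gN nN R zN.
have k0' : (0 : R) < k%:R by rewrite ltr0n.
rewrite mulrA ler_pdivlMr// -[k%:R]normr_nat -normrM mulrC.
have -> : k%:R * ev phi c = \sum_(x <- signed_seq xs ys) phi x.
  have evD' := evD phi.
  have -> : k%:R * ev phi c = ev phi (k%:R *: c) by rewrite (morphDZ evD') ratr_nat.
  rewrite zE ze chain_ratD chain_ratN evD (morphDN evD').
  have sE s : ev phi (chain_rat (\sum_(x <- s) << x >>)) = \sum_(x <- s) phi x.
    elim: s => [|x s IH].
      rewrite !big_nil (_ : chain_rat 0 = 0) ?(morphD0 evD')//.
      by apply: freegP => x; rewrite coeff_chain_rat !coeff0.
    by rewrite !big_cons chain_ratD evD IH chain_rat1 ev1.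
  rewrite !sE /signed_seq big_cat/= big_map; congr +%R.
  rewrite -sumrN big_seq [RHS]big_seq; apply: eq_bigr => y /ysN yN.
  by rewrite (inv_hqmV gN hphi yN).
by apply: inv_hqm_stl => //; exact: signed_seq_in.
Qed.

Lemma mixed_chains_mul (K : nzRingType) x y : x \in N -> y \in N ->
  mixed_chains N (<< x >> + << y >> - << (x * y)%g >> : {freeg G / K}).
Proof.
move=> xN yN; split.
  apply/mem_chains1 => z zN; rewrite coeffB coeffD !coeff1.
  have ne t : t \in N -> (t == z) = false.
    by move=> tN; apply: contraNF zN => /eqP <-.
  by rewrite !ne ?NM// addr0 subr0.
exists << (x, y) >>; last by rewrite /boundary liftU scale1r /= addrC addrA.
exists [:: (1, << (x, y) >>)]; split; last by rewrite big_seq1 scale1r.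
by move=> p; rewrite inE => /eqP -> /=; exists (x, y) => //=; rewrite xN.
Qed.

Lemma mixed_chains_conj (K : nzRingType) x g : x \in N ->
  mixed_chains N (<< x >> - << (x ^ g)%g >> : {freeg G / K}).
Proof.
move=> xN; split.
  apply/mem_chains1 => z zN; rewrite coeffB !coeff1.
  have ne t : t \in N -> (t == z) = false.
    by move=> tN; apply: contraNF zN => /eqP <-.
  by rewrite !ne ?nN// subr0.
(* Since [x g = g x^g], the two product terms cancel in the boundary. *)
exists (<< (x, g) >> - << (g, x ^ g)%g >>); last first.
  rewrite [boundary _]lift_is_additive !liftU !scale1r /= -conjgC addrC opprD opprB.
  have abel (V : zmodType) (u v w t : V) : u - v - w + (w - u + t) = t - v.
    by rewrite -(addrA w) subrKA (addrC (- u)) [LHS]addrC subrKA.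
  exact: abel.
exists [:: (1, << (x, g) >>); (-1, << (g, x ^ g)%g >>)]; split.
  move=> p; rewrite !inE => /orP[] /eqP -> /=; first by exists (x, g) => //=; rewrite xN.
  by exists (g, x ^ g)%g => //=; rewrite nN// orbT.
by rewrite !big_cons big_nil /= scale1r scaleN1r addr0.
Qed.

Lemma mixed_chains_pow (K : nzRingType) x n : x \in N ->
  mixed_chains N (<< x ^+ n >>%g - << x >> *+ n : {freeg G / K}).
Proof.
move=> xN; elim: n => [|n IH].
  rewrite mulr0n subr0 expg0; have := mixed_chains_mul K N1 N1.
  by rewrite mulg1 addrK.
have h := mixed_chains_mul K xN (groupX_in gN n xN).
have -> : << x ^+ n.+1 >>%g - << x >> *+ n.+1 =
    -1 *: (<< x >> + << x ^+ n >>%g - << x * x ^+ n >>%g) +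
    (<< x ^+ n >>%g - << x >> *+ n) :> {freeg G / K}.
  rewrite scaleN1r mulrS expgS.
  have abel (V : zmodType) (u v w t : V) : u - (v + t) = - (v + w - u) + (w - t).
    by rewrite opprB !opprD !addrA subrK.
  exact: abel.
exact: mixed_chainsP.
Qed.

Lemma scl_rat_mul x y : x \in N -> y \in N ->
  scl_rat R N (<< x >> + << y >> - << (x * y)%g >>) <= 2^-1.
Proof.
move=> xN yN; have zN := mixed_chains_mul int xN yN.
have e : expression N (<< x >> + << y >> - << (x * y)%g >>) [:: x; y] [:: (x * y)%g].
  split; [by move=> z; rewrite !inE => /orP[] /eqP ->| |].
    by move=> z; rewrite inE => /eqP ->; exact: NM.
  by rewrite !big_cons !big_nil !addr0.
have := scl_rat_chain gN nN R zN.
rewrite chain_ratD chain_ratD chain_ratN !chain_rat1 => ->.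
by rewrite (scl_intE gN nN R zN e); case: (stl_mul gN nN R xN yN).
Qed.

Lemma scl_rat_conj x g : x \in N -> scl_rat R N (<< x >> - << (x ^ g)%g >>) = 0.
Proof.
move=> xN; have zN := mixed_chains_conj int g xN.
have e : expression N (<< x >> - << (x ^ g)%g >>) [:: x] [:: (x ^ g)%g].
  split; [by move=> z; rewrite !inE => /eqP ->| |].
    by move=> z; rewrite inE => /eqP ->; exact: nN.
  by rewrite !big_cons !big_nil !addr0.
have := scl_rat_chain gN nN R zN.
rewrite chain_ratD chain_ratN !chain_rat1 => ->.
rewrite (scl_intE gN nN R zN e).
have [xsN ysN _] := e.
suff h k : mixed_comm N 1 (prod_pow (signed_seq [:: x] [:: (x ^ g)%g]) k).
  by case: (stl_bounded gN nN R (signed_seq_in gN xsN ysN) h).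
rewrite /prod_pow !big_cons big_nil mulg1 expVgn -conjXg.
by apply: near_sym => //; apply: nearJ; exact: groupX_in.
Qed.

Lemma scl_rat_pow x n : x \in N -> scl_rat R N (<< x ^+ n >>%g - << x >> *+ n) = 0.
Proof.
move=> xN; have zN := mixed_chains_pow int n xN.
have e : expression N (<< x ^+ n >>%g - << x >> *+ n) [:: (x ^+ n)%g] (nseq n x).
  split; [by move=> z; rewrite !inE => /eqP ->; exact: groupX_in| |].
    by move=> z /nseqP[-> _].
  by rewrite big_seq1; congr (_ - _); rewrite big_nseq iter_addr_0.
have := scl_rat_chain gN nN R zN.
rewrite chain_ratD chain_ratN chain_ratMn !chain_rat1 => ->.
rewrite (scl_intE gN nN R zN e).
have [xsN ysN _] := e.
suff h k : mixed_comm N 0 (prod_pow (signed_seq [:: (x ^+ n)%g] (nseq n x)) k).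
  by case: (stl_bounded gN nN R (signed_seq_in gN xsN ysN) h).
rewrite prod_pow_cat /prod_pow big_seq1 big_map big_nseq iter_mulg_1 !expVgn.
by rewrite -!expgnA mulnC mulgV; exact: mixed_comm1.
Qed.

(* Any Q-linear extension of f to all chains restricts to a G-invariant homogeneous
   quasimorphism on N, because the chains x + y - xy, x^n - nx and x - x^g have scl at
   most 1/2, 0 and 0. *)
Theorem mixed_duality (f : {freeg G / rat} -> R) (C : R) :
  (forall c d, mixed_chains N c -> mixed_chains N d -> f (c + d) = f c + f d) ->
  (forall c, mixed_chains N c -> `|f c| <= 2 * C * scl_rat R N c) -> 0 <= C ->
  exists phi, inv_hqm N C phi /\ forall c, mixed_chains N c -> ev phi c = f c.
Proof.
move=> fD fC C0.
have [F [FD Ff]] := additive_extension mixed_chains_subspace fD.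
pose phi x := F << x >>.
have FE (c : {freeg G / rat}) : ev phi c = F c.
  rewrite -{2}[c]freeg_sumE (morphD_sum FD) /ev; apply: eq_bigr => x _.
  rewrite -(morphDZ FD); congr F; apply: freegP => y.
  by rewrite coeffZ coeff1 coeffU.
have F0 c : mixed_chains N c -> scl_rat R N c = 0 -> F c = 0.
  move=> cN c0; apply/eqP; rewrite -normr_le0 Ff//.
  by have := fC _ cN; rewrite c0 mulr0.
exists phi; split; last by move=> c cN; rewrite FE Ff.
split=> [x y xN yN|x n xN|x g xN].
- have -> : phi (x * y)%g - phi x - phi y = - F (<< x >> + << y >> - << (x * y)%g >>).
    by rewrite (morphDB FD) FD /phi; lra.
  have cN := mixed_chains_mul rat xN yN.
  rewrite normrN Ff//; apply: le_trans (fC _ cN) _.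
  have := scl_rat_mul xN yN; nra.
- have := F0 _ (mixed_chains_pow rat n xN) (scl_rat_pow n xN).
  by rewrite (morphDB FD) (morphDMn FD) => /eqP; rewrite subr_eq0 => /eqP.
- have := F0 _ (mixed_chains_conj rat g xN) (scl_rat_conj g xN).
  by rewrite (morphDB FD) => /eqP; rewrite subr_eq0 => /eqP.
Qed.

End MixedDuality.

(** * Pairs of seminorms and their duals *)

Section RationalSeminorm.
Context (R : realType) (X : lmodType rat) (p : X -> R).
Hypotheses (sp : sublinear p) (pN : forall x, p (- x) = p x).

Lemma even_sublinear_ge0 x : 0 <= p x.
Proof. by have := sublinearN_le x sp; rewrite pN; lra. Qed.

Lemma even_sublinearB x y : p (x - y) <= p x + p y.
Proof. by rewrite -(pN y); exact: sp.1. Qed.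

Lemma even_sublinear_sub x y : p x <= p (x - y) + p y.
Proof. by have := sp.1 (x - y) y; rewrite subrK. Qed.

Lemma sublinear_div n x : (0 < n)%N -> p (n%:R^-1 *: x) = p x / n%:R.
Proof.
move=> n0; have n0' : n%:R != 0 :> R by rewrite pnatr_eq0 -lt0n.
have n0Q : n%:R != 0 :> rat by rewrite pnatr_eq0 -lt0n.
apply: (mulfI n0'); rewrite -sp.2 -scaler_nat scalerA divff// scale1r.
by rewrite mulrCA divff// mulr1.
Qed.

(** Only rational multiples are available: [x] is scaled by [n / m], with [m] the next integer above
    [n p(x)], and for large [n] the rounding error is absorbed in [e]. *)
Lemma unit_ball_bound (f : X -> R) (K : R) : {morph f : x y / x + y} ->
  (forall x, p x <= 1 -> `|f x| <= K) -> forall x, `|f x| <= K * p x.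
Proof.
move=> fD fK x; have p0 := even_sublinear_ge0.
have K0 : 0 <= K by apply: le_trans (fK 0 _) => //; rewrite (sublinear0 sp).
apply/ler_addgt0Pr => e e0.
pose n := (Num.truncn ((K + 1) / e)).+1.
have n0 : (0 : R) < n%:R by rewrite ltr0n.
have nK : K <= e * n%:R.
  have : (K + 1) / e < n%:R by exact: truncnS_gt.
  by rewrite ltr_pdivrMr// => h; rewrite mulrC; lra.
pose m := (Num.truncn (p x * n%:R)).+1.
have m1 : p x * n%:R < m%:R by exact: truncnS_gt.
have m2 : m%:R <= p x * n%:R + 1.
  have : (Num.truncn (p x * n%:R))%:R <= p x * n%:R.
    by rewrite truncn_le mulr_ge0.
  by rewrite /m -natr1; lra.
have h : `|f (m%:R^-1 *: (x *+ n))| <= K.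
  by apply: fK; rewrite sublinear_div// sp.2 ler_pdivrMr ?mul1r ?ltr0n// mulrC ltW.
have m0 : (0 : R) < m%:R by rewrite ltr0n.
have mV : ratr (m%:R^-1) = m%:R^-1 :> R by rewrite fmorphV/= ratr_nat.
move: h; rewrite (morphDZ fD) (morphDMn fD) mV normrM normfV.
rewrite normr_nat normrM normr_nat mulrC ler_pdivrMr// => h.
rewrite -(ler_pM2l n0); apply: le_trans h _.
have := ler_wpM2l K0 m2; nra.
Qed.

End RationalSeminorm.

Section GeometricLimit.
Context (R : realType).

(** The intervals of radius [2 K / 2^n] about [u n] are nested; the limit is the infimum of their
    right ends. *)
Lemma geometric_limit (u : nat -> R) (K : R) :
  (forall n, `|u n.+1 - u n| <= K / 2 ^+ n) ->
  exists l, forall n, `|l - u n| <= 2 * K / 2 ^+ n.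
Proof.
move=> uK; have K0 : 0 <= K by have := uK 0%N; rewrite expr0 divr1; apply: le_trans.
pose v n := u n + 2 * K / 2 ^+ n; pose w n := u n - 2 * K / 2 ^+ n.
have half n : 2 * K / 2 ^+ n = K / 2 ^+ n + 2 * K / 2 ^+ n.+1 :> R.
  by rewrite exprS; field; rewrite expf_neq0.
have vS n : v n.+1 <= v n.
  by have := uK n; have := half n; rewrite /v ler_norml => ? /andP[]; lra.
have wS n : w n <= w n.+1.
  by have := uK n; have := half n; rewrite /w ler_norml => ? /andP[]; lra.
have vmono m n : (m <= n)%N -> v n <= v m.
  by move=> /subnK <-; elim: (n - m)%N => // k; rewrite addSn; exact: le_trans.
have wmono m n : (m <= n)%N -> w m <= w n.
  move=> /subnK <-; elim: (n - m)%N => // k IH; rewrite addSn.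
  exact: le_trans IH _.
have wv m n : w m <= v n.
  apply: le_trans (wmono m (maxn m n) (leq_maxl _ _)) _.
  apply: le_trans _ (vmono n (maxn m n) (leq_maxr _ _)).
  have : 0 <= 2 * K / 2 ^+ (maxn m n) by rewrite divr_ge0 ?mulr_ge0 ?exprn_ge0.
  by rewrite /w /v; lra.
have hinf : has_inf (range v).
  by split; [exists (v 0%N), 0%N|exists (w 0%N) => _ [n _ <-]].
exists (inf (range v)) => n; rewrite ler_norml.
have h1 : inf (range v) <= v n by apply: ge_inf; [case: hinf|exists n].
have h2 : w n <= inf (range v).
  by apply: lb_le_inf; [case: hinf|move=> _ [m _ <-]].
by move: h1 h2; rewrite /v /w => h1 h2; apply/andP; split; lra.
Qed.

Lemma half_pow_small (e K : R) : 0 < e -> exists n, K / 2 ^+ n <= e.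
Proof.
move=> e0; pose n := (Num.truncn (K / e)).+1; exists n.
rewrite ler_pdivrMr ?exprn_gt0// mulrC -ler_pdivrMr//.
apply: le_trans (ltW (truncnS_gt _)) _.
by rewrite -natrX ler_nat ltnW// ltn_expl.
Qed.

End GeometricLimit.

(* A rational vector space X with two seminorms, together with a realization (Phi, D)
   of the dual of (X, 2 p) and the subspace I of its q-bounded elements. *)
Record dualPair (R : realType) := DualPair {
  dp_X : lmodType rat;
  dp_p : dp_X -> R;
  dp_q : dp_X -> R;
  dp_Phi : lmodType R;
  dp_D : seminorm dp_Phi;
  dp_I : submodClosed dp_Phi;
  dp_ev : dp_Phi -> dp_X -> R;
  dp_sp : sublinear dp_p;
  dp_pN : forall x, dp_p (- x) = dp_p x;
  dp_sq : sublinear dp_q;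
  dp_qN : forall x, dp_q (- x) = dp_q x;
  dp_qp : forall x, dp_q x <= dp_p x;
  dp_evD : forall f, {morph dp_ev f : x y / x + y};
  dp_ev_lin : forall (a : R) f g x,
    dp_ev (a *: f + g) x = a * dp_ev f x + dp_ev g x;
  dp_ev_le : forall f x, `|dp_ev f x| <= 2 * dp_D f * dp_p x;
  dp_rep : forall (h : dp_X -> R) (C : R), 0 <= C -> {morph h : x y / x + y} ->
    (forall x, `|h x| <= 2 * C * dp_p x) ->
    exists f, dp_D f <= C /\ forall x, dp_ev f x = h x;
  dp_D_le : forall f (C : R), 0 <= C -> (forall x, `|dp_ev f x| <= 2 * C * dp_p x) ->
    dp_D f <= C;
  dp_IP : forall f, f \in dp_I <-> exists C, forall x, `|dp_ev f x| <= C * dp_q x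
}.

Section DualPairTheory.
Context (R : realType) (P : dualPair R).
Local Notation X := (dp_X P).
Local Notation p := (@dp_p R P).
Local Notation q := (@dp_q R P).
Local Notation Phi := (dp_Phi P).
Local Notation D := (dp_D P).
Local Notation I := (dp_I P).
Local Notation ev := (@dp_ev R P).
Implicit Types (x y e : X) (f g : Phi).

Let p0 x : 0 <= p x. Proof. exact: (even_sublinear_ge0 (dp_sp P) (@dp_pN R P)). Qed.
Let q0 x : 0 <= q x. Proof. exact: (even_sublinear_ge0 (dp_sq P) (@dp_qN R P)). Qed.
Let D0 f : 0 <= D f. Proof. exact: seminorm_ge0. Qed.

Lemma dp_ev0 x : ev 0 x = 0.
Proof. by have := dp_ev_lin 1 0 (0 : Phi) x; rewrite scaler0 add0r mul1r; lra. Qed.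

Lemma dp_evDl f g x : ev (f + g) x = ev f x + ev g x.
Proof. by have := dp_ev_lin 1 f g x; rewrite scale1r mul1r. Qed.

Lemma dp_evZl a f x : ev (a *: f) x = a * ev f x.
Proof. by have := dp_ev_lin a f 0 x; rewrite !addr0 dp_ev0 addr0. Qed.

Lemma dp_evBl f g x : ev (f - g) x = ev f x - ev g x.
Proof. by rewrite dp_evDl -scaleN1r dp_evZl mulN1r. Qed.

Lemma dp_evB f x y : ev f (x - y) = ev f x - ev f y.
Proof. exact: (morphDB (dp_evD f)). Qed.

Lemma dp_I_unit_ball f : f \in I <-> exists K, forall x, q x <= 1 -> `|ev f x| <= K.
Proof.
rewrite dp_IP; split=> -[K fK]; last first.
  by exists K; exact: (unit_ball_bound (dp_sq P) (@dp_qN R P) (dp_evD f) fK).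
exists `|K| => x qx; apply: le_trans (fK x) _.
by apply: le_trans (ler_wpM2r (q0 x) (ler_norm K)) _; rewrite ler_piMr.
Qed.

(* The dual norm of (X, 2 p) restricted to I is equivalent to that of (X, q). *)
Definition I_bounded := exists C, forall f, f \in I -> D f <= 1 ->
  forall x, q x <= 1 -> `|ev f x| <= C.

(* After completion this says that (X, p) -> (X, q) has closed range. *)
Definition ball_approx := exists c, 0 <= c /\ forall x, q x <= 1 ->
  forall eps, 0 < eps -> exists e, p e <= c /\ q (x - e) <= eps.

Definition I_closed := forall f,
  (forall eps, 0 < eps -> exists g, g \in I /\ D (f - g) <= eps) -> f \in I.

(** Write [f(x) = f(e) + (f - g)(x - e) + g(x - e)] with [g] in [I] near [f]. The choice of [g]
    depends on [x], and that of [e] on the [q]-bound of [g], so the last two terms become small,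
    while the first is at most [2 c D(f)]. *)
Lemma ball_approx_closed : ball_approx -> I_closed.
Proof.
move=> [c [c0 hc]] f fI; apply/dp_I_unit_ball; exists (2 * c * D f) => x qx.
apply/ler_addgt0Pr => d d0.
(* Makes [2 eta (p x + c)] at most [d / 2]; the 1 keeps the denominator positive. *)
pose eta := d / (4 * (p x + c) + 1).
have den0 : 0 < 4 * (p x + c) + 1 by have := p0 x; lra.
have eta0 : 0 < eta by rewrite divr_gt0.
have [g [gI fg]] := fI _ eta0.
have /dp_IP[K gK] := gI.
have K1 : 0 < 2 * (`|K| + 1) by have := normr_ge0 K; lra.
have [e [pe qe]] := hc _ qx _ (divr_gt0 d0 K1).
have -> : ev f x = ev f e + (ev (f - g) (x - e) + ev g (x - e)).
  by rewrite dp_evBl !dp_evB; ring.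
have h1 : `|ev f e| <= 2 * c * D f.
  by apply: le_trans (dp_ev_le _ _) _; rewrite -!mulrA ler_pM2l// mulrC ler_wpM2r.
have h2 : `|ev (f - g) (x - e)| <= d / 2.
  apply: le_trans (dp_ev_le _ _) _.
  apply: (@le_trans _ _ (2 * eta * (p x + c))).
    apply: ler_pM => //; [by rewrite mulr_ge0|by rewrite ler_pM2l|].
    by apply: le_trans (even_sublinearB (dp_sp P) (@dp_pN R P) _ _) _; rewrite lerD2l.
  rewrite /eta; have := p0 x => px; rewrite mulrA mulrAC ler_pdivrMr//; nra.
have h3 : `|ev g (x - e)| <= d / 2.
  apply: le_trans (gK _) _; apply: (@le_trans _ _ (`|K| * (d / (2 * (`|K| + 1))))).
    apply: le_trans (ler_wpM2r (q0 _) (ler_norm K)) _.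
    by rewrite ler_wpM2l.
  rewrite mulrA ler_pdivrMr//; have := normr_ge0 K; nra.
have := ler_normD (ev f e) (ev (f - g) (x - e) + ev g (x - e)).
have := ler_normD (ev (f - g) (x - e)) (ev g (x - e)).
lra.
Qed.

(** If [x] cannot be approximated, it has norm at least 1 in the infimal convolution of [p / C] and
    [q / eps]. A functional [h] with [h x = 1] that is dominated by both is [q]-bounded, hence in
    [I], and [2 C h] has [D] at most 1 but exceeds [C] at [x]. *)
Lemma I_bounded_approx : I_bounded -> ball_approx.
Proof.
move=> [C0 hC0]; pose C := `|C0| + 1.
have C1 : 0 < C by rewrite /C ltr_wpDl.
have hC f : f \in I -> D f <= 1 -> forall x, q x <= 1 -> `|ev f x| <= C.
  by move=> fI fD x qx; have := hC0 f fI fD x qx; have := ler_norm C0; rewrite /C; lra.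
exists C; split; first exact: ltW.
move=> x qx eps eps0; apply: contrapT => /forallNP hx.
have fstMn (u : X * X) n : (u *+ n).1 = u.1 *+ n by rewrite -[LHS]/(fst _) raddfMn.
have sndMn (u : X * X) n : (u *+ n).2 = u.2 *+ n by rewrite -[LHS]/(snd _) raddfMn.
pose pr (u : X * X) := p u.1 / C + q u.2 / eps.
have spr : sublinear pr.
  split=> [u v|n u]; rewrite /pr /=.
    have h1 := (dp_sp P).1 u.1 v.1; have h2 := (dp_sq P).1 u.2 v.2.
    by rewrite addrACA -!mulrDl lerD// ler_wpM2r// invr_ge0 ltW.
  by rewrite fstMn sndMn (dp_sp P).2 (dp_sq P).2; ring.
have pr1 e : 1 <= pr (e, x - e).
  rewrite leNgt; apply/negP => pr_lt1; apply: (hx e); rewrite /pr /= in pr_lt1.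
  have h1 : 0 <= p e / C by rewrite divr_ge0// ltW.
  have h2 : 0 <= q (x - e) / eps by rewrite divr_ge0// ltW.
  split; first by rewrite -[C]mul1r -ler_pdivrMr//; lra.
  by rewrite -[eps]mul1r -ler_pdivrMr//; lra.
(* Hahn-Banach on the pairs [(e, m x - e)]. As [F] vanishes on [(y, - y)], its restrictions to the
   two factors are the same functional [h], which is therefore bounded by [p / C] and by
   [q / eps]. *)
pose s (u : X * int) : X * X := (u.1, x *~ u.2 - u.1).
have sD : {morph s : u v / u + v}.
  by move=> u v; rewrite /s /= mulrzDr opprD addrACA.
pose g (u : X * int) : R := u.2%:~R.
have gD : {morph g : u v / u + v} by move=> u v; rewrite /g /= intrD.
have gp u : g u <= pr (s u).
  have pr0 : 0 <= pr (s u) by rewrite addr_ge0// divr_ge0// ltW.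
  case: u pr0 => e [[|n]|n] pr0.
  - exact: pr0.
  - have := pr1 (n.+1%:R^-1 *: e); rewrite -(ler_pM2l (x := n.+1%:R))// mulr1.
    rewrite -spr.2; congr (_ <= pr _); rewrite [LHS]surjective_pairing fstMn sndMn.
    have nE : (n.+1%:R^-1 *: e) *+ n.+1 = e.
      by rewrite -scaler_nat scalerA divff ?scale1r// pnatr_eq0.
    by rewrite /= mulrnBl nE.
  - by apply: le_trans pr0; rewrite /g /= NegzE rmorphN/= oppr_le0.
have [F [FD Fp Fg]] := hahn_banach sD gD spr gp.
pose h y := F (0, y).
have hD : {morph h : y z / y + z}.
  by move=> y z; rewrite /h -FD; congr F; rewrite -[RHS]/(0 + 0, y + z) addr0.
have hN := morphDN hD.
have F0 : F 0 = 0 by apply: (@addrI _ (F 0)); rewrite -FD !addr0.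
have hF y : h y = F (y, 0).
  have E : (y, 0) = (y, - y) + (0, y) by rewrite -[RHS]/(y + 0, - y + y) addr0 addNr.
  rewrite E FD; have := Fg (y, 0); rewrite /s /g /= mulr0z sub0r => ->.
  by rewrite add0r.
have hle y : h y <= p y / C /\ h y <= q y / eps.
  split; last by have := Fp (0, y); rewrite /pr/= (sublinear0 (dp_sp P)) mul0r add0r.
  by have := Fp (y, 0); rewrite /pr/= (sublinear0 (dp_sq P)) mul0r addr0 -hF.
have habs y : `|h y| <= p y / C /\ `|h y| <= q y / eps.
  have [h1 h2] := hle y; have [h3 h4] := hle (- y).
  move: h3 h4; rewrite hN dp_pN dp_qN !ler_norml => h3 h4.
  by split; apply/andP; split; lra.
have hx1 : h x = 1.
  by have := Fg (0, 1); rewrite /s /g /= mulr1z subr0.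
have C2 : 0 < 2 * C by rewrite mulr_gt0.
have [|y|f [fD fh]] := @dp_rep R P h (2 * C)^-1 _ hD.
- by rewrite invr_ge0 ltW.
- apply: le_trans (habs y).1 _; rewrite mulrC; rewrite ler_wpM2r//.
  by rewrite invfM mulrA divff// mul1r.
have fI : (2 * C) *: f \in I.
  apply/dp_IP; exists (2 * C / eps) => y; rewrite dp_evZl fh normrM gtr0_norm//.
  have -> : 2 * C / eps * q y = (2 * C) * (q y / eps) by ring.
  by rewrite ler_pM2l//; have [_] := habs y.
have Df : D ((2 * C) *: f) <= 1.
  by rewrite seminormZ gtr0_norm// -ler_pdivlMl// mulr1.
have := hC _ fI Df x qx; rewrite dp_evZl fh hx1 mulr1 gtr0_norm//.
lra.
Qed.

End DualPairTheory.

(** * The gliding hump *)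

Section GlidingHump.
Context (R : realType) (P : dualPair R).
Local Notation X := (dp_X P).
Local Notation p := (@dp_p R P).
Local Notation q := (@dp_q R P).
Local Notation Phi := (dp_Phi P).
Local Notation D := (dp_D P).
Local Notation I := (dp_I P).
Local Notation ev := (@dp_ev R P).
Implicit Types (x y : X) (f g : Phi).

Let p0 x : 0 <= p x. Proof. exact: (even_sublinear_ge0 (dp_sp P) (@dp_pN R P)). Qed.
Let D0 f : 0 <= D f. Proof. exact: seminorm_ge0. Qed.
Let pow0 n : (0 : R) < 2 ^+ n. Proof. exact: exprn_gt0. Qed.

(** Completeness of the dual, with a rate: the partial sums converge geometrically at each point of
    [X], and the limit is represented through [dp_rep]. *)
Lemma series_limit (h : nat -> Phi) (t : nat -> R) : (forall k, `|t k| <= 1) ->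
  (forall k, D (h k) <= (2 ^+ k)^-1) ->
  exists f, forall n, D (f - \sum_(j < n) t j *: h j) <= 2 / 2 ^+ n.
Proof.
move=> t1 Dh; pose u y n := ev (\sum_(j < n) t j *: h j) y.
have uS y n : `|u y n.+1 - u y n| <= 2 * p y / 2 ^+ n.
  rewrite /u big_ord_recr/= dp_evDl addrAC subrr add0r dp_evZl normrM.
  apply: (@le_trans _ _ `|ev (h n) y|).
    by rewrite -[leRHS]mul1r ler_wpM2r.
  apply: le_trans (dp_ev_le _ _) _; rewrite -!mulrA ler_pM2l// mulrC.
  by rewrite ler_wpM2l.
have /choice[l hl] : forall y, exists l, forall n, `|l - u y n| <= 2 * (2 * p y) / 2 ^+ n.
  by move=> y; exact: geometric_limit.
have lD : {morph l : y z / y + z}.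
  move=> y z; apply/eqP; rewrite -subr_eq0 -normr_le0; apply/ler_addgt0Pr => e e0.
  have [n hn] := half_pow_small (4 * (p (y + z) + p y + p z)) e0.
  rewrite add0r; apply: le_trans hn.
  have E : u (y + z) n = u y n + u z n by exact: dp_evD.
  have h1 := hl (y + z) n; have h2 := hl y n; have h3 := hl z n.
  have -> : 4 * (p (y + z) + p y + p z) / 2 ^+ n = 2 * (2 * p (y + z)) / 2 ^+ n +
    2 * (2 * p y) / 2 ^+ n + 2 * (2 * p z) / 2 ^+ n by ring.
  move: h1 h2 h3; rewrite E !ler_norml => /andP[? ?] /andP[? ?] /andP[? ?].
  by apply/andP; split; lra.
have [|y|f [_ fl]] := @dp_rep R P l 2 _ lD; first by [].
  by have := hl y 0%N; rewrite /u big_ord0 dp_ev0 subr0 expr0 divr1 mulrA.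
exists f => n; apply: dp_D_le => [|y]; first by rewrite divr_ge0// ltW.
rewrite dp_evBl fl; apply: le_trans (hl y n) _.
by rewrite le_eqVlt; apply/orP; left; apply/eqP; ring.
Qed.

(* The k-th functional h k is small in D but large at a point x k of the q-unit ball;
   there the earlier ones are controlled by their q-bounds and the later ones by D. *)
Lemma gliding_hump : ~ I_bounded P -> exists (h : nat -> Phi),
  [/\ forall k, h k \in I, forall k, D (h k) <= (2 ^+ k)^-1 &
    forall (t : nat -> R) f, (forall k, `|t k| <= 1) ->
    (forall n, D (f - \sum_(j < n) t j *: h j) <= 2 / 2 ^+ n) -> f \in I ->
    exists C, forall k, `|t k| * k%:R <= C].
Proof.
move=> nI.
(* In [z = (k, M, S)], [M] is the sum of the [q]-bounds of the functionals chosen so far and [S] the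
   sum of [p] over the points chosen so far. The components of [w] are the next functional, its
   point and its [q]-bound; the functional is [a^-1] times a counterexample to [I_bounded]. *)
have /choice[g hg] : forall z : nat * R * R, exists w : Phi * X * R,
    [/\ w.1.1 \in I, D w.1.1 <= (2 ^+ z.1.1 * (1 + `|z.2|))^-1, q w.1.2 <= 1,
      z.1.1%:R * (1 + `|z.1.2|) <= `|ev w.1.1 w.1.2| &
      0 <= w.2 /\ forall y, q y <= 1 -> `|ev w.1.1 y| <= w.2].
  move=> [[k M] S] /=; pose a := 2 ^+ k * (1 + `|S|).
  have a0 : 0 < a by rewrite mulr_gt0// ltr_pwDl.
  apply: contrapT => /forallNP hw; apply: nI.
  exists (k%:R * (1 + `|M|) * a) => f fI fD x qx.
  rewrite leNgt; apply/negP => big.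
  have aI : a^-1 *: f \in I by rewrite rpredZ.
  have /dp_I_unit_ball[K hK] := aI.
  apply: (hw (a^-1 *: f, x, K)); split=> //=.
  - by rewrite seminormZ gtr0_norm ?invr_gt0// ler_piMr// invr_ge0 ltW.
  - rewrite dp_evZl normrM gtr0_norm ?invr_gt0// ler_pdivlMl//.
    by rewrite [leLHS]mulrC ltW.
  - by split=> //; exact: le_trans (hK x qx).
pose st := fix st k : R * R := if k is k'.+1 then
  let w := g (k', (st k').1, (st k').2) in ((st k').1 + w.2, (st k').2 + p w.1.2)
  else (0, 0).
pose w k := g (k, (st k).1, (st k).2).
pose h k := (w k).1.1; pose x k := (w k).1.2.
have stS k : st k.+1 = ((st k).1 + (w k).2, (st k).2 + p (x k)) by [].
have wP k := hg (k, (st k).1, (st k).2); rewrite -/w /= in wP.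
have M0 k : 0 <= (st k).1.
  elim: k => [//|k IH]; rewrite stS addr_ge0//.
  by have [_ _ _ _ []] := wP k.
have S0 k : 0 <= (st k).2 by elim: k => [//|k IH]; rewrite stS addr_ge0.
have tle (t : nat -> R) k y : `|t k| <= 1 -> `|t k * ev (h k) y| <= `|ev (h k) y|.
  by move=> t1; rewrite normrM -[leRHS]mul1r ler_wpM2r.
have hM (t : nat -> R) k y : (forall j, `|t j| <= 1) -> q y <= 1 ->
    `|ev (\sum_(j < k) t j *: h j) y| <= (st k).1.
  move=> t1 qy; elim: k => [|k IH]; first by rewrite big_ord0 dp_ev0 normr0.
  rewrite big_ord_recr/= dp_evDl dp_evZl; apply: le_trans (ler_normD _ _) _.
  apply: lerD => //; apply: le_trans (tle _ _ _ (t1 k)) _.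
  by have [_ _ _ _ [_]] := wP k; apply.
have hS k m : p (x k) <= (st (k.+1 + m)%N).2.
  elim: m => [|m IH]; first by rewrite addn0 stS /= lerDr.
  by rewrite addnS stS /=; apply: le_trans IH _; rewrite lerDl.
have Dh k : D (h k) <= (2 ^+ k * (1 + (st k).2))^-1.
  by have [_ + _ _ _] := wP k; rewrite (ger0_norm (S0 k)).
exists h; split=> [k|k|t f t1 fT fI]; first by have [] := wP k.
  apply: le_trans (Dh k) _; rewrite lef_pV2 ?posrE ?mulr_gt0//; last by rewrite ltr_pwDl.
  by rewrite ler_peMr ?lerDl// ltW.
have /dp_I_unit_ball[K hK] := fI; exists (`|K| + 5) => k.
have [_ _ qx hx _] := wP k; rewrite (ger0_norm (M0 k)) -/(h k) -/(x k) in qx hx.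
pose u n := ev (\sum_(j < n) t j *: h j) (x k).
(* The later term of index [n] is at most [2 D(h n) p(x k)], hence at most [2 / 2^n], because
   [p (x k)] is part of the sum [S] in the bound on [D (h n)]. *)
have tail m : `|u (k.+1 + m)%N - u k.+1| <= 4 - 4 / 2 ^+ (k.+1 + m).
  elim: m => [|m IH].
    rewrite addn0 subrr normr0 subr_ge0 ler_pdivrMr// ler_peMr//.
    by rewrite exprn_ege1// ler1n.
  rewrite addnS {1}/u big_ord_recr/= dp_evDl dp_evZl -/(u _) addrAC.
  apply: le_trans (ler_normD _ _) _.
  set n := (k.+1 + m)%N in IH *.
  have h1 : `|t n * ev (h n) (x k)| <= 2 / 2 ^+ n.
    apply: le_trans (tle _ _ _ (t1 n)) _; apply: le_trans (dp_ev_le _ _) _.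
    rewrite -mulrA ler_pM2l//.
    apply: (@le_trans _ _ ((2 ^+ n * (1 + (st n).2))^-1 * (1 + (st n).2))).
      apply: ler_pM => //; apply: le_trans (hS k m) _; rewrite -/n lerDr//.
    rewrite invfM -mulrA mulVf ?mulr1// gt_eqF// ltr_pwDl//.
  have E : 4 / 2 ^+ n = 4 / 2 ^+ n.+1 + 2 / 2 ^+ n :> R.
    by rewrite exprS; field; rewrite expf_neq0.
  by lra.
have [N0 hN0] := half_pow_small (4 * p (x k)) ltr01.
pose n := (k.+1 + N0)%N.
have rem : `|ev f (x k) - u n| <= 1.
  rewrite /u -dp_evBl; apply: le_trans (dp_ev_le _ _) _.
  apply: le_trans hN0; have := fT n => fTn.
  apply: (@le_trans _ _ (2 * (2 / 2 ^+ n) * p (x k))).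
    by rewrite ler_wpM2r// ler_pM2l.
  have -> : 2 * (2 / 2 ^+ n) * p (x k) = 4 * p (x k) / 2 ^+ n by ring.
  rewrite ler_wpM2l ?mulr_ge0// lef_pV2 ?posrE//.
  by rewrite ler_eXn2l ?ltr1n// /n leq_addl.
have uk : u k.+1 = u k + t k * ev (h k) (x k).
  by rewrite /u big_ord_recr/= dp_evDl dp_evZl.
have h1 := hM t k (x k) t1 qx; rewrite -/(u k) in h1.
have h2 := hK (x k) qx.
have h3 : `|u n - u k.+1| <= 4.
  by apply: le_trans (tail N0) _; rewrite lerBlDr lerDl divr_ge0// ltW.
(* The hump is what remains of [f] at [x k]: [f] itself contributes [K], the earlier terms [M], the
   later ones 4 and the remainder of the series 1. The factor [1 + M] in the height of the hump then
   absorbs [M]. *)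
have h4 : `|t k * ev (h k) (x k)| <= K + 5 + (st k).1.
  move: h1 h2 h3 rem; rewrite uk !ler_norml.
  move=> /andP[? ?] /andP[? ?] /andP[? ?] /andP[? ?].
  by apply/andP; split; lra.
have h5 : `|t k| * k%:R * (1 + (st k).1) <= (`|K| + 5) * (1 + (st k).1).
  apply: (@le_trans _ _ (K + 5 + (st k).1)).
    apply: le_trans h4; rewrite normrM -mulrA ler_wpM2l//.
  have := ler_norm K; have := normr_ge0 K; have := M0 k; nra.
by move: h5; rewrite ler_pM2r// ltr_pwDl.
Qed.

End GlidingHump.

Section BoundedDual.
Context (R : realType) (P : dualPair R).
Local Notation X := (dp_X P).
Local Notation q := (@dp_q R P).
Local Notation Phi := (dp_Phi P).
Local Notation D := (dp_D P).
Local Notation I := (dp_I P).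
Local Notation ev := (@dp_ev R P).
Implicit Types (x y : X) (f g : Phi).

(** With all coefficients equal to 1 the series lies in [I] by closedness, and then the hump bounds
    every [k]. *)
Lemma closed_I_bounded : I_closed P -> I_bounded P.
Proof.
move=> Icl; apply: contrapT => /gliding_hump[h [hI hD hump]].
have t1 (k : nat) : `|1 : R| <= 1 by rewrite normr1.
have [f fh] := series_limit t1 hD.
have fI : f \in I.
  apply: Icl => e e0; have [n hn] := half_pow_small 2 e0.
  exists (\sum_(j < n) 1 *: h j); split; last exact: le_trans hn.
  by apply: rpred_sum => j _; rewrite rpredZ.
have [C hC] := hump _ _ t1 fh fI.
have := hC (Num.truncn C).+1; rewrite normr1 mul1r leNgt => /negP; apply.
exact: truncnS_gt.
Qed.

(** Summing the humps over each residue class modulo [n.+1] gives [n.+1] limits in a quotient of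
    dimension [n]. A nontrivial relation between them is a series in [I] whose coefficients are
    constant on residue classes and nonzero on one of them, against the bound on [|t k| * k]. *)
Lemma findim_I_bounded : finite_dimensional (snquot D I) -> I_bounded P.
Proof.
move=> [n [[v2r v2r_lin v2r_bij]]].
apply: contrapT => /gliding_hump[h [hI hD hump]].
pose chi (i : 'I_n.+1) (k : nat) : R := (k %% n.+1 == i)%N%:R.
have chi1 i k : `|chi i k| <= 1 by rewrite /chi; case: eqP; rewrite ?normr1 ?normr0.
have /choice[F hF] : forall i, exists f, forall m,
    D (f - \sum_(j < m) chi i j *: h j) <= 2 / 2 ^+ m.
  by move=> i; exact: series_limit (chi1 i) hD.
pose M : 'M[R]_(n.+1, n) := \matrix_i v2r (snproj D I (F i)).
have : kermx M != 0.
  rewrite kermx_eq0 /row_free; apply: contraTN isT => /eqP rM.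
  by have := rank_leq_col M; rewrite rM ltnn.
case/rowV0Pn => a0 /sub_kermxP a0M a0N0.
pose b : R := \sum_i `|a0 0 i| + 1.
have b1 : 0 < b by rewrite ltr_wpDl// sumr_ge0.
pose a i := a0 0 i / b.
have a1 i : `|a i| <= 1.
  rewrite normrM normfV (gtr0_norm b1) ler_pdivrMr// mul1r.
  by rewrite /b (bigD1 i)//= -addrA lerDl addr_ge0// sumr_ge0.
pose f := \sum_i a i *: F i.
have fI : f \in I.
  have [r2v v2rK _] := v2r_bij.
  have h0 : v2r (snproj D I f) = 0.
    have vD : {morph v2r : u v / u + v}.
      by move=> u v; have := v2r_lin 1 u v; rewrite !scale1r.
    have v0 : v2r 0 = 0 by apply: (@addrI _ (v2r 0)); rewrite -vD !addr0.
    have vZ c u : v2r (c *: u) = c *: v2r u.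
      by have := v2r_lin c u 0; rewrite v0 !addr0.
    rewrite linear_sum (big_morph _ vD v0).
    transitivity (b^-1 *: (a0 *m M)); last by rewrite a0M scaler0.
    rewrite mulmx_sum_row scaler_sumr.
    by apply: eq_bigr => i _; rewrite linearZ vZ rowK scalerA mulrC.
  have f0 : snproj D I f = snproj D I 0.
    rewrite -[LHS]v2rK -[RHS]v2rK h0; congr r2v.
    by rewrite linear0; apply: (@addrI _ (v2r 0)); have := v2r_lin 1 0 0;
      rewrite !scale1r addr0 => {1}->; rewrite addr0.
  by have /qprojP := f0; rewrite subr0.
pose t k := \sum_i a i * chi i k.
have aS : \sum_i `|a i| <= 1.
  rewrite (eq_bigr (fun i => `|a0 0 i| / b)); last first.
    by move=> i _; rewrite normrM normfV (gtr0_norm b1).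
  by rewrite -mulr_suml ler_pdivrMr// mul1r lerDl.
have t1 k : `|t k| <= 1.
  apply: le_trans (ler_norm_sum _ _ _) _; apply: le_trans aS; apply: ler_sum => i _.
  by rewrite normrM -[leRHS]mulr1 ler_wpM2l.
have ft m : D (f - \sum_(j < m) t j *: h j) <= 2 / 2 ^+ m.
  have -> : f - \sum_(j < m) t j *: h j =
      \sum_i a i *: (F i - \sum_(j < m) chi i j *: h j).
    under [RHS]eq_bigr do rewrite scalerBr scaler_sumr.
    rewrite [RHS]sumrB; congr (_ - _); rewrite exchange_big/=.
    apply: eq_bigr => j _; rewrite scaler_suml; apply: eq_bigr => i _.
    by rewrite scalerA.
  have Dsum (r : seq 'I_n.+1) (H : 'I_n.+1 -> Phi) :
      D (\sum_(i <- r) H i) <= \sum_(i <- r) D (H i).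
    elim: r => [|i r IH]; first by rewrite !big_nil seminorm0.
    by rewrite !big_cons; apply: le_trans (seminormD _ _ _) _; rewrite lerD2l.
  apply: le_trans (Dsum _ _) _.
  apply: (@le_trans _ _ (\sum_i `|a i| * (2 / 2 ^+ m))).
    by apply: ler_sum => i _; rewrite seminormZ ler_wpM2l.
  by rewrite -mulr_suml -[leRHS]mul1r ler_wpM2r// divr_ge0// exprn_ge0.
have [C hC] := hump t f t1 ft fI.
have /rV0Pn[i ai0] := a0N0.
have ai : 0 < `|a i| by rewrite normr_gt0 mulf_neq0// invr_neq0// gt_eqF.
pose m := (Num.truncn (C / `|a i|)).+1.
have := hC (i + m * n.+1)%N.
have -> : t (i + m * n.+1)%N = a i.
  rewrite /t (bigD1 i)//= big1 ?addr0 => [|j ji].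
    by rewrite /chi addnC modnMDl modn_small// eqxx mulr1.
  rewrite /chi addnC modnMDl modn_small// eq_sym.
  by rewrite -[(_ == _ :> nat)]/(j == i) (negbTE ji) mulr0.
rewrite leNgt => /negP; apply.
apply: (@lt_le_trans _ _ (`|a i| * m%:R)).
  by rewrite mulrC -ltr_pdivrMr// truncnS_gt.
by rewrite ler_pM2l// ler_nat mulnS addnCA leq_addr.
Qed.

End BoundedDual.

(** * The kernel in the completion *)

Section Bidual.
Context (R : realType) (P : dualPair R).
Local Notation X := (dp_X P).
Local Notation p := (@dp_p R P).
Local Notation q := (@dp_q R P).
Local Notation Phi := (dp_Phi P).
Local Notation D := (dp_D P).
Local Notation I := (dp_I P).
Local Notation ev := (@dp_ev R P).
Implicit Types (x y : X) (f g : Phi) (F H : Phi -> R^o).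

Let p0 x : 0 <= p x. Proof. exact: (even_sublinear_ge0 (dp_sp P) (@dp_pN R P)). Qed.
Let D0 f : 0 <= D f. Proof. exact: seminorm_ge0. Qed.

Definition bidual_norm F : R := sup [set `|F f| | f in [set f | D f <= 1]].

Lemma bidual_norm_le F (C : R) : 0 <= C -> (forall f, `|F f| <= C * D f) ->
  bidual_norm F <= C.
Proof.
move=> C0 h; apply: ge_sup.
  by exists `|F 0|, 0 => //=; rewrite seminorm0.
by move=> _ [f /= fD <-]; apply: le_trans (h f) _; rewrite ler_piMr.
Qed.

Lemma bidual_norm_ub F (C : R) f : (forall a f, F (a *: f) = a * F f) ->
  (forall f, `|F f| <= C * D f) -> `|F f| <= bidual_norm F * D f.
Proof.
move=> FZ FC; have [Df0|Df0] := eqVneq (D f) 0.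
  by rewrite Df0 mulr0; have := FC f; rewrite Df0 mulr0.
have Dp : 0 < D f by rewrite lt_neqAle eq_sym Df0 D0.
rewrite -ler_pdivrMr//; apply: ub_le_sup.
  exists `|C| => _ [g /= gD <-]; apply: le_trans (FC g) _.
  by apply: le_trans (ler_wpM2r (D0 g) (ler_norm C)) _; rewrite ler_piMr.
exists ((D f)^-1 *: f) => /=.
  by rewrite seminormZ gtr0_norm ?invr_gt0// mulVf.
by rewrite FZ normrM gtr0_norm ?invr_gt0// mulrC.
Qed.

(* The elements of the closure of (the image of) X in the bidual that vanish on I. *)
Definition bikernel_pred : {pred Phi -> R^o} := [pred F | `[<
  (forall eps, 0 < eps -> exists x, forall f, `|F f - ev f x| <= eps * D f) /\
  (forall f, f \in I -> F f = 0) >]].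

Lemma bikernel_approx F eps : F \in bikernel_pred -> 0 < eps ->
  exists x, forall f, `|F f - ev f x| <= eps * D f.
Proof. by move=> /asboolP[h _]; exact: h. Qed.

Lemma bikernel_I F f : F \in bikernel_pred -> f \in I -> F f = 0.
Proof. by move=> /asboolP[_ h]; exact: h. Qed.

(** Inherited from the evaluations, which are linear and approximate [F]. *)
Lemma bikernel_linear F a f g : F \in bikernel_pred -> F (a *: f + g) = a * F f + F g.
Proof.
move=> FV; apply/eqP; rewrite -subr_eq0 -normr_le0; apply/ler_addgt0Pr => e e0.
pose K := D (a *: f + g) + `|a| * D f + D g + 1.
have K0 : 0 < K by rewrite ltr_wpDl// !addr_ge0// mulr_ge0.
have [x hx] := bikernel_approx FV (divr_gt0 e0 K0).
have -> : F (a *: f + g) - (a * F f + F g) = (F (a *: f + g) - ev (a *: f + g) x)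
    - (a * (F f - ev f x) + (F g - ev g x)).
  by rewrite dp_ev_lin; ring.
rewrite add0r; apply: le_trans (ler_normB _ _) _.
apply: le_trans (lerD (hx _) (ler_normD _ _)) _.
rewrite normrM; apply: (@le_trans _ _
    (e / K * D (a *: f + g) + (`|a| * (e / K * D f) + e / K * D g))).
  by rewrite lerD2l lerD// ler_wpM2l.
have -> : e / K * D (a *: f + g) + (`|a| * (e / K * D f) + e / K * D g) =
  e * ((K - 1) / K) by rewrite /K; ring.
by apply: ler_piMr; [exact: ltW|rewrite ler_pdivrMr//; lra].
Qed.

Lemma bikernel0 F : F \in bikernel_pred -> F 0 = 0.
Proof.
move=> FV; have := bikernel_linear 1 0 0 FV; rewrite scale1r addr0 mul1r => h.
by apply: (@addrI _ (F 0)); rewrite -h addr0.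
Qed.

Lemma bikernelZ F a f : F \in bikernel_pred -> F (a *: f) = a * F f.
Proof.
by move=> FV; have := bikernel_linear a f 0 FV; rewrite (bikernel0 FV) !addr0.
Qed.

Lemma bikernelD F f g : F \in bikernel_pred -> F (f + g) = F f + F g.
Proof. by move=> FV; have := bikernel_linear 1 f g FV; rewrite scale1r mul1r. Qed.

Lemma bikernelB F f g : F \in bikernel_pred -> F (f - g) = F f - F g.
Proof. by move=> FV; rewrite bikernelD// -scaleN1r bikernelZ// mulN1r. Qed.

Lemma bikernel_bounded F : F \in bikernel_pred -> exists C, forall f, `|F f| <= C * D f.
Proof.
move=> FV; have [x hx] := bikernel_approx FV ltr01.
exists (2 * p x + 1) => f; rewrite -(subrK (ev f x) (F f)).
apply: le_trans (ler_normD _ _) _; apply: le_trans (lerD (hx f) (dp_ev_le _ _)) _.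
by rewrite le_eqVlt; apply/orP; left; apply/eqP; ring.
Qed.

Lemma bikernel_le F f : F \in bikernel_pred -> `|F f| <= bidual_norm F * D f.
Proof.
move=> FV; have [C hC] := bikernel_bounded FV.
by apply: bidual_norm_ub hC => a g; exact: bikernelZ.
Qed.

Lemma bikernel_submod : submod_closed bikernel_pred.
Proof.
split.
  apply/asboolP; split=> // eps eps0; exists 0 => f.
  by rewrite (morphD0 (dp_evD f)) -[(0 : Phi -> R^o) f]/(0 : R) subr0 normr0 mulr_ge0// ltW.
move=> a F H FV HV; apply/asboolP; split; last first.
  move=> f fI; rewrite -[LHS]/(a * F f + H f : R) (bikernel_I FV fI) (bikernel_I HV fI).
  by rewrite mulr0 addr0.
move=> e e0; pose e' := e / (`|a| + 3).
have d0 : 0 < `|a| + 3 by rewrite ltr_wpDl.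
have e'0 : 0 < e' by rewrite divr_gt0.
have [x hx] := bikernel_approx FV e'0; have [y hy] := bikernel_approx HV e'0.
have px : 0 < 2 * p x + 1 by have := p0 x; lra.
pose c := e' / (2 * p x + 1).
have c0 : 0 < c by rewrite divr_gt0.
(* Real multiples in the closure of a rational vector space: [a] is replaced by a rational [r], and
   [c] is scaled so that this costs at most [e'] at [x]. The errors [|a| e'], [e'] and [e'] add up
   to less than [e = (|a| + 3) e']. *)
have [r] : exists r : rat, `|a - ratr r| <= c.
  have ac : a - c < a + c by lra.
  have [r] := rat_in_itvoo ac; rewrite in_itv/= => /andP[h1 h2].
  by exists r; rewrite ler_norml; apply/andP; split; lra.
move=> rc; exists (r *: x + y) => f.
rewrite (dp_evD f) (morphDZ (dp_evD f)).
have -> : (a *: F + H) f - (ratr r * ev f x + ev f y) =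
    a * (F f - ev f x) + ((a - ratr r) * ev f x + (H f - ev f y)).
  by rewrite -[(a *: F + H) f]/(a * F f + H f : R); ring.
have h1 : `|a * (F f - ev f x)| <= `|a| * (e' * D f) by rewrite normrM ler_wpM2l.
have h2 : `|(a - ratr r) * ev f x| <= e' * D f.
  rewrite normrM; apply: (@le_trans _ _ (c * (2 * D f * p x))).
    by apply: ler_pM => //; exact: dp_ev_le.
  have -> : c * (2 * D f * p x) = e' * D f * ((2 * p x) / (2 * p x + 1)).
    by rewrite /c; ring.
  by apply: ler_piMr; [rewrite mulr_ge0// ltW|rewrite ler_pdivrMr//; lra].
apply: le_trans (ler_normD _ _) _.
apply: le_trans (lerD h1 (ler_normD _ _)) _.
apply: le_trans (lerD (lexx _) (lerD h2 (hy f))) _.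
have -> : `|a| * (e' * D f) + (e' * D f + e' * D f) = e * D f * ((`|a| + 2) / (`|a| + 3)).
  by rewrite /e'; ring.
by apply: ler_piMr; [rewrite mulr_ge0// ltW|rewrite ler_pdivrMr//; lra].
Qed.

HB.instance Definition _ := GRing.isSubmodClosed.Build R (Phi -> R^o) bikernel_pred
  (GRing.submod_closed_semi bikernel_submod).

Definition bikernel : Type := {F : Phi -> R^o | F \in bikernel_pred}.

HB.instance Definition _ := SubChoice.on bikernel.
HB.instance Definition _ := [SubChoice_isSubLmodule of bikernel by <:].

Lemma bikernel_mem (F : bikernel) : val F \in bikernel_pred.
Proof. exact: valP. Qed.

Definition bikernel_norm (F : bikernel) : R := bidual_norm (val F).

Lemma bikernel_norm_ge0 (F : bikernel) : 0 <= bikernel_norm F.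
Proof.
have [C hC] := bikernel_bounded (bikernel_mem F).
apply: le_trans (_ : `|val F 0| <= _) => //; apply: ub_le_sup.
  exists `|C| => _ [g /= gD <-]; apply: le_trans (hC g) _.
  by apply: le_trans (ler_wpM2r (D0 g) (ler_norm C)) _; rewrite ler_piMr.
by exists 0 => //=; rewrite seminorm0.
Qed.

Lemma bikernel_normD (F H : bikernel) : bikernel_norm (F + H) <= bikernel_norm F + bikernel_norm H.
Proof.
apply: bidual_norm_le => [|f]; first by rewrite addr_ge0 ?bikernel_norm_ge0.
rewrite -[val (F + H) f]/(val F f + val H f : R) mulrDl.
apply: le_trans (ler_normD _ _) _.
by apply: lerD; exact/bikernel_le/bikernel_mem.
Qed.

Lemma bikernel_normZ_le a (F : bikernel) : bikernel_norm (a *: F) <= `|a| * bikernel_norm F.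
Proof.
apply: bidual_norm_le => [|f]; first by rewrite mulr_ge0 ?bikernel_norm_ge0.
rewrite -[val (a *: F) f]/(a * val F f : R) normrM -mulrA ler_wpM2l//.
exact/bikernel_le/bikernel_mem.
Qed.

Lemma bikernel_normZ a (F : bikernel) : bikernel_norm (a *: F) = `|a| * bikernel_norm F.
Proof.
apply/eqP; rewrite eq_le bikernel_normZ_le/=; have [->|a0] := eqVneq a 0.
  by rewrite normr0 mul0r bikernel_norm_ge0.
rewrite mulrC -ler_pdivlMr ?normr_gt0// mulrC -normfV.
by rewrite -{1}[F](scalerK a0) bikernel_normZ_le.
Qed.

Lemma bikernel_norm0_eq0 (F : bikernel) : bikernel_norm F = 0 -> F = 0.
Proof.
move=> F0; apply/val_inj/funext => f; apply/eqP; rewrite -normr_le0.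
by have := bikernel_le f (bikernel_mem F); rewrite -/(bikernel_norm F) F0 mul0r.
Qed.

HB.instance Definition _ := Lmodule_isNormed.Build R bikernel
  bikernel_normD bikernel_normZ bikernel_norm0_eq0.

(** The functional norming [p] at [x] has [D] at most 1/2, as [D] is dual to [2 p]; hence the
    division by 2. *)
Lemma le_of_ev x K : 0 <= K -> (forall f, `|ev f x| <= K * D f) -> p x <= K / 2.
Proof.
move=> K0 h; have [g [gD gp gx]] := norming_functional x (dp_sp P) (@dp_pN R P).
have [||f [fD fg]] := @dp_rep R P g 2^-1 _ gD; first by [].
  by move=> y; rewrite divff// mul1r.
by have := h f; rewrite fg gx ger0_norm// => /le_trans; apply; rewrite ler_wpM2l.
Qed.

(** A functional norming [q] at [x] lies in [I], so [F] vanishes on it, and the closeness of [x] to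
    [F] bounds [q x]. *)
Lemma bikernel_near_X F : F \in bikernel_pred ->
  exists x, q x <= 1 /\ forall f, `|F f - ev f x| <= D f.
Proof.
move=> FV; have [x hx] := bikernel_approx FV ltr01.
exists x; split; last by move=> f; have := hx f; rewrite mul1r.
have [g [gD gq gx]] := norming_functional x (dp_sq P) (@dp_qN R P).
have [||f [fD fg]] := @dp_rep R P g 2^-1 _ gD; first by [].
  by move=> y; rewrite divff// mul1r; apply: le_trans (gq y) (dp_qp _).
have fI : f \in I by apply/dp_IP; exists 1 => y; rewrite fg mul1r.
have := hx f; rewrite (bikernel_I FV fI) fg gx sub0r normrN mul1r.
by have := ler_norm (q x); lra.
Qed.

(** Successive corrections as in the open mapping theorem: [q (s n) <= 2^-n] while
    [p (s n - s n.+1) <= c / 2^n]. The sequence converges in the bidual, and its limit vanishes on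
    [I] since [q (s n)] tends to 0. *)
Lemma unit_ball_near_bikernel : ball_approx P -> exists K, 0 <= K /\
  forall x, q x <= 1 -> exists F, F \in bikernel_pred /\
    forall f, `|ev f x - F f| <= K * D f.
Proof.
move=> [c [c0 hc]]; have pow0 n : (0 : R) < 2 ^+ n by exact: exprn_gt0.
have /choice[step hstep] : forall kx : nat * X, exists y, q kx.2 <= (2 ^+ kx.1)^-1 ->
    q y <= (2 ^+ kx.1.+1)^-1 /\ p (kx.2 - y) <= c / 2 ^+ kx.1.
  move=> [k x] /=; have [qx|qx] := pselect (q x <= (2 ^+ k)^-1); last by exists 0.
  have n0 : (0 < 2 ^ k)%N by rewrite expn_gt0.
  have nE : (2 ^ k)%:R = 2 ^+ k :> R by rewrite natrX.
  (* The approximation is made at [2^k x] with error 1/2 and divided by [2^k] afterwards. *)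
  have [||e [pe qe]] := hc (x *+ 2 ^ k) _ 2^-1; last first.
  - exists (x - (2 ^ k)%:R^-1 *: e) => _; split; last first.
      by rewrite opprB addrC subrK (sublinear_div (dp_sp P))// nE ler_wpM2r// invr_ge0 ltW.
    have -> : x - (2 ^ k)%:R^-1 *: e = (2 ^ k)%:R^-1 *: (x *+ 2 ^ k - e).
      by rewrite scalerBr -scaler_nat scalerA mulVf ?scale1r// pnatr_eq0 -lt0n.
    rewrite (sublinear_div (dp_sq P))// nE exprS invfM ler_wpM2r// invr_ge0 ltW//.
  - by [].
  - by rewrite (dp_sq P).2 nE mulrC -ler_pdivlMr// mul1r.
exists (4 * c); split; first by rewrite mulr_ge0.
move=> x qx; pose s := fix s n := if n is m.+1 then step (m, s m) else x.
have qs n : q (s n) <= (2 ^+ n)^-1.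
  elim: n => [|n IH]; first by rewrite expr0 invr1.
  by have [] := hstep (n, s n) IH.
have ps n : p (s n - s n.+1) <= c / 2 ^+ n by have [] := hstep (n, s n) (qs n).
have /choice[F hF] : forall f, exists l, forall n,
    `|l - ev f (s n)| <= 2 * (2 * D f * c) / 2 ^+ n.
  move=> f; apply: geometric_limit => n; rewrite -dp_evB.
  apply: le_trans (dp_ev_le _ _) _; rewrite -[leRHS]mulrA ler_wpM2l//; first by rewrite mulr_ge0.
  by rewrite -opprB dp_pN.
exists F; split; last first.
  by move=> f; have := hF f 0%N; rewrite expr0 divr1 distrC => /le_trans; apply;
    rewrite le_eqVlt; apply/orP; left; apply/eqP; ring.
apply/asboolP; split=> [eps eps0|f fI].
  have [n hn] := half_pow_small (4 * c) eps0; exists (s n) => f.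
  apply: le_trans (hF f n) _; apply: le_trans (ler_wpM2r (D0 f) hn).
  by rewrite le_eqVlt; apply/orP; left; apply/eqP; ring.
have /dp_IP[C hC] := fI.
apply/eqP; rewrite -normr_le0; apply/ler_addgt0Pr => e e0.
have [n hn] := half_pow_small (4 * D f * c + `|C|) e0.
rewrite add0r; apply: le_trans hn; rewrite -[F f](subrK (ev f (s n))).
apply: le_trans (ler_normD _ _) _.
have h : `|ev f (s n)| <= `|C| / 2 ^+ n.
  apply: le_trans (hC _) _; apply: le_trans (ler_wpM2r _ (ler_norm C)) _.
    exact: (even_sublinear_ge0 (dp_sq P) (@dp_qN R P)).
  by rewrite ler_wpM2l.
apply: le_trans (lerD (hF f n) h) _.
by rewrite le_eqVlt; apply/orP; left; apply/eqP; ring.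
Qed.

Lemma ball_near_bikernel (r : R) : ball_approx P -> exists K, 0 <= K /\
  forall x, q x <= r -> exists F, F \in bikernel_pred /\
    forall f, `|ev f x - F f| <= K * D f.
Proof.
move=> /unit_ball_near_bikernel[K [K0 hK]].
pose n := (Num.truncn r).+1; have rn : r < n%:R := truncnS_gt r.
exists (K * n%:R); split; first by rewrite mulr_ge0.
move=> x qx; have [|F [FV hF]] := hK (n%:R^-1 *: x).
  by rewrite (sublinear_div (dp_sq P))// ler_pdivrMr// mul1r (le_trans qx)// ltW.
exists (n%:R *: F); split; first by rewrite rpredZ.
move=> f; have E : ev f x = n%:R * ev f (n%:R^-1 *: x).
  rewrite (morphDZ (dp_evD f)) fmorphV/= ratr_nat mulrA divff ?mul1r//.
  by rewrite pnatr_eq0.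
rewrite E -[(n%:R *: F) f]/(n%:R * F f : R) -mulrBr normrM normr_nat.
by rewrite mulrAC [leRHS]mulrC ler_wpM2l.
Qed.

End Bidual.

(** * Coarse kernels *)

Section CoarseKernel.
Context (R : realType) (P : dualPair R).
Local Notation X := (dp_X P).
Local Notation p := (@dp_p R P).
Local Notation q := (@dp_q R P).
Local Notation Phi := (dp_Phi P).
Local Notation D := (dp_D P).
Local Notation ev := (@dp_ev R P).
Context (Y : Type) (dX : X -> X -> R) (dY : Y -> Y -> R) (iota : X -> Y).
Hypotheses (dXE : forall x y, dX x y = p (x - y))
  (dYE : forall x y, dY (iota x) (iota y) = q (x - y)).
Implicit Types (x y : X) (f g : Phi) (A : set X).

Let sp := dp_sp P.
Let sq := dp_sq P.
Let pN := @dp_pN R P.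
Let qN := @dp_qN R P.
Let p0 x : 0 <= p x. Proof. exact: (even_sublinear_ge0 sp pN). Qed.
Let q0 x : 0 <= q x. Proof. exact: (even_sublinear_ge0 sq qN). Qed.

Lemma ball_bounded_subset r : bounded_subset dY (iota @` [set x | q x <= r]).
Proof.
exists (r + r) => _ _ [x /= xr <-] [y /= yr <-]; rewrite dYE.
by apply: le_trans (even_sublinearB sq qN _ _) _; exact: lerD.
Qed.

(** As [{0}] has bounded image, [A] has a point at finite distance from 0, from which the bounded
    image of [A] is measured. *)
Lemma coarse_kernel_ball A : coarse_kernel dX dY iota A ->
  exists r, 0 <= r /\ forall a, A a -> q a <= r.
Proof.
move=> [[r1 hr1] hA].
have [|r [r0 hr]] := hA [set 0].
  exists 0 => _ _ [_ -> <-] [_ -> <-]; rewrite dYE subrr (sublinear0 sq)//.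
have [a0 Aa0] := hr 0 erefl; rewrite dXE sub0r pN => pa0.
exists (r + `|r1|); split; first by rewrite addr_ge0.
move=> a Aa; have := hr1 _ _ (imageP iota Aa) (imageP iota Aa0); rewrite dYE => h.
have := even_sublinear_sub sq a a0; have := dp_qp a0; have := ler_norm r1.
lra.
Qed.

Lemma coarse_kernel_near A r : coarse_kernel dX dY iota A ->
  exists K, 0 <= K /\ forall x, q x <= r -> exists2 a, A a & p (x - a) <= K.
Proof.
move=> [_ hA]; have [K [K0 hK]] := hA _ (ball_bounded_subset r).
exists K; split=> // x qx; have [a Aa] := hK x qx.
by rewrite dXE => h; exists a.
Qed.

(** The [q]-ball of radius [2 n], with [n > r], is within [K] of [A], which lies in the ball of
    radius [r]. Dividing by [2 n], each point of the unit ball is within [K] of the ball of radius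
    1/2; iteration reaches arbitrarily small balls. *)
Lemma coarse_kernel_ball_approx A : coarse_kernel dX dY iota A -> ball_approx P.
Proof.
move=> kA; have [r [r0 hr]] := coarse_kernel_ball kA.
pose n := (Num.truncn r).+1; have rn : r < n%:R := truncnS_gt r.
have n0 : (0 < n * 2)%N by rewrite muln_gt0.
have n0' : (0 : R) < (n * 2)%:R by rewrite ltr0n.
have [K [K0 hK]] := coarse_kernel_near (n * 2)%:R kA.
have halving x : q x <= 1 -> exists a, q a <= 2^-1 /\ p (x - a) <= K.
  move=> qx; have [|a Aa pa] := hK (x *+ (n * 2)).
    by rewrite sq.2 -[leRHS]mulr1 ler_wpM2l// ltW.
  exists ((n * 2)%:R^-1 *: a); split.
    rewrite (sublinear_div sq)// ler_pdivrMr// natrM mulrCA mulVf ?mulr1//.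
    by apply: le_trans (hr a Aa) _; exact: ltW.
  have -> : x - (n * 2)%:R^-1 *: a = (n * 2)%:R^-1 *: (x *+ (n * 2) - a).
    by rewrite scalerBr -scaler_nat scalerA mulVf ?scale1r// pnatr_eq0 -lt0n.
  rewrite (sublinear_div sp)// ler_pdivrMr//; apply: le_trans pa _.
  by rewrite ler_peMr// ler1n.
exists (2 * K); split; first by rewrite mulr_ge0.
suff iter k : forall x, q x <= 1 -> exists e, p e <= 2 * K /\ q (x - e) <= (2 ^+ k)^-1.
  move=> x qx e e0; have [k hk] := half_pow_small 1 e0.
  have [y [py qy]] := iter k x qx; exists y; split=> //.
  by apply: le_trans qy _; rewrite -[leLHS]mul1r.
elim: k => [|k IH] x qx.
  exists 0; rewrite (sublinear0 sp) subr0 expr0 invr1; split=> //.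
  by rewrite mulr_ge0.
have [a [qa pa]] := halving x qx.
(* The remainder [a] is doubled back into the unit ball. The bound [2 K] reproduces itself as
   [K + (2 K) / 2]. *)
have [|e [pe qe]] := IH (a *+ 2); first by rewrite sq.2; lra.
exists ((x - a) + 2%:R^-1 *: e); split.
  apply: le_trans (sp.1 _ _) _; rewrite (sublinear_div sp)//.
  have : p e / 2 <= K by rewrite ler_pdivrMr// mulrC.
  lra.
have -> : x - (x - a + 2%:R^-1 *: e) = 2%:R^-1 *: (a *+ 2 - e).
  by rewrite scalerBr -scaler_nat scalerA mulVf// scale1r opprD opprB addrA addrCA subrr addr0.
by rewrite (sublinear_div sq)// exprS invfM mulrC ler_wpM2l.
Qed.

(** A set with bounded image lies in a [q]-ball of radius [n]. If [e] approximates [b / n] up to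
    [1 / n], the point [b - n e] lies in the unit ball, at distance at most [n c] from [b]. *)
Lemma ball_approx_coarse_kernel : ball_approx P ->
  coarse_kernel dX dY iota [set x | q x <= 1].
Proof.
move=> [c [c0 hc]]; split; first exact: ball_bounded_subset.
move=> B [r hr]; have [B0|/set0P[b0 Bb0]] := eqVneq B set0.
  by exists 0; split=> // a; rewrite B0.
pose n := (Num.truncn (q b0 + r)).+1; have rn : q b0 + r < n%:R := truncnS_gt _.
have n0 : (0 : R) < n%:R by rewrite ltr0n.
exists (n%:R * c); split; first by rewrite mulr_ge0.
move=> b Bb; have qb : q b <= n%:R.
  have := hr _ _ (imageP iota Bb) (imageP iota Bb0); rewrite dYE => h.
  have := even_sublinear_sub sq b b0; lra.
have [||e [pe qe]] := hc (n%:R^-1 *: b) _ n%:R^-1.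
- by rewrite (sublinear_div sq)// ler_pdivrMr// mul1r.
- by rewrite invr_gt0.
exists (b - e *+ n) => /=.
  have -> : b - e *+ n = (n%:R^-1 *: b - e) *+ n.
    by rewrite mulrnBl -[(_ *: b) *+ n]scaler_nat scalerA divff ?scale1r// pnatr_eq0.
  by rewrite sq.2 -ler_pdivlMl// mulr1.
by rewrite dXE opprB addrC subrK sp.2 ler_wpM2l// ltW.
Qed.

Lemma coarse_kernel_ex : (exists A, coarse_kernel dX dY iota A) <-> ball_approx P.
Proof.
split=> [[A]|h]; first exact: coarse_kernel_ball_approx.
by eexists; exact: ball_approx_coarse_kernel.
Qed.

Section Isomorphism.
Context (V : zmodType) (nV : V -> R) (E : V -> Phi -> R^o).
Hypotheses (ED : forall v w f, E (v + w) f = E v f + E w f)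
  (EV : forall v, E v \in @bikernel_pred R P)
  (E_surj : forall F, F \in @bikernel_pred R P -> exists v, forall f, E v f = F f)
  (nVE : forall v, nV v = bidual_norm (E v)).

(** Distance in the bidual, where both [X] and [V] live. [V] stays abstract because both [bikernel]
    and the dual of [W(G,N)] are substituted for it. *)
Let apart (K : R) x v := forall f, `|ev f x - E v f| <= K * D f.

Let EB v w f : E (v - w) f = E v f - E w f.
Proof. by apply/eqP; rewrite eq_sym subr_eq -ED subrK. Qed.

Let apart_nV K L x y v w : 0 <= K -> 0 <= L -> apart K x v -> apart L y w ->
  nV (v - w) <= K + L + 2 * p (x - y).
Proof.
move=> K0 L0 h1 h2; rewrite nVE; apply: bidual_norm_le => [|f].
  by rewrite !addr_ge0// mulr_ge0.
rewrite EB; have h3 := dp_ev_le f (x - y); rewrite dp_evB in h3.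
have := h1 f; have := h2 f; move: h3.
have -> : (K + L + 2 * p (x - y)) * D f = K * D f + L * D f + 2 * D f * p (x - y).
  by ring.
rewrite !ler_norml.
move=> /andP[? ?] /andP[? ?] /andP[? ?]; apply/andP; split; lra.
Qed.

Let apart_p K L x y v w : 0 <= K -> 0 <= L -> apart K x v -> apart L y w ->
  p (x - y) <= K + L + nV (v - w).
Proof.
move=> K0 L0 h1 h2.
have n0 : 0 <= nV (v - w).
  rewrite nVE; apply: le_trans (_ : `|E (v - w) 0| <= _) => //.
  have := bikernel_le 0 (EV (v - w)); rewrite seminorm0 mulr0 normr_le0 => /eqP ->.
  rewrite normr0; have [C hC] := bikernel_bounded (EV (v - w)).
  apply: le_trans (_ : `|E (v - w) 0| <= _) => //; apply: ub_le_sup.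
    exists `|C| => _ [g /= gD <-]; apply: le_trans (hC g) _.
    apply: le_trans (ler_wpM2r (seminorm_ge0 _ _) (ler_norm C)) _.
    by rewrite ler_piMr.
  by exists 0 => //=; rewrite seminorm0.
have S0 : 0 <= K + L + nV (v - w) by rewrite !addr_ge0.
apply: (@le_trans _ _ ((K + L + nV (v - w)) / 2)); last by lra.
apply: le_of_ev => // f; rewrite dp_evB.
have h3 := bikernel_le f (EV (v - w)); rewrite -nVE EB in h3.
have := h1 f; have := h2 f; move: h3.
have -> : (K + L + nV (v - w)) * D f = K * D f + L * D f + nV (v - w) * D f by ring.
rewrite !ler_norml.
move=> /andP[? ?] /andP[? ?] /andP[? ?]; apply/andP; split; lra.
Qed.

Let apartD K L x y v w : apart K x v -> apart L y w -> apart (K + L) (x + y) (v + w).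
Proof.
move=> h1 h2 f; rewrite (dp_evD f) ED; have := h1 f; have := h2 f.
rewrite mulrDl !ler_norml => /andP[? ?] /andP[? ?]; apply/andP; split; lra.
Qed.

(** Both maps choose points at bounded distance in the bidual: [ball_near_bikernel] leads from the
    kernel to [V], and [bikernel_near_X] leads back. Since [apart] is additive, they are
    homomorphisms up to a bounded error, and inverse to each other up to closeness. *)
Lemma coarse_kernel_isomorphic A : coarse_kernel dX dY iota A ->
  coarse_subset_isomorphic dX +%R (A `|` [set 0]) (fun u v => nV (u - v)) +%R.
Proof.
move=> kA; have bA := coarse_kernel_ball_approx kA.
set A' := A `|` [set 0].
have [r [r0 hr]] := coarse_kernel_ball kA.
have A'r a : A' a -> q a <= r by move=> [/hr//|->]; rewrite (sublinear0 sq).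
have near s : exists K, 0 <= K /\ forall x, q x <= s -> exists a : A', p (x - val a) <= K.
  have [K [K0 hK]] := coarse_kernel_near s kA; exists K; split=> // x /hK[a Aa pa].
  have A'a : A' a by left.
  by exists (exist _ a (mem_set A'a)).
have memA' (a : A') : A' (val a) by exact: set_mem (valP a).
have [K1 [K10 hK1]] := ball_near_bikernel r bA.
have /choice[phi hphi] : forall a : A', exists v, apart K1 (val a) v.
  move=> a; have [F [FV hF]] := hK1 _ (A'r _ (memA' a)).
  by have [v vF] := E_surj FV; exists v => f; rewrite vF.
have [K2 [K20 hK2]] := near 1.
have /choice[psi hpsi] : forall v, exists a : A', apart (2 * K2 + 1) (val a) v.
  move=> v; have [x [qx hx]] := bikernel_near_X (EV v).
  have [a pa] := hK2 x qx; exists a => f.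
  have h1 := dp_ev_le f (x - val a); rewrite dp_evB in h1.
  have h2 : 2 * D f * p (x - val a) <= 2 * K2 * D f.
    by rewrite -!mulrA ler_wpM2l// mulrC ler_wpM2r// seminorm_ge0.
  have -> : (2 * K2 + 1) * D f = 2 * K2 * D f + D f by ring.
  have := hx f; move: h1; rewrite !ler_norml.
  by move=> /andP[? ?] /andP[? ?]; apply/andP; split; lra.
have K2' : 0 <= 2 * K2 + 1 by rewrite addr_ge0// mulr_ge0.
split.
  have [K3 [K30 hK3]] := near (r + r).
  have /choice[star hstar] : forall ab : A' * A', exists c : A',
      p (val ab.1 + val ab.2 - val c) <= K3.
    move=> [a b]; apply: hK3; apply: le_trans (sq.1 _ _) _.
    by apply: lerD; exact: A'r.
  exists (fun a b => star (a, b)), K3; split=> // a b.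
  by rewrite dXE -opprB pN; exact: hstar (a, b).
move=> star [r3 [r30 hstar]].
exists phi, psi; split.
- split=> [s s0|].
    exists (K1 + K1 + 2 * s); split; first by rewrite !addr_ge0// mulr_ge0.
    move=> a b; rewrite dXE => h; apply: le_trans (apart_nV _ _ (hphi a) (hphi b)) _ => //.
    by rewrite lerD2l ler_wpM2l.
  exists (K1 + (K1 + K1) + 2 * r3) => a b.
  apply: le_trans (apart_nV _ _ (hphi _) (apartD (hphi a) (hphi b))) _ => //.
    by rewrite addr_ge0.
  by rewrite lerD2l ler_wpM2l// -dXE.
- split=> [s s0|].
    exists (2 * K2 + 1 + (2 * K2 + 1) + s); split; first by rewrite addr_ge0// addr_ge0.
    by move=> v w h; rewrite dXE; apply: le_trans (apart_p _ _ (hpsi v) (hpsi w)) _ => //;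
      rewrite lerD2l.
  exists (2 * K2 + 1 + (2 * K2 + 1 + (2 * K2 + 1)) + nV 0 + r3) => v w; rewrite dXE.
  set u := val (psi (v + w)); set a := psi v; set b := psi w.
  have -> : u - val (star a b) =
      (u - (val a + val b)) - (val (star a b) - (val a + val b)) by rewrite opprB subrKA.
  apply: le_trans (even_sublinearB sp pN _ _) _; apply: lerD; last by rewrite -dXE.
  apply: le_trans (apart_p _ _ (hpsi (v + w)) (apartD (hpsi v) (hpsi w))) _ => //.
    by rewrite addr_ge0.
  by rewrite subrr.
- exists (2 * K2 + 1 + K1 + nV 0) => a; rewrite dXE /=.
  by rewrite -[X in nV X](subrr (phi a)); exact: apart_p K2' K10 (hpsi (phi a)) (hphi a).
- exists (K1 + (2 * K2 + 1) + 2 * p 0) => v /=.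
  by rewrite -[X in p X](subrr (val (psi v))); exact: apart_nV K10 K2' (hphi _) (hpsi v).
Qed.

End Isomorphism.
End CoarseKernel.

(** * The dual of the kernel, and the finite-dimensional case *)

Section SeparatingSubspace.
Context (F : fieldType) (n : nat) (U : set 'cV[F]_n).

(** Take a matrix of maximal rank with column space in [U]. A row vector that kills it kills all of
    [U], as appending a column from [U] does not raise the rank; so its left kernel is 0 and its
    columns span everything. *)
Lemma separating_subspace : U 0 ->
  (forall a c d, U c -> U d -> U (a *: c + d)) ->
  (forall u : 'rV_n, (forall c, U c -> u *m c = 0) -> u = 0) ->
  forall c, U c.
Proof.
move=> U0 UP Usep.
pose good r := `[< exists k (M : 'M[F]_(n, k)), (forall d : 'cV_k, U (M *m d)) /\
  \rank M = r >].
have ex : exists r, good r.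
  by exists 0%N; apply/asboolP; exists 0%N, 0; split=> [d|]; rewrite ?mul0mx ?mxrank0.
have ub r : good r -> (r <= n)%N.
  by move=> /asboolP[k [M [_ <-]]]; exact: rank_leq_row.
case: (ex_maxnP ex ub) => r /asboolP[k [M [UM rM]]] rmax.
have ker : kermx M = 0.
  apply/row_matrixP => i; rewrite row0; apply: Usep => c Uc.
  pose B := row_mx M c.
  have UB (d : 'cV_(k + 1)) : U (B *m d).
    rewrite -[d]vsubmxK mul_row_col addrC -[c]scale1r.
    rewrite [dsubmx d]mx11_scalar mul_mx_scalar scale1r.
    exact: UP.
  have rB : (\rank B <= r)%N by apply: rmax; apply/asboolP; exists (k + 1)%N, B.
  have BM : (kermx B <= kermx M)%MS.
    apply/sub_kermxP; have := mulmx_ker B.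
    by rewrite /B mul_mx_row -row_mx0 => /eq_row_mx[].
  have MB : (kermx M <= kermx B)%MS.
    by rewrite -(geq_leqif (mxrank_leqif_sup BM)) !mxrank_ker rM leq_sub2l.
  have := submx_trans (row_sub i _) MB => /sub_kermxP.
  by rewrite /B mul_mx_row -row_mx0 => /eq_row_mx[].
have /row_freeP[B MB] : row_free M by rewrite -kermx_eq0 ker.
by move=> c; rewrite -[c]mul1mx -MB -mulmxA.
Qed.

End SeparatingSubspace.

Section DualNorm.
Context (R : realType) (V : preTopologicalLmodType R) (p : V -> R).
Hypotheses (pZ : forall a v, p (a *: v) = `|a| * p v) (p0 : forall v, 0 <= p v).
Implicit Types (h : dual V) (v : V).

Lemma dual_linear h a u v : val h (a *: u + v) = a * val h u + val h v.
Proof. by have /asboolP[hlin _] := valP h; exact: hlin. Qed.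

Lemma dualD h u v : val h (u + v) = val h u + val h v.
Proof. by have := dual_linear h 1 u v; rewrite scale1r mul1r. Qed.

Lemma dual0 h : val h 0 = 0.
Proof. by apply: (@addrI _ (val h 0)); rewrite -dualD !addr0. Qed.

Lemma dualZ h a u : val h (a *: u) = a * val h u.
Proof. by have := dual_linear h a u 0; rewrite dual0 !addr0. Qed.

Lemma dual_norm_le h C : 0 <= C -> (forall v, `|val h v| <= C * p v) ->
  dual_norm p h <= C.
Proof.
move=> C0 hC; apply: ge_sup.
  by exists `|val h 0|, 0 => //=; rewrite -(scale0r 0) pZ normr0 mul0r.
by move=> _ [v /= pv <-]; apply: le_trans (hC v) _; rewrite ler_piMr.
Qed.

Lemma dual_norm_ub h v : (exists C, forall v, `|val h v| <= C * p v) ->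
  `|val h v| <= dual_norm p h * p v.
Proof.
move=> [C hC]; have [pv0|pv0] := eqVneq (p v) 0.
  by rewrite pv0 mulr0; have := hC v; rewrite pv0 mulr0.
have pv : 0 < p v by rewrite lt_neqAle eq_sym pv0 p0.
rewrite -ler_pdivrMr//; apply: ub_le_sup.
  exists `|C| => _ [u /= pu <-]; apply: le_trans (hC u) _.
  by apply: le_trans (ler_wpM2r (p0 u) (ler_norm C)) _; rewrite ler_piMr.
exists ((p v)^-1 *: v) => /=.
  by rewrite pZ gtr0_norm ?invr_gt0// mulVf.
by rewrite dualZ normrM gtr0_norm ?invr_gt0// mulrC.
Qed.

End DualNorm.

Section DualNormed.
Context (R : realType) (V : normedModType R).

Lemma dual_bounded (h : dual V) : exists C, forall v, `|val h v| <= C * `|v|.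
Proof.
have /asboolP[_ hcont] := valP h.
have := hcont 0; move=> /cvgrPdist_lt/(_ 1 ltr01); rewrite -nbhs_nearE.
move=> /nbhs_ballP[d /= d0 hd]; exists (2 / d) => v.
have [->|v0] := eqVneq v 0; first by rewrite dual0 !normr0 mulr0.
have nv : 0 < `|v| by rewrite normr_gt0.
pose a := d / 2 / `|v|.
have a0 : 0 < a by rewrite !divr_gt0.
have /hd : ball 0 d (a *: v).
  rewrite -ball_normE /= sub0r normrN normrZ gtr0_norm// /a divfK ?gt_eqF//.
  by rewrite ltr_pdivrMr//; lra.
rewrite /= dual0 sub0r normrN dualZ normrM gtr0_norm// -ltr_pdivlMl// mulr1 => /ltW.
have -> : a^-1 = 2 / d * `|v| by rewrite /a; field; rewrite !gt_eqF.
by [].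
Qed.

Lemma bounded_dual (h : V -> R^o) C : scalar h -> (forall v, `|h v| <= C * `|v|) ->
  h \in @dual_pred R V.
Proof.
move=> hlin hC; apply/asboolP; split=> // x; apply/cvgrPdist_lt => e e0.
pose K := `|C| + 1; have K0 : 0 < K by rewrite ltr_wpDl.
apply/nbhs_ballP; exists (e / K) => /=; first by rewrite divr_gt0.
move=> y; rewrite -ball_normE /= => xy.
have -> : h x - h y = h (x - y).
  by have := hlin (-1) y x; rewrite scaleN1r mulN1r (addrC (- y)) => ->; exact: addrC.
apply: le_lt_trans (hC _) _; apply: (@le_lt_trans _ _ (K * `|x - y|)).
  by rewrite ler_wpM2r// /K; have := ler_norm C; lra.
by rewrite mulrC -ltr_pdivlMr.
Qed.

End DualNormed.

Section BikernelDual.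
Context (R : realType) (P : dualPair R).
Hypothesis hP : ball_approx P.
Local Notation X := (dp_X P).
Local Notation p := (@dp_p R P).
Local Notation Phi := (dp_Phi P).
Local Notation D := (dp_D P).
Local Notation I := (dp_I P).
Local Notation ev := (@dp_ev R P).
Local Notation V := (bikernel P).
Local Notation W := (snquot D I).
Implicit Types (x y : X) (f g : Phi).

Let D0 f : 0 <= D f. Proof. exact: seminorm_ge0. Qed.
Let p0 x : 0 <= p x. Proof. exact: (even_sublinear_ge0 (dp_sp P) (@dp_pN R P)). Qed.

(** Points of the [q]-unit ball are at bounded distance from elements of [bikernel], which are 0 at
    [f]; so [f] is [q]-bounded. *)
Lemma bikernel_separates f : (forall F : V, val F f = 0) -> f \in I.
Proof.
move=> f0; have [K [K0 hK]] := unit_ball_near_bikernel hP.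
apply/dp_I_unit_ball; exists (K * D f) => x /hK[F [FV hF]].
have Ff : F f = 0 := f0 (exist _ F FV).
by have := hF f; rewrite Ff subr0.
Qed.

Lemma bikernel_val_le (F : V) f : `|val F f| <= `|F| * D f.
Proof. exact: bikernel_le (bikernel_mem F). Qed.

(* Hahn-Banach on X * V, normed as a subspace of the bidual. *)
Lemma bikernel_represent (h : V -> R) (M : R) : 0 <= M ->
  {morph h : F H / F + H} -> (forall F, `|h F| <= M * `|F|) ->
  exists f, D f <= M /\ forall F : V, val F f = h F.
Proof.
move=> M0 hD hM.
pose E (u : X * V) : Phi -> R^o := fun f => ev f u.1 + val u.2 f.
have ED u v f : E (u + v) f = E u f + E v f.
  rewrite -[LHS]/(ev f (u.1 + v.1) + (val u.2 f + val v.2 f) : R) (dp_evD f).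
  exact: addrACA.
have EZ u a f : E u (a *: f) = a * E u f.
  by rewrite /E dp_evZl (bikernelZ _ _ (bikernel_mem u.2)) mulrDr.
have Ebnd u : exists C, forall f, `|E u f| <= C * D f.
  exists (2 * p u.1 + `|u.2|) => f; apply: le_trans (ler_normD _ _) _.
  rewrite mulrDl; apply: lerD; last exact: bikernel_val_le.
  by apply: le_trans (dp_ev_le _ _) _; rewrite mulrAC.
have Ele u f : `|E u f| <= bidual_norm (E u) * D f.
  by have [C hC] := Ebnd u; apply: bidual_norm_ub hC => a g; exact: EZ.
have En0 u : 0 <= bidual_norm (E u).
  have [C hC] := Ebnd u; apply: le_trans (_ : `|E u 0| <= _) => //.
  apply: ub_le_sup; last by exists 0 => //=; rewrite seminorm0.
  exists `|C| => _ [g /= gD <-]; apply: le_trans (hC g) _.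
  by apply: le_trans (ler_wpM2r (D0 g) (ler_norm C)) _; rewrite ler_piMr.
pose pr u := M * bidual_norm (E u).
have EMn u n f : E (u *+ n) f = n%:R * E u f.
  elim: n => [|n IH].
    by rewrite mulr0n mul0r; apply: (@addrI _ (E 0 f)); rewrite -ED !addr0.
  by rewrite mulrS ED IH -nat1r mulrDl mul1r.
have spr : sublinear pr.
  split=> [u v|n u]; rewrite /pr.
    rewrite -mulrDr ler_wpM2l//; apply: bidual_norm_le => [|f]; first by rewrite addr_ge0.
    by rewrite ED mulrDl; apply: le_trans (ler_normD _ _) _; exact: lerD.
  rewrite mulrCA; congr *%R; apply/eqP; rewrite eq_le; apply/andP; split.
    apply: bidual_norm_le => [|f]; first by rewrite mulr_ge0.
    by rewrite EMn normrM normr_nat -mulrA ler_wpM2l.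
  case: n => [|n]; first by rewrite mul0r.
  rewrite -ler_pdivlMl//; apply: bidual_norm_le => [|f]; first by rewrite mulr_ge0 ?invr_ge0.
  have -> : E u f = n.+1%:R^-1 * E (u *+ n.+1) f by rewrite EMn mulKf// pnatr_eq0.
  by rewrite normrM normfV normr_nat -mulrA ler_wpM2l ?invr_ge0.
have prN u : pr (- u) = pr u.
  have EN f : E (- u) f = - E u f.
    apply: (@addrI _ (E u f)); rewrite -ED !subrr.
    by apply: (@addrI _ (E 0 f)); rewrite -ED !addr0.
  rewrite /pr; congr (M * sup _); apply/seteqP.
  by split=> _ [f /= fD <-]; exists f => //; rewrite EN normrN.
have prV (F : V) : pr (0, F) = M * `|F|.
  rewrite /pr; congr (M * _); congr bidual_norm; apply/funext => f.
  by rewrite /E /= (morphD0 (dp_evD f)) add0r.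
have prX x : pr (x, 0) <= M * (2 * p x).
  rewrite /pr ler_wpM2l//; apply: bidual_norm_le => [|f]; first by rewrite mulr_ge0.
  rewrite /E /= addr0; apply: le_trans (dp_ev_le _ _) _.
  by rewrite mulrAC.
pose s (F : V) : X * V := (0, F).
have sD : {morph s : F H / F + H}.
  by move=> F H; rewrite /s -[RHS]/(0 + 0, F + H) addr0.
have hle F : h F <= pr (s F) by rewrite prV; exact: le_trans (ler_norm _) (hM F).
have [L [LD Lp Ls]] := hahn_banach sD hD spr hle.
have L0 : L 0 = 0 by apply: (@addrI _ (L 0)); rewrite -LD !addr0.
have LN u : L (- u) = - L u by apply: (@addrI _ (L u)); rewrite -LD !subrr.
have Labs u : `|L u| <= pr u.
  by rewrite ler_norml Lp andbT lerNl -LN -prN Lp.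
(* The bidual norm of [x] is at most [2 p x], so [g] is bounded by [2 M p] and is represented by
   some [f] with [D f <= M]. *)
pose g x := L (x, 0).
have gD : {morph g : x y / x + y}.
  by move=> x y; rewrite /g -LD; congr L; rewrite -[RHS]/(x + y, 0 + 0) addr0.
have [x|f [fD fg]] := @dp_rep R P g M M0 gD.
  by apply: le_trans (Labs _) _; apply: le_trans (prX x) _; rewrite mulrA (mulrC M).
exists f; split=> // F; apply/eqP; rewrite -subr_eq0 -normr_le0.
apply/ler_addgt0Pr => e e0; rewrite add0r.
have K0 : 0 < D f + M + 1 by rewrite ltr_wpDl// addr_ge0.
have [x hx] := bikernel_approx (bikernel_mem F) (divr_gt0 e0 K0).
(* [x] approximates [F] in the bidual, so [(- x, F)] has small norm and [h F] is close to
   [ev f x]. *)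
have h1 : `|L (- x, F)| <= M * (e / (D f + M + 1)).
  apply: le_trans (Labs _) _; rewrite /pr ler_wpM2l//.
  apply: bidual_norm_le => [|k]; first by rewrite divr_ge0// ltW.
  by rewrite /E /= (morphDN (dp_evD k)) addrC; exact: hx.
have E1 : val F f - h F = (val F f - ev f x) - L (- x, F).
  have -> : (- x, F) = - (x, 0) + s F.
    by rewrite /s -[RHS]/(- x + 0, - 0 + F) oppr0 addr0 add0r.
  by rewrite LD LN Ls fg /g; ring.
rewrite E1; apply: le_trans (ler_normB _ _) _; apply: le_trans (lerD (hx f) h1) _.
have -> : e / (D f + M + 1) * D f + M * (e / (D f + M + 1)) =
  e * ((D f + M) / (D f + M + 1)) by ring.
by apply: ler_piMr; [exact: ltW|rewrite ler_pdivrMr//; lra].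
Qed.

Lemma dual_bikernel_le (h : dual V) (F : V) :
  `|val h F| <= dual_norm (@Num.norm R V) h * `|F|.
Proof. by apply: dual_norm_ub => [a v||]; [exact: normrZ| |exact: dual_bounded]. Qed.

Lemma dual_bikernel_norm_ge0 (h : dual V) : 0 <= dual_norm (@Num.norm R V) h.
Proof.
have [C hC] := dual_bounded h.
apply: le_trans (_ : `|val h 0| <= _) => //; apply: ub_le_sup.
  exists `|C| => _ [v /= pv <-]; apply: le_trans (hC v) _.
  by apply: le_trans (ler_wpM2r (normr_ge0 v) (ler_norm C)) _; rewrite ler_piMr.
by exists 0 => //=; rewrite normr0.
Qed.

Lemma dual_bikernel_ex (h : dual V) : exists f,
  D f <= dual_norm (@Num.norm R V) h /\ forall F : V, val F f = val h F.
Proof.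
apply: bikernel_represent; first exact: dual_bikernel_norm_ge0.
  by move=> F H; exact: dualD.
exact: dual_bikernel_le.
Qed.

Definition dual_rep (h : dual V) : Phi := sval (cid (dual_bikernel_ex h)).

Lemma dual_rep_le h : D (dual_rep h) <= dual_norm (@Num.norm R V) h.
Proof. by rewrite /dual_rep; case: cid => f []. Qed.

Lemma dual_repE h (F : V) : val F (dual_rep h) = val h F.
Proof. by rewrite /dual_rep; case: cid => f []. Qed.

Definition dual_to_quotient (h : dual V) : W := snproj D I (dual_rep h).

(** Two representatives of [h] differ by an element on which [bikernel] vanishes, hence by an
    element of [I]; the arbitrary choice in [dual_rep] disappears in the quotient. *)
Lemma dual_to_quotient_eq h f : (forall F : V, val F f = val h F) ->
  dual_to_quotient h = snproj D I f.
Proof.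
move=> hf; apply/qprojP; apply: bikernel_separates => F.
by rewrite (bikernelB _ _ (bikernel_mem F)) dual_repE hf subrr.
Qed.

Lemma dual_to_quotient_linear : linear dual_to_quotient.
Proof.
move=> a h k; rewrite (@dual_to_quotient_eq _ (a *: dual_rep h + dual_rep k)).
  by rewrite linearP.
by move=> F; rewrite (bikernel_linear _ _ _ (bikernel_mem F)) !dual_repE.
Qed.

Lemma quotient_eq_bikernel f g : snproj D I f = snproj D I g ->
  forall F : V, val F f = val F g.
Proof.
move=> /qprojP fgI F; apply/eqP; rewrite -subr_eq0.
by rewrite -(bikernelB _ _ (bikernel_mem F)) (bikernel_I (bikernel_mem F) fgI).
Qed.

Lemma dual_bikernel_isometry :
  isometrically_isomorphic (@dual_norm R V Num.norm) (quotient_seminorm D I).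
Proof.
pose T : {linear dual V -> W} :=
  HB.pack dual_to_quotient (GRing.isLinear.Build R _ _ _ _ dual_to_quotient_linear).
exists T; split=> [|h]; last first.
  apply/eqP; rewrite eq_le; apply/andP; split.
    by apply: le_trans (qnorm_le _ _ _) _; exact: dual_rep_le.
  (* Every element of the class represents [h], so none has [D] below the norm of [h]. *)
  apply: qnorm_ge => f /esym Tf; apply: dual_norm_le => //; first exact: normrZ.
  move=> F; rewrite -dual_repE (quotient_eq_bikernel Tf) mulrC.
  exact: bikernel_val_le.
have gD (w : W) : (fun F : V => val F (repr (w : qmod I)) : R^o) \in @dual_pred R V.
  apply: (@bounded_dual _ _ _ (D (repr (w : qmod I)))) => [a F H //|F].
  by rewrite mulrC; exact: bikernel_val_le.
pose g (w : W) : dual V := exist (fun h => h \in @dual_pred R V) _ (gD w).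
exists g => [h|w].
  apply/val_inj/funext => F; rewrite -[RHS]dual_repE.
  apply: (@quotient_eq_bikernel (repr (dual_to_quotient h : qmod I)) (dual_rep h) _ F).
  exact: qprojK.
rewrite -[T _]/(dual_to_quotient _) (@dual_to_quotient_eq _ (repr (w : qmod I)))//.
exact: qprojK.
Qed.

(* The evaluations at elements of V separate the points of W. *)
Lemma findim_bikernel_surj (h : W -> R) : finite_dimensional W -> scalar h ->
  exists F : V, forall f, val F f = h (snproj D I f).
Proof.
move=> [n [[v2r v2r_lin [r2v v2rK r2vK]]]] hlin.
have vD : {morph v2r : u v / u + v}.
  by move=> u v; have := v2r_lin 1 u v; rewrite !scale1r.
have v0 : v2r 0 = 0 by apply: (@addrI _ (v2r 0)); rewrite -vD !addr0.
have vZ a u : v2r (a *: u) = a *: v2r u.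
  by have := v2r_lin a u 0; rewrite v0 !addr0.
pose e i : Phi := repr (r2v (delta_mx 0 i) : qmod I).
have eE i : snproj D I (e i) = r2v (delta_mx 0 i) by exact: qprojK.
have basis (l : W -> R) : scalar l -> forall w,
    l w = (v2r w *m (\col_i l (r2v (delta_mx 0 i)) : 'cV[R]_n)) 0 0.
  move=> ll w.
  have lD : {morph l : u v / u + v}.
    by move=> u v; have := ll 1 u v; rewrite scale1r mul1r.
  have l0 : l 0 = 0 by apply: (@addrI _ (l 0)); rewrite -lD !addr0.
  have lZ a u : l (a *: u) = a * l u by have := ll a u 0; rewrite l0 !addr0.
  have wE : w = \sum_i v2r w 0 i *: r2v (delta_mx 0 i).
    rewrite -[LHS]v2rK -[RHS]v2rK; congr r2v.
    rewrite (big_morph _ vD v0) {1}[v2r w]row_sum_delta.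
    by apply: eq_bigr => i _; rewrite vZ r2vK.
  rewrite mxE {1}wE (big_morph _ lD l0).
  by apply: eq_bigr => i _; rewrite lZ mxE.
have lin_val (F : V) : scalar (fun w : W => val F (repr (w : qmod I))).
  move=> a u v; rewrite -(bikernel_linear _ _ _ (bikernel_mem F)).
  apply: quotient_eq_bikernel; rewrite linearP.
  by rewrite [LHS]qprojK; congr (_ *: _ + _); rewrite [RHS]qprojK.
pose col (F : V) : 'cV[R]_n := \col_i val F (repr (r2v (delta_mx 0 i) : qmod I)).
have colE (F : V) f : val F f = (v2r (snproj D I f) *m col F) 0 0.
  rewrite -(basis _ (lin_val F)); apply: quotient_eq_bikernel.
  by rewrite [RHS]qprojK.
pose U : set 'cV[R]_n := range col.
have Uall : forall c, U c.
  apply: separating_subspace.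
  - exists 0 => //; apply/colP => i; rewrite !mxE //.
  - move=> a _ _ [F _ <-] [H _ <-]; exists (a *: F + H) => //.
    by apply/colP => i; rewrite !mxE.
  - move=> u hu; rewrite -[u]r2vK -v0; congr v2r.
    have : snproj D I (repr (r2v u : qmod I)) = snproj D I 0.
      apply/qprojP; rewrite subr0; apply: bikernel_separates => F.
      rewrite colE; have -> : snproj D I (repr (r2v u : qmod I)) = r2v u by exact: qprojK.
      by rewrite r2vK hu ?mxE//; exists F.
    by rewrite linear0 => <-; rewrite [RHS]qprojK.
have [F _ Fc] := Uall (\col_i h (r2v (delta_mx 0 i))).
by exists F => f; rewrite colE Fc -(basis _ hlin).
Qed.

Definition quotient_eval (h : dual W) : Phi -> R^o := fun f => val h (snproj D I f).

Lemma quotient_eval_bikernel (h : dual W) : finite_dimensional W ->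
  quotient_eval h \in @bikernel_pred R P.
Proof.
move=> fW; have /asboolP[hlin _] := valP h.
have [F hF] := findim_bikernel_surj fW hlin.
by rewrite (_ : quotient_eval h = val F) ?bikernel_mem//; apply/funext => f; rewrite hF.
Qed.

(** [F] is constant on classes modulo [I], so its bound by [D] passes to the infimum over the
    class. *)
Lemma bikernel_qnorm_le F f : F \in @bikernel_pred R P ->
  `|F f| <= bidual_norm F * qnorm (snproj D I f).
Proof.
move=> FV; pose H : V := exist _ F FV.
have F0 : 0 <= bidual_norm F by exact: (bikernel_norm_ge0 H).
have [F00|F00] := eqVneq (bidual_norm F) 0.
  by have := bikernel_le f FV; rewrite F00 !mul0r.
have Fp : 0 < bidual_norm F by rewrite lt_neqAle eq_sym F00.
rewrite mulrC -ler_pdivrMr//; apply: qnorm_ge => g gf.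
rewrite ler_pdivrMr// mulrC -[F f](quotient_eq_bikernel gf H).
exact: bikernel_le.
Qed.

Lemma quotient_eval_surj F : F \in @bikernel_pred R P ->
  exists h, forall f, quotient_eval h f = F f.
Proof.
move=> FV; pose H : V := exist _ F FV.
have hE f : F (repr (snproj D I f : qmod I)) = F f.
  by apply: (quotient_eq_bikernel _ H); exact: qprojK.
have hD : (fun w : W => F (repr (w : qmod I)) : R^o) \in @dual_pred R W.
  apply/asboolP; split.
    move=> a u v; rewrite -(bikernel_linear _ _ _ FV).
    apply: (quotient_eq_bikernel _ H); rewrite linearP.
    by rewrite [LHS]qprojK; congr (_ *: _ + _); rewrite [RHS]qprojK.
  move=> w A /nbhs_ballP[e /= e0 hA].
  pose K := bidual_norm F + 1.
  have F0 : 0 <= bidual_norm F by exact: (bikernel_norm_ge0 H).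
  have K0 : 0 < K by rewrite ltr_wpDl.
  exists [set z : W * W | qball z.1 (e / K) z.2].
    by exists (e / K) => /=; first exact: divr_gt0.
  move=> v /xsectionP; rewrite /qball /= => wv.
  apply: hA; rewrite /ball /= -(bikernelB _ _ FV).
  apply: le_lt_trans (bikernel_qnorm_le _ FV) _.
  have -> : snproj D I (repr (w : qmod I) - repr (v : qmod I)) = w - v.
    by rewrite linearB; congr (_ - _); exact: qprojK.
  apply: (@le_lt_trans _ _ (K * qnorm (w - v))).
    by rewrite ler_wpM2r ?(seminorm_ge0 (quotient_seminorm D I))// lerDl.
  by rewrite mulrC -ltr_pdivlMr.
by exists (exist (fun h => h \in @dual_pred R W) _ hD) => f; exact: hE.
Qed.

Lemma quotient_eval_norm (h : dual W) : quotient_eval h \in @bikernel_pred R P ->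
  dual_norm (quotient_seminorm D I) h = bidual_norm (quotient_eval h).
Proof.
move=> hV; have b0 : 0 <= bidual_norm (quotient_eval h).
  exact: (bikernel_norm_ge0 (exist (fun F => F \in @bikernel_pred R P) _ hV)).
have qle w : `|val h w| <= bidual_norm (quotient_eval h) * qnorm w.
  rewrite -[w](qprojK (w : qmod I)); exact: bikernel_qnorm_le hV.
apply/eqP; rewrite eq_le; apply/andP; split.
  by apply: dual_norm_le => //; exact: (seminormZ (quotient_seminorm D I)).
have ub w : `|val h w| <= dual_norm (quotient_seminorm D I) h * qnorm w.
  apply: dual_norm_ub; [exact: (seminormZ (quotient_seminorm D I))| |].
    exact: (seminorm_ge0 (quotient_seminorm D I)).
  by exists (bidual_norm (quotient_eval h)).
have d0 : 0 <= dual_norm (quotient_seminorm D I) h.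
  apply: le_trans (_ : `|val h 0| <= _) => //; apply: ub_le_sup; last first.
    by exists 0 => //=; rewrite [X in X <= _](seminorm0 (quotient_seminorm D I)).
  exists (bidual_norm (quotient_eval h)) => _ [w /= hw <-].
  by apply: le_trans (qle w) _; rewrite ler_piMr.
apply: bidual_norm_le => // f; apply: le_trans (ub _) _.
by rewrite ler_wpM2l// qnorm_le.
Qed.

End BikernelDual.

(** * The case of stable mixed commutator length *)

Section Homogeneity.
Context (R : realType) (H : groupType).

Lemma homogeneous_pow (f : H -> R^o) : (forall x n, f (x ^+ n)%g = n%:R * f x) ->
  (forall x, f (x^-1)%g = - f x) -> homogeneous f.
Proof.
move=> fX fV h x y.
have fXV n : f (h ^- n)%g = - (n%:R * f h) by rewrite fV fX.
have diff m n : f (h ^+ m * h ^- n)%g = m%:R * f h - n%:R * f h.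
  rewrite -mulrBl; case: (leqP n m) => [nm|/ltnW mn].
    by rewrite -expgnFr// fX natrB.
  have -> : (h ^+ m * h ^- n)%g = (h ^- (n - m))%g.
    by rewrite expgnFr// invgF.
  by rewrite fXV natrB// -mulNr opprB.
have comm m n : (h ^- m * h ^+ n = h ^+ n * h ^- m)%g.
  by apply/commute_sym/commuteV/commuteX2/commute_refl.
move=> [m [->|->]] [n [->|->]].
- by rewrite -expgnDr !fX natrD mulrDl.
- by rewrite diff fX fXV.
- by rewrite comm diff fX fXV addrC.
- by rewrite -invgM -expgnDr !fXV natrD mulrDl opprD addrC.
Qed.

Lemma hqm_of_inv_hqm (phi : H -> R) (C : R) : inv_hqm predT C phi ->
  exists f : hqm R H, val f = phi /\ defect (val f) <= C.
Proof.
move=> hphi; have [h1 h2 h3] := hphi.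
have gT : group_closed (predT : {pred H}) by [].
have fP : (phi : H -> R^o) \in @hqm_pred R H.
  apply/asboolP; split; first by apply/quasimorphismP; exists C => x y; exact: h1.
  apply: homogeneous_pow => [x n|x]; first exact: h2.
  exact: (inv_hqmV gT hphi).
exists (exist (fun f => f \in @hqm_pred R H) _ fP); split=> //.
by apply: defect_le => x y; exact: h1.
Qed.

Lemma inv_hqm_of_hqm (f : hqm R H) : inv_hqm predT (defect (val f)) (val f).
Proof.
split=> [x y _ _|x n _|x g _]; [exact/defect_ub/hqm_qm|exact: hqmX|exact: hqm_conj].
Qed.

End Homogeneity.

Section Restriction.
Context (R : realType) (G : groupType) (N : groupClosed G).
Hypothesis nN : forall x g : G, x \in N -> (x ^ g)%g \in N.
Implicit Types (f : ihqm R N) (x y g : G) (u v : subgroup N).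

Lemma groupClosed_closed : group_closed (N : {pred G}).
Proof. by split; [exact: gpred1|move=> x y xN yN; rewrite gpredF]. Qed.

(** The value 0 outside [N] is a default, never seen by chains supported in [N]. *)
Definition extend f x : R := oapp (fun u : subgroup N => val (val f) u) 0 (insub x).

Lemma extend_val f u : extend f (val u) = val (val f) u.
Proof. by rewrite /extend valK. Qed.

Lemma extend_lin (a : R) f h x : extend (a *: f + h) x = a * extend f x + extend h x.
Proof.
by rewrite /extend; case: insubP => [u _ _|_] //=; rewrite mulr0 addr0.
Qed.

Lemma subgroupP x : x \in N -> exists u : subgroup N, val u = x.
Proof. by move=> xN; exists (exist (fun x => x \in N) x xN). Qed.

Lemma val_subgroupX u n : val (u ^+ n)%g = (val u ^+ n)%g.
Proof. by elim: n => [|n IH]; rewrite ?expg0 ?val1// !expgS valM IH. Qed.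

Lemma extend_inv_hqm f : inv_hqm N (ihqm_defect R N f) (extend f).
Proof.
have /asboolP fG := valP f; split=> [x y|x n|x g].
- move=> /subgroupP[u <-] /subgroupP[v <-]; rewrite -(valM u v) !extend_val.
  exact/defect_ub/hqm_qm.
- by move=> /subgroupP[u <-]; rewrite -val_subgroupX !extend_val hqmX.
- move=> xN; have /subgroupP[v vE] := nN g xN; have [u uE] := subgroupP xN.
  by rewrite -vE -uE !extend_val; apply: (fG g); rewrite vE uE.
Qed.

Lemma ihqm_of_inv_hqm (phi : G -> R) (C : R) : inv_hqm N C phi ->
  exists f, ihqm_defect R N f <= C /\ forall x, x \in N -> extend f x = phi x.
Proof.
move=> hphi; have [h1 h2 h3] := hphi.
have fP : (fun u : subgroup N => phi (val u) : R^o) \in @hqm_pred R (subgroup N).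
  apply/asboolP; split.
    by apply/quasimorphismP; exists C => u v; rewrite valM; apply: h1; exact: valP.
  apply: homogeneous_pow => [u n|u]; first by rewrite val_subgroupX h2//; exact: valP.
  have -> : val (u^-1)%g = ((val u)^-1)%g by [].
  by apply: (inv_hqmV groupClosed_closed hphi); exact: valP.
pose f0 : hqm R (subgroup N) := exist (fun k => k \in @hqm_pred R (subgroup N)) _ fP.
have f0P : f0 \in @inv_pred R G N.
  by apply/asboolP => g u v /= ->; apply: h3; exact: (valP u).
exists (exist (fun k => k \in @inv_pred R G N) _ f0P); split.
  by apply: defect_le => u v; exact: (h1 (val u) (val v) (valP u) (valP v)).
by move=> x /subgroupP[u <-]; rewrite extend_val.
Qed.

Lemma extend_restrict (k : hqm R G) x : x \in N -> extend (@Defs.restrict R G N k) x = val k x.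
Proof. by move=> /subgroupP[u <-]; rewrite extend_val. Qed.

Lemma ihom_extend f : f \in @ihom_pred R G N <-> forall x y, x \in N -> y \in N ->
  extend f (x * y)%g = extend f x + extend f y.
Proof.
split=> [/asboolP h x y /subgroupP[u <-] /subgroupP[v <-]|h].
  by rewrite -(valM u v) !extend_val h.
by apply/asboolP => u v; rewrite -!extend_val valM h//; exact: valP.
Qed.

Lemma ihom_defect f : f \in @ihom_pred R G N -> ihqm_defect R N f = 0.
Proof.
move=> /asboolP h; apply/eqP; rewrite eq_le seminorm_ge0 andbT.
by apply: defect_le => u v; rewrite h [X in `|X|](_ : _ = 0) ?normr0//; ring.
Qed.

End Restriction.

Section MixedSeminorm.
Context (R : realType) (G : groupType) (N : {pred G}).
Hypotheses (gN : group_closed N) (nN : forall x g, x \in N -> (x ^ g)%g \in N).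
Implicit Types c d : rat_chains N.

Definition scl_norm c : R := scl_rat R N (val c).

Lemma rat_chains_mixed c : mixed_chains N (val c).
Proof. exact/asboolP/(valP c). Qed.

Lemma scl_norm_sublinear : sublinear scl_norm.
Proof.
split=> [c d|n c].
  exact: (scl_ratD gN nN R (rat_chains_mixed c) (rat_chains_mixed d)).
rewrite /scl_norm (_ : val (c *+ n) = val c *+ n); last exact: raddfMn.
exact: (scl_ratMn gN nN R n (rat_chains_mixed c)).
Qed.

Lemma scl_normN c : scl_norm (- c) = scl_norm c.
Proof. exact: (scl_ratN gN nN R (rat_chains_mixed c)). Qed.

Lemma rat_chains_duality (f : rat_chains N -> R) (C : R) : 0 <= C ->
  {morph f : c d / c + d} -> (forall c, `|f c| <= 2 * C * scl_norm c) ->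
  exists phi, inv_hqm N C phi /\ forall c, ev phi (val c) = f c.
Proof.
move=> C0 fD fC; pose h (c : {freeg G / rat}) : R := oapp f 0 (insub c).
have hE c : h (val c) = f c by rewrite /h valK.
have lift (c : {freeg G / rat}) : mixed_chains N c -> exists c' : rat_chains N, val c' = c.
  by move=> cN; exists (exist (fun e => e \in rat_chains_pred N) c (asboolT cN)).
have [||phi [hphi phiE]] := mixed_duality gN nN (f := h) (C := C) _ _ C0.
- move=> _ _ /lift[c <-] /lift[d <-].
  by rewrite -[val c + val d]/(val (c + d)) !hE.
- by move=> _ /lift[c <-]; rewrite hE; exact: fC.
- by exists phi; split=> // c; rewrite phiE ?hE//; exact: rat_chains_mixed.
Qed.

End MixedSeminorm.

Section MixedDualPair.
Context (R : realType) (G : groupType) (N : groupClosed G).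
Hypothesis nN : forall x g : G, x \in N -> (x ^ g)%g \in N.
Local Notation X := (rat_chains N).
Local Notation T := (predT : {pred G}).
Local Notation p := (@scl_norm R G N).
Local Notation Phi := (ihqm R N).
Local Notation D := (ihqm_defect R N).
Local Notation I := (@ihom_restrict_pred R G N).
Implicit Types (c d : X) (f : Phi).

Let gN := groupClosed_closed N.
Let gT : group_closed T. Proof. by []. Qed.
Let nT x g : x \in T -> (x ^ g)%g \in T. Proof. by []. Qed.

Let q c : R := scl_norm R (iotaQ c).
Let pair f c : R := ev (extend f) (val c).

Let iotaD c d : iotaQ (c + d) = iotaQ c + iotaQ d.
Proof. exact: val_inj. Qed.

Let iotaMn c n : iotaQ (c *+ n) = iotaQ c *+ n.
Proof.
apply: val_inj; rewrite [RHS]raddfMn /=.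
by rewrite -[LHS]/(val (c *+ n)) raddfMn.
Qed.

Let sp : sublinear p := scl_norm_sublinear R gN nN.
Let pN c : p (- c) = p c. Proof. exact: scl_normN. Qed.
Let sT : sublinear (@scl_norm R G T) := scl_norm_sublinear R gT nT.

Let sq : sublinear q.
Proof.
by split=> [c d|n c]; rewrite /q ?iotaD ?iotaMn; [exact: sT.1|exact: sT.2].
Qed.

Let qN c : q (- c) = q c.
Proof.
rewrite /q (_ : iotaQ (- c) = - iotaQ c); first exact: (scl_normN R gT nT).
exact: val_inj.
Qed.

Let inv_hqm_sub (phi : G -> R) C : inv_hqm T C phi -> inv_hqm N C phi.
Proof. by move=> [h1 h2 h3]; split=> [x y _ _|x n _|x g _]; auto. Qed.

(** By duality rather than by comparing limits: a functional norming [scl_G] at [c] comes from a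
    quasimorphism on [G] of defect at most 1/2, and its restriction to [N] is subject to
    [ev_bound]. *)
Let qp c : q c <= p c.
Proof.
have [h [hD hle hc]] := norming_functional (iotaQ c) sT (scl_normN R gT nT).
have [||phi [hphi phiE]] := rat_chains_duality gT nT (C := 2^-1) _ hD; first by [].
  by move=> d; rewrite divff// mul1r.
have := ev_bound gN nN (inv_hqm_sub hphi) (rat_chains_mixed c).
have E2 : 2 * 2^-1 = 1 :> R by rewrite divff.
rewrite E2 mul1r => hb; apply: le_trans _ hb.
have -> : q c = ev phi (val c) by rewrite -[LHS]hc; exact/esym/(phiE (iotaQ c)).
exact: ler_norm.
Qed.

Let pairD f : {morph pair f : c d / c + d}.
Proof. by move=> c d; exact: evD. Qed.

Let pair_lin (a : R) f h c : pair (a *: f + h) c = a * pair f c + pair h c.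
Proof. by rewrite /pair -ev_lin; congr ev; apply/funext => x; exact: extend_lin. Qed.

Let pair_le f c : `|pair f c| <= 2 * D f * p c.
Proof. exact: (ev_bound gN nN (extend_inv_hqm nN f) (rat_chains_mixed c)). Qed.

Let chains1_mem c : chains1 N (val c).
Proof. by have [] := rat_chains_mixed c. Qed.

Let rep (h : X -> R) (C : R) : 0 <= C -> {morph h : c d / c + d} ->
  (forall c, `|h c| <= 2 * C * p c) -> exists f, D f <= C /\ forall c, pair f c = h c.
Proof.
move=> C0 hD hC; have [phi [hphi phiE]] := rat_chains_duality gN nN C0 hD hC.
have [f [fC fE]] := ihqm_of_inv_hqm hphi.
exists f; split=> // c; rewrite -phiE; apply: eq_ev fE; exact: chains1_mem.
Qed.

Let mulc (u v : G) : u \in N -> v \in N -> exists c : X,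
  [/\ val c = << u >> + << v >> - << (u * v)%g >> & p c <= 2^-1].
Proof.
move=> uN vN; have cN := mixed_chains_mul gN rat uN vN.
exists (exist (fun e => e \in rat_chains_pred N) _ (asboolT cN)); split; first by [].
exact: (scl_rat_mul R gN nN uN vN).
Qed.

Let pair_mulc f u v c : val c = << u >> + << v >> - << (u * v)%g >> ->
  pair f c = extend f u + extend f v - extend f (u * v)%g.
Proof.
move=> cE; have eD := evD (extend f).
by rewrite /pair cE (morphDB eD) eD !ev1.
Qed.

(** Evaluation at [u + v - uv], of norm at most 1/2, recovers the defect. *)
Let D_le f C : 0 <= C -> (forall c, `|pair f c| <= 2 * C * p c) -> D f <= C.
Proof.
move=> C0 fC; apply: defect_le => u v; have [c [cE pc]] := mulc (valP u) (valP v).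
have := fC c; rewrite (pair_mulc f cE) -valM !extend_val => h.
rewrite -normrN; apply: le_trans (_ : 2 * C * p c <= C); last by nra.
by apply: le_trans h; rewrite le_eqVlt; apply/orP; left; apply/eqP; congr `|_|; ring.
Qed.

(** A homomorphism pairs to 0 with mixed chains, and the restriction of [k] is bounded by
    [2 D(k) scl_G]. Conversely, Hahn-Banach extends the pairing to [C_Q(G)], where it comes from a
    quasimorphism on [G]; the restriction of the latter agrees with [f] on the chains [u + v - uv],
    so it differs from [f] by a homomorphism. *)
Let IP f : f \in I <-> exists C, forall c, `|pair f c| <= C * q c.
Proof.
split=> [/asboolP[h [k [hI ->]]]|[C fC]].
  exists (2 * defect (val k)) => c.
  have -> : pair (h + Defs.restrict N k) c = ev (val k) (val c).
    have := pair_lin 1 h (Defs.restrict N k) c; rewrite scale1r mul1r => ->.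
    have -> : pair h c = 0.
      apply/eqP; rewrite -normr_le0; apply: le_trans (pair_le h c) _.
      by rewrite (ihom_defect hI) mulr0 mul0r.
    rewrite add0r; apply: eq_ev (chains1_mem c) _ => x xN.
    exact: extend_restrict.
  exact: (ev_bound gT nT (inv_hqm_of_hqm k) (rat_chains_mixed (iotaQ c))).
pose pr (c : rat_chains T) : R := `|C| * scl_norm R c.
have spr : sublinear pr.
  split=> [c d|n c]; rewrite /pr; last by rewrite sT.2; ring.
  by rewrite -mulrDr ler_wpM2l// sT.1.
have q0 c : 0 <= q c by exact: even_sublinear_ge0 sq qN c.
have fpr c : pair f c <= pr (iotaQ c).
  apply: le_trans (ler_norm _) _; apply: le_trans (fC c) _.
  by rewrite ler_wpM2r// ler_norm.
have [h [hD hle hE]] := hahn_banach iotaD (pairD f) spr fpr.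
have hN (c : rat_chains T) : h (- c) = - h c := morphDN hD c.
have [|c|phi [hphi phiE]] := rat_chains_duality gT nT (C := `|C| / 2) _ hD.
- by rewrite divr_ge0.
- have -> : 2 * (`|C| / 2) * scl_norm R c = pr c by rewrite /pr; field.
  rewrite ler_norml hle andbT lerNl -hN; apply: le_trans (hle _) _.
  by rewrite /pr (scl_normN R gT nT).
have [k [kE _]] := hqm_of_inv_hqm hphi.
apply/asboolP; exists (f - Defs.restrict N k), k; split; last by rewrite subrK.
apply/ihom_extend => u v uN vN.
have ext x : x \in N -> extend (f - Defs.restrict N k) x = extend f x - phi x.
  move=> xN; rewrite addrC -scaleN1r extend_lin mulN1r addrC.
  by rewrite (extend_restrict k xN) kE.
rewrite !ext//; last exact: group_closedM.
have [c [cE _]] := mulc uN vN.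
have : pair f c = ev phi (val c) by rewrite -hE -phiE.
rewrite (pair_mulc f cE) cE; have eD := evD phi.
by rewrite (morphDB eD) eD !ev1 => e; lra.
Qed.

Definition mixed_dualPair : dualPair R :=
  DualPair sp pN sq qN qp pairD pair_lin pair_le rep D_le IP.

End MixedDualPair.

Section ClosedRange.
Context (R : realType) (G : groupType) (N : groupClosed G).
Hypothesis nN : forall x g : G, x \in N -> (x ^ g)%g \in N.
Local Notation D := (ihqm_defect R N).
Local Notation H1 := (@ihom_pred R G N).
Local Notation I := (@ihom_restrict_pred R G N).
Local Notation proj := (snproj D H1).
Implicit Types (f : ihqm R N) (k : hqm R G).

(** Homomorphisms have defect 0, so all elements of a class have the same defect, and closedness can
    be tested in [Q(N)^G]. *)
Lemma qnorm_ihom f : qnorm (proj f) = D f.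
Proof.
apply/eqP; rewrite eq_le qnorm_le /=; apply: qnorm_ge => g /qprojP gf.
have fE : f = g - (g - f) by rewrite subKr.
have := seminormD D g (- (g - f)); rewrite -fE seminormN.
by rewrite (ihom_defect gf) addr0.
Qed.

Lemma restrict_in_ihom_restrict k : Defs.restrict N k \in I.
Proof. by apply/asboolP; exists 0, k; rewrite add0r; split; first exact: rpred0. Qed.

Lemma range_restrict_hat f : range (@restrict_hat R G N) (proj f) <-> f \in I.
Proof.
split=> [[y _ /qprojP h]|/asboolP[h [k [hH ->]]]].
  set k := repr _ in h; apply/asboolP; exists (f - Defs.restrict N k), k.
  by rewrite subrK; split=> //; rewrite -opprB rpredN.
exists (snproj (@hqm_defect R G) (@hom_pred R G) k) => //.
rewrite restrict_hatE; apply/qprojP.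
by rewrite opprD addrA addrAC subrr add0r rpredN.
Qed.

Lemma closed_restrict_hat :
  closed (range (@restrict_hat R G N)) <-> I_closed (mixed_dualPair R nN).
Proof.
split=> [cl f hf|Icl y hy].
  apply/range_restrict_hat; apply: cl => B [i [e /= e0 ei] iB].
  have e2 : 0 < e / 2 by rewrite divr_gt0.
  have [g [gI fg]] := hf _ e2.
  exists (proj g); split; first exact/range_restrict_hat.
  apply: iB; apply/xsectionP; apply: ei => /=; rewrite /qball /=.
  rewrite -raddfB; apply: le_lt_trans (qnorm_le _ _ _) _.
  by apply: le_lt_trans fg _; rewrite ltr_pdivrMr// ltr_pMr// ltr1n.
rewrite -(qprojK (y : qmod H1)); apply/range_restrict_hat.
set f := repr _; apply: Icl => eps eps0.
have nb : nbhs y [set z : ihqm_mod_hom R N | qnorm (p := D) (I := H1) (y - z) < eps].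
  exists [set z : ihqm_mod_hom R N * ihqm_mod_hom R N | qball (p := D) (I := H1) z.1 eps z.2].
    by exists eps.
  by move=> z /xsectionP.
have [z [[w _ wz] yz]] := hy _ nb.
pose k := repr (w : qmod (@hom_pred R G)).
exists (Defs.restrict N k); split; first exact: restrict_in_ihom_restrict.
rewrite -[dp_D _ _]/(D _) -qnorm_ihom linearB /=.
apply: ltW; move: yz; rewrite /= -wz.
by rewrite (_ : proj f = y)//; exact: (qprojK (y : qmod H1)).
Qed.

End ClosedRange.

Theorem theorem2 (R : realType) (G : groupType) (N : groupClosed G)
    (normalN : forall x g : G, x \in N -> (x ^ g)%g \in N) :
  ((exists A : set (rat_chains N), iota_coarse_kernel R A) <->
    closed (range (@restrict_hat R G N))) /\
  (closed (range (@restrict_hat R G N)) ->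
    exists V : normedModType R,
      isometrically_isomorphic (@dual_norm R V Num.norm) (@Wnorm R G N) /\
      forall A : set (rat_chains N), iota_coarse_kernel R A ->
        kernel_coarsely_isomorphic A (@Num.norm R V)) /\
  (finite_dimensional (Wspace R N) ->
    (exists A : set (rat_chains N), iota_coarse_kernel R A) /\
    forall A : set (rat_chains N), iota_coarse_kernel R A ->
      kernel_coarsely_isomorphic A (@dual_norm R (Wspace R N) (@Wnorm R G N))).
Proof.
pose P := mixed_dualPair R normalN.
have dXE (c d : rat_chains N) : scl_dist R c d = dp_p (d := P) (c - d) by [].
have dYE (c d : rat_chains N) :
  scl_dist R (iotaQ c) (iotaQ d) = dp_q (d := P) (c - d) by [].
have kernel_iff := coarse_kernel_ex (P := P) dXE dYE.
have approx_iff : ball_approx P <-> closed (range (@restrict_hat R G N)).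
  rewrite closed_restrict_hat; split; first exact: ball_approx_closed.
  by move=> /closed_I_bounded; exact: I_bounded_approx.
split; [by rewrite -approx_iff|split=> [/approx_iff hP|fW]].
  exists (bikernel P); split; first exact: (dual_bikernel_isometry hP).
  move=> A kA; apply: (coarse_kernel_isomorphic (P := P) dXE dYE (E := fun F : bikernel P => val F)) kA.
  - by [].
  - exact: bikernel_mem.
  - by move=> F FV; exists (exist (fun H => H \in @bikernel_pred R P) F FV).
  - by [].
(* Finite dimension yields the uniform bound on [I] directly, so that closedness of the range
   follows instead of being assumed. *)
have hP : ball_approx P by apply: I_bounded_approx; exact: (@findim_I_bounded R P fW).
split; first exact/kernel_iff.
move=> A kA; apply: (coarse_kernel_isomorphic (P := P) dXE dYE
  (E := fun h : dual (Wspace R N) => @quotient_eval R P h)) kA.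
- by [].
- by move=> h; exact: (quotient_eval_bikernel hP h fW).
- by move=> F FV; exact: (@quotient_eval_surj R P F FV).
- by move=> h; apply: (@quotient_eval_norm R P h); exact: (quotient_eval_bikernel hP h fW).
Qed.
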